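(* Let $d\ge2$ be even. The $\mathbb C(u)$-algebra $Y_{d,n}^{B}(u)=\mathbb C(u)\otimes_{\mathbb C[u^{\pm1}]}Y_{d,n}^{B}$ is split (over $\mathbb C(u)$).
   Context: $u$ is an indeterminate. $Y^B_{d,n}$ ($n\ge2$) is the $\mathbb C[u^{\pm1}]$-algebra with generators $t_1,\dots,t_n,\xi_1,\dots,\xi_n$ and relations: (1) $t_jt_k=t_kt_j$; (2) $t_j^d=1$; (3) $\xi_i t_j=t_{r_i(H_j)}\xi_i$; (4) $\xi_i^2=u\,t_{H_{a_i}}^{d/2}+(1-u)e_i\xi_i$ with $e_i=\frac1d\sum_{j=1}^d t_{H_{a_i}}^j$; (5) $\xi_i\xi_j\cdots=\xi_j\xi_i\cdots$ ($m_{ij}$ factors each side, $m_{ij}$ the order of $r_ir_j$). Here $W_n$, the group of $n\times n$ signed permutation matrices, acts on $\bigoplus_j\mathbb Z H_j$ by signed permutations, $t_{\sum c_jH_j}=\prod t_j^{c_j}$, $r_1=\mathrm{Diag}(-1,1,\dots,1)$ with $H_{a_1}=2H_1$, and $r_{i+1}$ is the transposition $(i,i+1)$ with $H_{a_{i+1}}=\pm(H_i-H_{i+1})$ for $1\le i\le n-1$ (the sign is irrelevant). A finite-dimensional algebra is split over a field $k$ if every representation of it over an extension field $k'\supset k$ is obtained by extension of scalars from a representation defined over $k$ (equivalently, for a semisimple algebra, every irreducible representation over $k$ remains irreducible over every extension field). *)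

(* Defs.v *)
From HB Require Import structures.
From mathcomp Require Import all_boot all_order all_algebra generic_quotient.
From mathcomp Require Import boolp reals complex.

Set Implicit Arguments.
Unset Strict Implicit.
Unset Printing Implicit Defensive.

Import Order.TTheory GRing.Theory Num.Theory.
Local Open Scope ring_scope.
Local Open Scope quotient_scope.

(* F[u^{+-1}] is the subring { p / u^k } of F(u) = {fraction {poly F}}, with
   'X in the role of the indeterminate u. The inclusion is laurent_val. *)
Section Laurent.
Variable F : fieldType.

Local Notation "p %:F" := (tofrac p).

Definition is_laurent : {pred {fraction {poly F}}} :=
  [pred x | `[< exists (p : {poly F}) (k : nat), x = p%:F / 'X%:F ^+ k >]].

Lemma tofracX_neq0 k : 'X%:F ^+ k != 0 :> {fraction {poly F}}.
Proof. by rewrite expf_neq0 // tofrac_eq0 polyX_eq0. Qed.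

Lemma is_laurent_subring : subring_closed is_laurent.
Proof.
split=> [|x y /asboolP[p [k ->]] /asboolP[q [l ->]]
         |x y /asboolP[p [k ->]] /asboolP[q [l ->]]]; apply/asboolP.
- by exists 1, 0; rewrite rmorph1 expr0 divr1.
- exists (p * 'X ^+ l - q * 'X ^+ k), (k + l)%N.
  rewrite rmorphB !rmorphM !rmorphXn exprD mulrBl /=.
  by rewrite -mulf_div divff ?tofracX_neq0 // mulr1 [_ ^+ k * _]mulrC
             -mulf_div divff ?tofracX_neq0 // mulr1.
- by exists (p * q), (k + l)%N; rewrite rmorphM exprD mulf_div.
Qed.

HB.instance Definition _ :=
  GRing.isSubringClosed.Build _ is_laurent is_laurent_subring.

Record laurent : predArgType :=
  Laurent { laurent_val :> {fraction {poly F}};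
            laurentP : laurent_val \in is_laurent }.

HB.instance Definition _ := [isSub for laurent_val].
HB.instance Definition _ := [Choice of laurent by <:].
HB.instance Definition _ := [SubChoice_isSubComNzRing of laurent by <:].
HB.instance Definition _ := GRing.RMorphism.copy laurent_val (\val : laurent -> _).

Lemma poly_laurent (p : {poly F}) : p%:F \in is_laurent.
Proof. by apply/asboolP; exists p, 0; rewrite expr0 divr1. Qed.

Definition laurent_poly (p : {poly F}) : laurent := Laurent (poly_laurent p).

End Laurent.

(* Noncommutative polynomial expressions with coefficients in L in the
   generators X. *)
Inductive nc_expr (L X : Type) :=
| Gen of X
| Cst of L
| Add of nc_expr L X & nc_expr L X
| Mul of nc_expr L X & nc_expr L X.

Arguments Gen {L X}.
Arguments Cst {L X}.

Declare Scope nc_scope.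
Delimit Scope nc_scope with nc.
Bind Scope nc_scope with nc_expr.
Notation "x + y" := (Add x y) : nc_scope.
Notation "x * y" := (Mul x y) : nc_scope.

HB.instance Definition _ (L X : Type) := gen_eqMixin (nc_expr L X).
HB.instance Definition _ (L X : Type) := gen_choiceMixin (nc_expr L X).

Section Presentation.
Variables (L : comNzRingType) (X : Type).
Implicit Types (x y z : nc_expr L X) (c : L).

Definition nc_exp x (m : nat) : nc_expr L X := iter m (Mul x) (Cst 1).

Variable defrel : nc_expr L X -> nc_expr L X -> Prop.

(* The least congruence that contains defrel and whose quotient is an
   associative unital L-algebra. *)
Inductive nc_cong : nc_expr L X -> nc_expr L X -> Prop :=
| nc_refl x : nc_cong x x
| nc_sym x y : nc_cong x y -> nc_cong y x
| nc_trans y x z : nc_cong x y -> nc_cong y z -> nc_cong x z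
| nc_add x x' y y' : nc_cong x x' -> nc_cong y y' -> nc_cong (x + y) (x' + y')
| nc_mul x x' y y' : nc_cong x x' -> nc_cong y y' -> nc_cong (x * y) (x' * y')
| nc_addA x y z : nc_cong (x + (y + z)) (x + y + z)
| nc_addC x y : nc_cong (x + y) (y + x)
| nc_add0 x : nc_cong (Cst 0 + x) x
| nc_addN x : nc_cong (Cst (-1) * x + x) (Cst 0)
| nc_mulA x y z : nc_cong (x * (y * z)) (x * y * z)
| nc_mul1l x : nc_cong (Cst 1 * x) x
| nc_mul1r x : nc_cong (x * Cst 1) x
| nc_mulDl x y z : nc_cong ((x + y) * z) (x * z + y * z)
| nc_mulDr x y z : nc_cong (x * (y + z)) (x * y + x * z)
| nc_cstD c c' : nc_cong (Cst (c + c')%R) (Cst c + Cst c')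
| nc_cstM c c' : nc_cong (Cst (c * c')%R) (Cst c * Cst c')
| nc_cstC c x : nc_cong (Cst c * x) (x * Cst c)
| nc_rel x y : defrel x y -> nc_cong x y.

Definition nc_congb : rel (nc_expr L X) := fun x y => `[< nc_cong x y >].

Lemma nc_congb_refl : reflexive nc_congb.
Proof. by move=> x; apply/asboolP; apply: nc_refl. Qed.
Lemma nc_congb_sym : symmetric nc_congb.
Proof. by move=> x y; apply/asboolP/asboolP; apply: nc_sym. Qed.
Lemma nc_congb_trans : transitive nc_congb.
Proof.
by move=> y x z /asboolP xy /asboolP yz; apply/asboolP; apply: nc_trans yz.
Qed.

Canonical nc_equiv := EquivRel nc_congb nc_congb_refl nc_congb_sym
  nc_congb_trans.

Definition presented : Type := {eq_quot nc_equiv}.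
HB.instance Definition _ := Choice.on presented.
HB.instance Definition _ : EqQuotient _ nc_equiv presented :=
  EqQuotient.on presented.

Definition nc_class (x : nc_expr L X) : presented := \pi_presented x.

Lemma nc_classP x y : nc_class x = nc_class y <-> nc_cong x y.
Proof. by split=> [/eqmodP/asboolP//|h]; apply/eqmodP/asboolP. Qed.

Lemma nc_class_repr (a : presented) : nc_class (repr a) = a.
Proof. exact: reprK. Qed.

Lemma nc_repr_class x : nc_cong (repr (nc_class x)) x.
Proof. by apply/nc_classP; rewrite nc_class_repr. Qed.

Lemma nc_classW (P : presented -> Prop) :
  (forall x, P (nc_class x)) -> forall a, P a.
Proof. by move=> h a; rewrite -(nc_class_repr a). Qed.

Definition pres_add (a b : presented) := nc_class (repr a + repr b).
Definition pres_mul (a b : presented) := nc_class (repr a * repr b).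
Definition pres_scale c (a : presented) := nc_class (Cst c * repr a).

Lemma pres_addE x y : pres_add (nc_class x) (nc_class y) = nc_class (x + y).
Proof. by apply/nc_classP/nc_add; apply: nc_repr_class. Qed.
Lemma pres_mulE x y : pres_mul (nc_class x) (nc_class y) = nc_class (x * y).
Proof. by apply/nc_classP/nc_mul; apply: nc_repr_class. Qed.
Lemma pres_scaleE c x : pres_scale c (nc_class x) = nc_class (Cst c * x).
Proof. by apply/nc_classP/nc_mul; [apply: nc_refl|apply: nc_repr_class]. Qed.

Let presE := (pres_addE, pres_mulE, pres_scaleE).

Fact pres_addA : associative pres_add.
Proof.
elim/nc_classW=> x; elim/nc_classW=> y; elim/nc_classW=> z.
by rewrite !presE; apply/nc_classP/nc_addA.
Qed.
Fact pres_addC : commutative pres_add.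
Proof.
elim/nc_classW=> x; elim/nc_classW=> y.
by rewrite !presE; apply/nc_classP/nc_addC.
Qed.
Fact pres_add0 : left_id (nc_class (Cst 0)) pres_add.
Proof. by elim/nc_classW=> x; rewrite !presE; apply/nc_classP/nc_add0. Qed.
Fact pres_addN : left_inverse (nc_class (Cst 0)) (pres_scale (-1)) pres_add.
Proof. by elim/nc_classW=> x; rewrite !presE; apply/nc_classP/nc_addN. Qed.

HB.instance Definition _ := GRing.isZmodule.Build presented
  pres_addA pres_addC pres_add0 pres_addN.

Fact pres_mulA : associative pres_mul.
Proof.
elim/nc_classW=> x; elim/nc_classW=> y; elim/nc_classW=> z.
by rewrite !presE; apply/nc_classP/nc_mulA.
Qed.
Fact pres_mul1l : left_id (nc_class (Cst 1)) pres_mul.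
Proof. by elim/nc_classW=> x; rewrite !presE; apply/nc_classP/nc_mul1l. Qed.
Fact pres_mul1r : right_id (nc_class (Cst 1)) pres_mul.
Proof. by elim/nc_classW=> x; rewrite !presE; apply/nc_classP/nc_mul1r. Qed.
Fact pres_mulDl : left_distributive pres_mul +%R.
Proof.
elim/nc_classW=> x; elim/nc_classW=> y; elim/nc_classW=> z.
by rewrite /GRing.add /= !presE; apply/nc_classP/nc_mulDl.
Qed.
Fact pres_mulDr : right_distributive pres_mul +%R.
Proof.
elim/nc_classW=> x; elim/nc_classW=> y; elim/nc_classW=> z.
by rewrite /GRing.add /= !presE; apply/nc_classP/nc_mulDr.
Qed.

HB.instance Definition _ := GRing.Zmodule_isPzRing.Build presented
  pres_mulA pres_mul1l pres_mul1r pres_mulDl pres_mulDr.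

Fact pres_scaleA c c' (a : presented) :
  pres_scale c (pres_scale c' a) = pres_scale (c * c') a.
Proof.
elim/nc_classW: a => x; rewrite !presE; apply/nc_classP.
by apply: nc_trans (nc_mulA _ _ _) _; apply: nc_mul (nc_refl _);
  apply/nc_sym/nc_cstM.
Qed.
Fact pres_scale1 : left_id 1 pres_scale.
Proof. by elim/nc_classW=> x; rewrite !presE; apply/nc_classP/nc_mul1l. Qed.
Fact pres_scaleDr : right_distributive pres_scale +%R.
Proof.
move=> c; elim/nc_classW=> x; elim/nc_classW=> y.
by rewrite /GRing.add /= !presE; apply/nc_classP/nc_mulDr.
Qed.
Fact pres_scaleDl (a : presented) :
  {morph pres_scale^~ a : c c' / c + c' >-> c + c'}.
Proof.
elim/nc_classW: a => x c c'; rewrite [RHS]/GRing.add /= !presE; apply/nc_classP.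
by apply: nc_trans (nc_mulDl _ _ _); apply: nc_mul (nc_refl _); apply: nc_cstD.
Qed.

HB.instance Definition _ := GRing.Zmodule_isLmodule.Build L presented
  pres_scaleA pres_scale1 pres_scaleDr pres_scaleDl.

Lemma pres_scalerAl c (a b : presented) : c *: (a * b) = (c *: a) * b.
Proof.
elim/nc_classW: a => x; elim/nc_classW: b => y.
by rewrite /GRing.mul /GRing.scale /= !presE; apply/nc_classP/nc_mulA.
Qed.
Lemma pres_scalerAr c (a b : presented) : c *: (a * b) = a * (c *: b).
Proof.
elim/nc_classW: a => x; elim/nc_classW: b => y.
rewrite /GRing.mul /GRing.scale /= !presE; apply/nc_classP.
apply: nc_trans (nc_mulA _ _ _) _; apply: nc_trans (nc_sym (nc_mulA _ _ _)).
by apply: nc_mul (nc_refl _); apply: nc_cstC.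
Qed.

(* The augmentation sending every generator to 1 is a witness that 1 != 0. *)
Fixpoint nc_aug x : L :=
  match x with
  | Gen _ => 1
  | Cst c => c
  | (y + z)%nc => nc_aug y + nc_aug z
  | (y * z)%nc => nc_aug y * nc_aug z
  end.

Hypothesis aug_rel : forall x y, defrel x y -> nc_aug x = nc_aug y.

Lemma nc_aug_cong x y : nc_cong x y -> nc_aug x = nc_aug y.
Proof.
elim=> //=.
- by move=> y' x' z' _ -> _ ->.
- by move=> x' x'' y' y'' _ -> _ ->.
- by move=> x' x'' y' y'' _ -> _ ->.
- by move=> *; rewrite addrA.
- by move=> *; rewrite addrC.
- by move=> *; rewrite add0r.
- by move=> *; rewrite mulN1r addNr.
- by move=> *; rewrite mulrA.
- by move=> *; rewrite mul1r.
- by move=> *; rewrite mulr1.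
- by move=> *; rewrite mulrDl.
- by move=> *; rewrite mulrDr.
- by move=> *; rewrite mulrC.
Qed.

Definition pres_aug (a : presented) : L := nc_aug (repr a).

Lemma pres_augE x : pres_aug (nc_class x) = nc_aug x.
Proof. exact/nc_aug_cong/nc_repr_class. Qed.

Lemma pres_aug1 : pres_aug 1 = 1.
Proof. exact: pres_augE. Qed.

Lemma pres_augD (a b : presented) : pres_aug (a + b) = pres_aug a + pres_aug b.
Proof.
elim/nc_classW: a => x; elim/nc_classW: b => y.
by rewrite [X in pres_aug X]/GRing.add /= pres_addE !pres_augE.
Qed.

Lemma pres_augZ c (a : presented) : pres_aug (c *: a) = c * pres_aug a.
Proof.
elim/nc_classW: a => x.
by rewrite [X in pres_aug X]/GRing.scale /= pres_scaleE !pres_augE.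
Qed.

Lemma pres_neq0 : (1 : presented) != 0.
Proof.
apply/eqP => /(congr1 pres_aug).
by rewrite pres_aug1 [RHS]pres_augE => /eqP; rewrite oner_eq0.
Qed.

End Presentation.

(* K (x)_L A for f : L -> K: formal sums of pure tensors k (x) a, encoded
   as lists of pairs, modulo the balanced bilinearity relations. *)
Section BaseChange.
Variables (L K : comNzRingType) (f : {rmorphism L -> K}) (A : algType L).
Implicit Types (s t : seq (K * A)) (k : K) (a : A).

Inductive tens_cong : seq (K * A) -> seq (K * A) -> Prop :=
| tens_refl s : tens_cong s s
| tens_sym s t : tens_cong s t -> tens_cong t s
| tens_trans t s v : tens_cong s t -> tens_cong t v -> tens_cong s v
| tens_cat s s' t t' :
    tens_cong s s' -> tens_cong t t' -> tens_cong (s ++ t) (s' ++ t')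
| tens_catC s t : tens_cong (s ++ t) (t ++ s)
| tens_0l a : tens_cong [:: (0, a)] [::]
| tens_Dl k k' a : tens_cong [:: (k + k', a)] [:: (k, a); (k', a)]
| tens_Dr k a a' : tens_cong [:: (k, a + a')] [:: (k, a); (k, a')]
| tens_bal k c a : tens_cong [:: (k * f c, a)] [:: (k, c *: a)].

Definition tens_congb : rel (seq (K * A)) := fun s t => `[< tens_cong s t >].

Lemma tens_congb_refl : reflexive tens_congb.
Proof. by move=> x; apply/asboolP; apply: tens_refl. Qed.
Lemma tens_congb_sym : symmetric tens_congb.
Proof. by move=> x y; apply/asboolP/asboolP; apply: tens_sym. Qed.
Lemma tens_congb_trans : transitive tens_congb.
Proof.
by move=> y x z /asboolP xy /asboolP yz; apply/asboolP; apply: tens_trans yz.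
Qed.

Canonical tens_equiv := EquivRel tens_congb tens_congb_refl tens_congb_sym
  tens_congb_trans.

Definition base_change : Type := {eq_quot tens_equiv}.
HB.instance Definition _ := Choice.on base_change.
HB.instance Definition _ : EqQuotient _ tens_equiv base_change :=
  EqQuotient.on base_change.

Definition tens_class (s : seq (K * A)) : base_change := \pi_base_change s.

Definition tens k a : base_change := tens_class [:: (k, a)].

Lemma tens_classP s t : tens_class s = tens_class t <-> tens_cong s t.
Proof. by split=> [/eqmodP/asboolP//|h]; apply/eqmodP/asboolP. Qed.

Lemma tens_class_repr (x : base_change) : tens_class (repr x) = x.
Proof. exact: reprK. Qed.

Lemma tens_repr_class s : tens_cong (repr (tens_class s)) s.
Proof. by apply/tens_classP; rewrite tens_class_repr. Qed.

Lemma tens_classW (P : base_change -> Prop) :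
  (forall s, P (tens_class s)) -> forall x, P x.
Proof. by move=> h x; rewrite -(tens_class_repr x). Qed.

Lemma tens_catACA s t s' t' :
  tens_cong ((s ++ t) ++ (s' ++ t')) ((s ++ s') ++ (t ++ t')).
Proof.
rewrite -!catA; apply: tens_cat (tens_refl _) _; rewrite !catA.
by apply: tens_cat (tens_refl _); apply: tens_catC.
Qed.

Definition tens_bind (g : K * A -> seq (K * A)) s := flatten (map g s).

Lemma tens_bind_cong (g : K * A -> seq (K * A)) s s' :
  (forall a, tens_cong (g (0, a)) [::]) ->
  (forall k k' a, tens_cong (g (k + k', a)) (g (k, a) ++ g (k', a))) ->
  (forall k a a', tens_cong (g (k, a + a')) (g (k, a) ++ g (k, a'))) ->
  (forall k c a, tens_cong (g (k * f c, a)) (g (k, c *: a))) ->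
  tens_cong s s' -> tens_cong (tens_bind g s) (tens_bind g s').
Proof.
move=> g0 gDl gDr gb; rewrite /tens_bind.
elim=> {s s'} [s|s t _|t s v _ st _|s s' t t' _ ss' _ tt'|s t|a|k k' a|k a a'
  |k c a] /=; rewrite ?map_cat ?flatten_cat ?cats0 //.
- exact: tens_refl.
- exact: tens_sym.
- exact: tens_trans.
- exact: tens_cat.
- exact: tens_catC.
Qed.

Lemma tens_bind_split (g h1 h2 : K * A -> seq (K * A)) s :
  (forall x, tens_cong (g x) (h1 x ++ h2 x)) ->
  tens_cong (tens_bind g s) (tens_bind h1 s ++ tens_bind h2 s).
Proof.
move=> gh; elim: s => [|x s IH] /=; first exact: tens_refl.
by apply: tens_trans (tens_cat (gh x) IH) (tens_catACA _ _ _ _).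
Qed.

Lemma tens_bind_ext (g h : K * A -> seq (K * A)) s :
  (forall x, tens_cong (g x) (h x)) ->
  tens_cong (tens_bind g s) (tens_bind h s).
Proof.
by move=> gh; elim: s => [|x s IH] /=; [apply: tens_refl|apply: tens_cat].
Qed.

Definition tens_mul s t : seq (K * A) :=
  [seq (x.1 * y.1, x.2 * y.2) | x <- s, y <- t].
Definition tens_scale k s : seq (K * A) := [seq (k * x.1, x.2) | x <- s].

Lemma map_bind (h : K * A -> K * A) s : map h s = tens_bind (fun x => [:: h x]) s.
Proof. by elim: s => //= x s ->. Qed.

Lemma tens_mulEr s t :
  tens_mul s t = tens_bind
    (fun x => tens_bind (fun y => [:: (x.1 * y.1, x.2 * y.2)]) t) s.
Proof.
by rewrite /tens_mul /tens_bind; congr flatten; apply: eq_map => x;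
  rewrite map_bind.
Qed.

Lemma tens_bind_nil (g : K * A -> seq (K * A)) s :
  (forall x, tens_cong (g x) [::]) -> tens_cong (tens_bind g s) [::].
Proof.
move=> g0; elim: s => [|x s IH] /=; first exact: tens_refl.
by apply: (@tens_trans ([::] ++ [::])) (tens_refl _); apply: tens_cat.
Qed.

Lemma tens_mul_congl s s' t :
  tens_cong s s' -> tens_cong (tens_mul s t) (tens_mul s' t).
Proof.
rewrite !tens_mulEr => ss'; apply: tens_bind_cong ss' => /=.
- by move=> a; apply: tens_bind_nil => y; rewrite mul0r; apply: tens_0l.
- move=> k k' a; apply: tens_bind_split => y /=.
  by rewrite mulrDl; apply: tens_Dl.
- move=> k a a'; apply: tens_bind_split => y /=.
  by rewrite mulrDl; apply: tens_Dr.
- move=> k c a; apply: tens_bind_ext => y /=.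
  by rewrite mulrAC -scalerAl; apply: tens_bal.
Qed.

Lemma tens_mul_congr s t t' :
  tens_cong t t' -> tens_cong (tens_mul s t) (tens_mul s t').
Proof.
rewrite !tens_mulEr => tt'; apply: tens_bind_ext => x.
apply: tens_bind_cong tt' => /=.
- by move=> a; rewrite mulr0; apply: tens_0l.
- by move=> k k' a; rewrite mulrDr; apply: tens_Dl.
- by move=> k a a'; rewrite mulrDr; apply: tens_Dr.
- by move=> k c a; rewrite mulrA -scalerAr; apply: tens_bal.
Qed.

Lemma tens_scale_cong k s s' :
  tens_cong s s' -> tens_cong (tens_scale k s) (tens_scale k s').
Proof.
rewrite /tens_scale !map_bind => ss'; apply: tens_bind_cong ss' => /=.
- by move=> a; rewrite mulr0; apply: tens_0l.
- by move=> k1 k2 a; rewrite mulrDr; apply: tens_Dl.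
- by move=> k1 a a'; apply: tens_Dr.
- by move=> k1 c a; rewrite mulrA; apply: tens_bal.
Qed.

Definition bc_add (x y : base_change) := tens_class (repr x ++ repr y).
Definition bc_mul (x y : base_change) := tens_class (tens_mul (repr x) (repr y)).
Definition bc_scale k (x : base_change) := tens_class (tens_scale k (repr x)).

Lemma bc_addE s t : bc_add (tens_class s) (tens_class t) = tens_class (s ++ t).
Proof. by apply/tens_classP/tens_cat; apply: tens_repr_class. Qed.
Lemma bc_mulE s t :
  bc_mul (tens_class s) (tens_class t) = tens_class (tens_mul s t).
Proof.
apply/tens_classP; apply: tens_trans (tens_mul_congl _ (tens_repr_class s)) _.
exact/tens_mul_congr/tens_repr_class.
Qed.
Lemma bc_scaleE k s :
  bc_scale k (tens_class s) = tens_class (tens_scale k s).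
Proof. exact/tens_classP/tens_scale_cong/tens_repr_class. Qed.

Let bcE := (bc_addE, bc_mulE, bc_scaleE).

Fact bc_addA : associative bc_add.
Proof.
elim/tens_classW=> s; elim/tens_classW=> t; elim/tens_classW=> v.
by rewrite !bcE catA.
Qed.
Fact bc_addC : commutative bc_add.
Proof.
elim/tens_classW=> s; elim/tens_classW=> t.
by rewrite !bcE; apply/tens_classP/tens_catC.
Qed.
Fact bc_add0 : left_id (tens_class [::]) bc_add.
Proof. by elim/tens_classW=> s; rewrite !bcE. Qed.
Fact bc_addN : left_inverse (tens_class [::]) (bc_scale (-1)) bc_add.
Proof.
elim/tens_classW=> s; rewrite !bcE; apply/tens_classP.
have h : tens_cong (tens_bind (fun x => [:: (-1 * x.1, x.2)] ++ [:: x]) s)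
                   (tens_scale (-1) s ++ s).
  rewrite /tens_scale map_bind -[X in _ ++ X]map_id map_bind.
  by apply: tens_bind_split => x; apply: tens_refl.
apply: tens_trans (tens_sym h) _; apply: tens_bind_nil => -[k a] /=.
by apply: tens_trans (tens_sym (tens_Dl _ _ _)) _; rewrite mulN1r addNr;
  apply: tens_0l.
Qed.

HB.instance Definition _ := GRing.isZmodule.Build base_change
  bc_addA bc_addC bc_add0 bc_addN.

Lemma tens_mul_cat s s' t : tens_mul (s ++ s') t = tens_mul s t ++ tens_mul s' t.
Proof. exact: allpairs_cat. Qed.

Fact bc_mulA : associative bc_mul.
Proof.
elim/tens_classW=> s; elim/tens_classW=> t; elim/tens_classW=> v.
rewrite !bcE; congr tens_class.
elim: s => //= x s IH; rewrite -[x :: s]cat1s !tens_mul_cat IH.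
congr (_ ++ _); rewrite /tens_mul /= !cats0.
elim: t {IH} => //= y t IH; rewrite map_cat IH; congr (_ ++ _).
by rewrite -map_comp; apply: eq_map => z /=; rewrite !mulrA.
Qed.
Fact bc_mul1l : left_id (tens 1 1) bc_mul.
Proof.
elim/tens_classW=> s; rewrite !bcE; congr tens_class; rewrite /tens_mul /= cats0.
by rewrite -[RHS]map_id; apply: eq_map => -[k a]; rewrite !mul1r.
Qed.
Fact bc_mul1r : right_id (tens 1 1) bc_mul.
Proof.
elim/tens_classW=> s; rewrite !bcE; congr tens_class; rewrite /tens_mul.
by elim: s => //= -[k a] s ->; rewrite !mulr1.
Qed.
Fact bc_mulDl : left_distributive bc_mul +%R.
Proof.
elim/tens_classW=> s; elim/tens_classW=> t; elim/tens_classW=> v.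
by rewrite /GRing.add /= !bcE tens_mul_cat.
Qed.
Fact bc_mulDr : right_distributive bc_mul +%R.
Proof.
elim/tens_classW=> s; elim/tens_classW=> t; elim/tens_classW=> v.
rewrite /GRing.add /= !bcE; apply/tens_classP; rewrite !tens_mulEr.
apply: tens_bind_split => x.
by rewrite /tens_bind map_cat flatten_cat; apply: tens_refl.
Qed.

HB.instance Definition _ := GRing.Zmodule_isPzRing.Build base_change
  bc_mulA bc_mul1l bc_mul1r bc_mulDl bc_mulDr.

Fact bc_scaleA k k' (x : base_change) :
  bc_scale k (bc_scale k' x) = bc_scale (k * k') x.
Proof.
elim/tens_classW: x => s; rewrite !bcE /tens_scale -map_comp.
by congr tens_class; apply: eq_map => y /=; rewrite mulrA.
Qed.
Fact bc_scale1 : left_id 1 bc_scale.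
Proof.
elim/tens_classW=> s; rewrite !bcE /tens_scale; congr tens_class.
by rewrite -[RHS]map_id; apply: eq_map => -[k a]; rewrite mul1r.
Qed.
Fact bc_scaleDr : right_distributive bc_scale +%R.
Proof.
move=> k; elim/tens_classW=> s; elim/tens_classW=> t.
by rewrite /GRing.add /= !bcE /tens_scale map_cat.
Qed.
Fact bc_scaleDl (x : base_change) :
  {morph bc_scale^~ x : k k' / k + k' >-> k + k'}.
Proof.
elim/tens_classW: x => s k k'; rewrite [RHS]/GRing.add /= !bcE; apply/tens_classP.
rewrite /tens_scale !map_bind; apply: tens_bind_split => y /=.
by rewrite mulrDl; apply: tens_Dl.
Qed.

HB.instance Definition _ := GRing.Zmodule_isLmodule.Build K base_change
  bc_scaleA bc_scale1 bc_scaleDr bc_scaleDl.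

Lemma bc_scalerAl k (x y : base_change) : k *: (x * y) = (k *: x) * y.
Proof.
elim/tens_classW: x => s; elim/tens_classW: y => t.
rewrite /GRing.mul /GRing.scale /= !bcE; congr tens_class.
rewrite /tens_mul /tens_scale map_allpairs allpairs_mapl.
by congr flatten; apply: eq_map => x; apply: eq_map => y /=; rewrite mulrA.
Qed.
Lemma bc_scalerAr k (x y : base_change) : k *: (x * y) = x * (k *: y).
Proof.
elim/tens_classW: x => s; elim/tens_classW: y => t.
rewrite /GRing.mul /GRing.scale /= !bcE; congr tens_class.
rewrite /tens_mul /tens_scale map_allpairs allpairs_mapr.
by congr flatten; apply: eq_map => x; apply: eq_map => y /=; rewrite mulrCA.
Qed.

Lemma bc_neq0 (g : A -> K) :
  g 1 = 1 -> {morph g : a b / a + b} -> (forall c a, g (c *: a) = f c * g a) ->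
  (1 : base_change) != 0.
Proof.
move=> g1 gD gZ; pose h (s : seq (K * A)) := \sum_(x <- s) x.1 * g x.2.
have hP s t : tens_cong s t -> h s = h t.
  elim=> {s t} [s|s t _|t s v _ -> _|s s' t t' _ ss' _ tt'|s t|a|k k' a|k a a'
    |k c a] //; rewrite /h ?big_cat ?big_cons ?big_nil ?addr0 /=.
  - exact: congr2.
  - exact: addrC.
  - exact: mul0r.
  - exact: mulrDl.
  - by rewrite gD mulrDr.
  - by rewrite gZ mulrA.
apply/eqP => /tens_classP/hP; rewrite /h big_seq1 big_nil /= g1 mulr1.
by move/eqP; rewrite oner_eq0.
Qed.

End BaseChange.

Definition finite_dimensional (k : fieldType) (A : algType k) : Prop :=
  exists s : seq A, forall a : A,
    exists c : 'I_(size s) -> k, a = \sum_(i < size s) c i *: s`_i.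

(* A representation over the extension iota : k -> k' is a homomorphism of
   unital rings A -> 'M[k']_m that is k-linear through iota; it is obtained
   by extension of scalars when it is equivalent to the image under iota of
   a representation A -> 'M[k]_m. *)
Definition split_algebra (k : fieldType) (A : algType k) : Prop :=
  finite_dimensional A /\
  forall (k' : fieldType) (iota : {rmorphism k -> k'}) (m : nat)
    (rho : {lrmorphism A -> 'M[k']_m | iota \; *:%R}),
  exists (sigma : {lrmorphism A -> 'M[k]_m}) (P : 'M[k']_m),
    P \in unitmx /\ forall a, P *m rho a = map_mx iota (sigma a) *m P.

(* Indices are shifted: the ordinal 0 stands for 1, so r_1 is typeB_refl 0,
   and for i > 0 the reflection typeB_refl i transposes i - 1 = ord_pred i
   and i. The lattice with basis H_1, ..., H_n is 'cV[int]_n. *)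
Section TypeB.
Variable n : nat.

Definition coweight (j : 'I_n) : 'cV[int]_n := delta_mx j 0.

Definition typeB_refl (i : 'I_n) : 'M[int]_n :=
  if val i == 0%N then diag_mx (\row_j (if j == i then -1 else 1))
  else tperm_mx (ord_pred i) i.

Definition coroot (i : 'I_n) : 'cV[int]_n :=
  if val i == 0%N then 2 *: coweight i else coweight (ord_pred i) - coweight i.

Definition has_order (w : 'M[int]_n) (m : nat) : Prop :=
  [/\ (0 < m)%N, w ^+ m = 1 & forall l, (0 < l < m)%N -> w ^+ l <> 1].

End TypeB.

(* Generators: inl j is t_j and inr i is xi_i. *)
Section YokonumaB.
Variables (F : numFieldType) (d n : nat).

Local Notation L := (laurent F).
Local Notation expr := (nc_expr L ('I_n + 'I_n)).

Definition Yu : L := laurent_poly 'X.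

Definition Yt (j : 'I_n) : expr := Gen (inl j).
Definition Yxi (i : 'I_n) : expr := Gen (inr i).

(* t_H = prod_j t_j ^ c_j for H = sum_j c_j H_j. Because t_j ^ d = 1, the
   integer exponent c_j is replaced by its residue modulo d in [0, d). *)
Definition YtH (H : 'cV[int]_n) : expr :=
  \big[@Mul _ _/Cst 1]_(j < n) nc_exp (Yt j) `|(H j 0%R %% d)%Z|%N.

Definition Ye (i : 'I_n) : expr :=
  (Cst (laurent_poly (d%:R^-1)%:P) *
   \big[@Add _ _/Cst 0%R]_(1 <= j < d.+1) nc_exp (YtH (coroot i)) j)%nc.

Definition Yalt (i j : 'I_n) (m : nat) : expr :=
  \big[@Mul _ _/Cst 1]_(k < m) Yxi (if odd k then j else i).

Inductive Yrel : expr -> expr -> Prop :=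
| Yrel_tC j k : Yrel (Yt j * Yt k) (Yt k * Yt j)
| Yrel_td j : Yrel (nc_exp (Yt j) d) (Cst 1)
| Yrel_xit i j :
    Yrel (Yxi i * Yt j) (YtH (typeB_refl i *m coweight j) * Yxi i)
| Yrel_xi2 i :
    Yrel (Yxi i * Yxi i)
         (Cst Yu * nc_exp (YtH (coroot i)) d./2
          + Cst (1 - Yu)%R * (Ye i * Yxi i))
| Yrel_braid i j m : has_order (typeB_refl i * typeB_refl j)%R m ->
    Yrel (Yalt i j m) (Yalt j i m).

Lemma nc_aug_exp (x : expr) m : nc_aug x = 1 -> nc_aug (nc_exp x m) = 1.
Proof. by move=> x1; elim: m => //= m ->; rewrite x1 mulr1. Qed.

Lemma nc_aug_prod I (r : seq I) (x : I -> expr) :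
  (forall i, nc_aug (x i) = 1) ->
  nc_aug (\big[@Mul _ _/Cst 1]_(i <- r) x i) = 1.
Proof.
by move=> x1; elim/big_rec: _ => //= i y _ ->; rewrite x1 mulr1.
Qed.

Lemma nc_aug_tH H : nc_aug (YtH H) = 1.
Proof. by apply: nc_aug_prod => j; apply: nc_aug_exp. Qed.

Lemma nc_aug_e (d_gt0 : (0 < d)%N) i : nc_aug (Ye i) = 1.
Proof.
rewrite /= (big_morph (@nc_aug L _) (id1 := 0) (op1 := +%R)) //.
under eq_bigr => j _ do rewrite nc_aug_exp ?nc_aug_tH //.
rewrite sumr_const_nat subn1 /=; apply: val_inj => /=.
transitivity (tofrac ((d%:R^-1)%:P * d%:R : {poly F})).
  by rewrite rmorphM !rmorph_nat.
by rewrite -polyC_natr -polyCM mulVf ?pnatr_eq0 -?lt0n ?rmorph1.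
Qed.

Lemma Yrel_aug (d_gt0 : (0 < d)%N) x y : Yrel x y -> nc_aug x = nc_aug y.
Proof.
case=> [j k|j|i j|i|i j m _]; last by rewrite !nc_aug_prod.
- by [].
- by rewrite nc_aug_exp.
- by rewrite /= nc_aug_tH.
transitivity (Yu * nc_aug (nc_exp (YtH (coroot i)) d./2)
              + (1 - Yu) * (nc_aug (Ye i) * 1)); last by [].
by rewrite [LHS]/= nc_aug_e //
           nc_aug_exp ?nc_aug_tH // !mulr1 addrCA subrr addr0.
Qed.

(* The hypothesis 0 < d only serves to prove that 1 != 0, which algType needs. *)
Definition YB of (0 < d)%N : Type := presented Yrel.

HB.instance Definition _ (h : (0 < d)%N) := GRing.PzRing.on (YB h).
HB.instance Definition _ (h : (0 < d)%N) := GRing.Lmodule.on (YB h).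
HB.instance Definition _ (h : (0 < d)%N) :=
  GRing.PzSemiRing_isNonZero.Build (YB h) (pres_neq0 (@Yrel_aug h)).
HB.instance Definition _ (h : (0 < d)%N) :=
  GRing.Lmodule_isLalgebra.Build L (YB h) (@pres_scalerAl _ _ _).
HB.instance Definition _ (h : (0 < d)%N) :=
  GRing.Lalgebra_isAlgebra.Build L (YB h) (@pres_scalerAr _ _ _).

(* Y^B_{d,n}(u) = F(u) (x)_{F[u^{+-1}]} Y^B_{d,n}. *)
Definition YBu (h : (0 < d)%N) : Type :=
  base_change (@laurent_val F : {rmorphism L -> {fraction {poly F}}}) (YB h).

Lemma YBu_neq0 (h : (0 < d)%N) :
  (1 : base_change (@laurent_val F : {rmorphism L -> {fraction {poly F}}})
         (YB h)) != 0.
Proof.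
apply: (@bc_neq0 _ _ _ _ (fun a : YB h => laurent_val (pres_aug a))).
- by rewrite (pres_aug1 (@Yrel_aug h)).
- by move=> a b; rewrite (pres_augD (@Yrel_aug h)).
- by move=> c a; rewrite (pres_augZ (@Yrel_aug h)).
Qed.

HB.instance Definition _ (h : (0 < d)%N) := GRing.PzRing.on (YBu h).
HB.instance Definition _ (h : (0 < d)%N) := GRing.Lmodule.on (YBu h).
HB.instance Definition _ (h : (0 < d)%N) :=
  GRing.PzSemiRing_isNonZero.Build (YBu h) (YBu_neq0 h).
HB.instance Definition _ (h : (0 < d)%N) :=
  GRing.Lmodule_isLalgebra.Build {fraction {poly F}} (YBu h)
    (@bc_scalerAl _ _ _ _).
HB.instance Definition _ (h : (0 < d)%N) :=
  GRing.Lalgebra_isAlgebra.Build {fraction {poly F}} (YBu h)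
    (@bc_scalerAr _ _ _ _).

End YokonumaB.

(* Main.v *)
From HB Require Import structures.
Require Import Defs.
From mathcomp Require Import all_boot all_order all_algebra.
From mathcomp Require Import reals complex.
From mathcomp Require Import perm cyclic separable cyclotomic.
From mathcomp Require Import boolp.
From mathcomp Require Import zify ring.

Set Implicit Arguments.
Unset Strict Implicit.
Unset Printing Implicit Defensive.

Import Order.TTheory GRing.Theory Num.Theory.
Local Open Scope ring_scope.

(** The algebra is a direct sum of matrix algebras over K = C(u), and such a
sum is split: in a representation over any extension field the diagonal matrix
units act as orthogonal idempotents with sum 1; a basis of the range of one of
them for each block, transported by the other matrix units, is a basis in which
every matrix unit acts by a matrix of zeros and ones ([matrix_units_split]).

The matrix units come from a seminormal representation with coefficients in K,
on functions of standard words. A standard word is a list of n letters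
(z, (e, a)). The letter at position j says that t_j has the eigenvalue omega^z,
where omega is a primitive d-th root of unity, and that a box of content a is
added to a Young diagram; two words have the same shape when they end with the
same diagrams. The Weyl group replaces z by -z, so the diagrams are indexed by
classes {z, -z}: in the stabilizer of the eigenvalues, a class with z = -z
modulo d contributes a factor of type B, whose representations need two diagrams, told
apart by e; a class with z <> -z contributes a symmetric group, one diagram is
enough, and each letter is free to carry z or -z. A square root of u, which K
does not contain, would enter only if xi_i, with xi_i^2 = u or -u, were
normalized symmetrically between two eigenspaces of the t_j that it exchanges.
Only the product of the two coefficients is prescribed, and both can be taken
in K. The defining relations then come down to rational identities in at most
three content values u^a or -u^(a+1) ([act_cong]).

Polynomials in the t_j and in the Jucys-Murphy elements separate the standard
words ([diagonal_separate]), because u is transcendental over C; the xi_i and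
the Jucys-Murphy elements connect any two standard words of one shape
([connect_std]). Hence the image contains every matrix unit between two words
of one shape ([matrix_unit_exists]).

It remains to see that the representation is faithful, and this is a count. The
tuples of diagrams form a differential poset, which gives (2d)^n n! pairs of
standard words of one shape ([sum_num_std]). The algebra is spanned by equally
many normal forms ([normal_forms_spanning]). Elements lifting the matrix units
are linearly independent, so they form a basis and the representation is
faithful; hence they multiply as matrix units in the algebra itself
([YBu_split]). *)

(** * Words of letters and their shapes *)

(** The letter (z, (e, a)) stands for a box of content a in the diagram with index
(z, e). The exponent z < d of an eigenvalue comes unreduced in words; shapes are
lists of letters whose z represents its class {z, -z}. *)
Definition letter : Type := (nat * (bool * int))%type.

Definition shift (k : letter) (b : int) : letter := (k.1, (k.2.1, k.2.2 + b)).

(** A list of letters is read as a tuple of Young diagrams, each known by the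
lengths m(a) of its diagonals. A box of content a > 0 fits on the diagonal a
when the diagonal a - 1 is one longer than the diagonal a and the diagonal
a + 1 is as long as it; a = 0 and a < 0 are similar. *)
Definition addable (l : seq letter) (k : letter) : bool :=
  (count_mem (shift k (-1)) l == count_mem k l + (0 < k.2.2)%R)%N &&
  (count_mem (shift k 1) l == count_mem k l + (k.2.2 < 0)%R)%N.

Definition removable (l : seq letter) (k : letter) : bool :=
  (k \in l) && addable (rem k l) k.

(** Boxes that are far can be added in either order. *)
Definition far (k k' : letter) : bool :=
  ~~ [&& k.1 == k'.1, k.2.1 == k'.2.1 & `|k.2.2 - k'.2.2|%N <= 1]%N.

(** Diagonal lengths come from a partition exactly when they decrease by steps of
at most one away from the main diagonal. *)
Definition diagram (l : seq letter) : Prop := forall c e (a : int),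
  let m b := count_mem (c, (e, b)) l in
  (0 <= a -> (m (a + 1)%R <= m a)%N /\ (m a <= (m (a + 1)%R).+1)%N) /\
  (a <= 0 -> (m (a - 1)%R <= m a)%N /\ (m a <= (m (a - 1)%R).+1)%N).

Lemma addable_perm l l' k : perm_eq l l' -> addable l k = addable l' k.
Proof. by move=> /seq.permP h; rewrite /addable !h. Qed.

Lemma pair_eqb (c c' : nat) (e e' : bool) (a a' : int) :
  ((c, (e, a)) == (c', (e', a')) :> letter) = [&& c == c', e == e' & a == a'].
Proof. by []. Qed.

Lemma far_sym k k' : far k k' = far k' k.
Proof.
by rewrite /far (eq_sym k.1) (eq_sym k.2.1); congr (~~ [&& _, _ & _]); lia.
Qed.

Lemma addable_far l k k' : far k k' -> addable (k' :: l) k = addable l k.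
Proof.
case: k k' => [c [e a]] [c' [e' a']].
rewrite /far /addable /shift /= !pair_eqb (eq_sym c') (eq_sym e').
by case: eqP => //= _; case: eqP => //= _; lia.
Qed.

Lemma addable_swap l k k' : far k k' -> addable l k -> addable (k :: l) k' ->
  addable l k' /\ addable (k' :: l) k.
Proof.
move=> f; rewrite (addable_far _ f) => -> /=.
by rewrite addable_far // far_sym.
Qed.

Lemma addable_neq l k : addable l k -> ~~ addable (k :: l) k.
Proof.
case: k => [c [e a]]; rewrite /addable /shift /= !pair_eqb !eqxx /=.
lia.
Qed.

(** Between two boxes on one diagonal both neighbouring diagonals must grow, which
one box k' cannot achieve. This is why three consecutive letters of a standard
word have distinct content values wherever these enter a denominator. *)
Lemma addable_neq3 l k k' : addable l k -> addable (k :: l) k' ->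
  ~~ addable (k' :: k :: l) k.
Proof.
case: k k' => [c [e a]] [c' [e' a']] ad ad'.
have [f|] := boolP (far (c, (e, a)) (c', (e', a'))).
  by rewrite addable_far // addable_neq.
rewrite /far negbK /= => /and3P[/eqP<- /eqP<- h]; move: ad ad'.
rewrite /addable /shift /= !pair_eqb !eqxx /=.
lia.
Qed.

Lemma diagram_nil : diagram [::].
Proof. by move=> c e a. Qed.

Lemma diagram_cons l k : diagram l -> addable l k -> diagram (k :: l).
Proof.
case: k => [c [e a]] dl /andP[/eqP h1 /eqP h2] c' e' a'.
move: h1 h2 (dl c' e' a'); rewrite /shift /= /= !pair_eqb.
case: (c =P c') => [<-|] //; case: (e =P e') => [<-|] //= h1 h2.
have [e1|n1] := eqVneq a' a.
  rewrite {}e1; move: (dl c e a) h1 h2; lia.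
have [e1|n2] := eqVneq a' (a + 1).
  rewrite {}e1 in n1 *; move: h1 h2 (dl c e a); rewrite addrK; lia.
have [e1|n3] := eqVneq a' (a - 1).
  rewrite {}e1 in n1 n2 *; move: h1 h2 (dl c e a); rewrite subrK; lia.
have -> : (a == a' + 1) = false by lia.
have -> : (a == a' - 1) = false by lia.
by [].
Qed.

Lemma count_rem_letter (l : seq letter) k j : k \in l ->
  count_mem j (rem k l) = (count_mem j l - (k == j))%N.
Proof. by move=> kl; rewrite count_rem kl. Qed.

Lemma diagram_rem l k : diagram l -> removable l k -> diagram (rem k l).
Proof.
case: k => [c [e a]] dl /andP[kl /andP[/eqP h1 /eqP h2]] c' e' a'.
have kl' : (0 < count_mem (c, (e, a)) l)%N by rewrite -has_count has_pred1.
move: h1 h2 (dl c' e' a'); rewrite /shift /= /= !count_rem_letter // !pair_eqb.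
case: (c =P c') => [<-|] //=; rewrite ?subn0 //.
case: (e =P e') => [<-|] //= h1 h2; rewrite ?subn0 //.
have [e1|n1] := eqVneq a' a.
  rewrite {}e1; move: (dl c e a) h1 h2 kl'; rewrite !eqxx /=; lia.
have [e1|n2] := eqVneq a' (a + 1).
  rewrite {}e1 in n1 *; move: h1 h2 (dl c e a) kl'; rewrite addrK !eqxx /=; lia.
have [e1|n3] := eqVneq a' (a - 1).
  rewrite {}e1 in n1 n2 *; move: h1 h2 (dl c e a) kl'; rewrite subrK !eqxx /=; lia.
have -> : (a == a' + 1) = false by lia.
have -> : (a == a' - 1) = false by lia.
by rewrite !subn0.
Qed.

(** The number of addable minus removable boxes on a diagonal is linear in the
diagonal lengths: their discrete Laplacian, with a source on the main diagonal. *)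
Lemma add_sub_rem l c e (a : int) : diagram l ->
  (addable l (c, (e, a)))%:Z - (removable l (c, (e, a)))%:Z
  = (a == 0)%:Z + (count_mem (c, (e, a - 1)) l)%:Z
    + (count_mem (c, (e, a + 1)) l)%:Z - (count_mem (c, (e, a)) l)%:Z *+ 2.
Proof.
move=> dl; rewrite /removable.
have kl : ((c, (e, a)) \in l) = (0 < count_mem (c, (e, a)) l)%N.
  by rewrite -has_pred1 has_count.
have rE b : (count_mem (c, (e, b)) (rem (c, (e, a)) l)
  = if (0 < count_mem (c, (e, a)) l) then count_mem (c, (e, b)) l - (a == b)
    else count_mem (c, (e, b)) l)%N.
  by rewrite -kl; case: ifP => h;
    [rewrite count_rem_letter // pair_eqb !eqxx|rewrite rem_id ?h].
rewrite {}kl /addable /shift /= !{}rE eqxx.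
have -> : (a == a + 1) = false by lia.
have -> : (a == a - 1) = false by lia.
case: (ltgtP a 0) => [a0|a0|a0] /=.
- have p1 : a <= 0 by lia.
  have p2 : a + 1 <= 0 by lia.
  have [_ /(_ p1) [+ +]] := dl c e a; have [_ /(_ p2) [+ +]] := dl c e (a + 1).
  rewrite /= (addrK (1 : int) a).
  move: (count_mem (c, (e, a - 1)) l) (count_mem (c, (e, a + 1)) l) => x y.
  move: (count_mem _ _) => r; case: r => [|r] /=; lia.
- have p1 : 0 <= a by lia.
  have p2 : 0 <= a - 1 by lia.
  have [/(_ p1) [+ +] _] := dl c e a; have [/(_ p2) [+ +] _] := dl c e (a - 1).
  rewrite /= (subrK (1 : int) a).
  move: (count_mem (c, (e, a - 1)) l) (count_mem (c, (e, a + 1)) l) => x y.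
  move: (count_mem _ _) => r; case: r => [|r] /=; lia.
- have p1 : 0 <= a by rewrite a0.
  have p2 : a <= 0 by rewrite a0.
  have [/(_ p1) [+ +] /(_ p2) [+ +]] := dl c e a; rewrite /=.
  move: (count_mem (c, (e, a - 1)) l) (count_mem (c, (e, a + 1)) l) => x y.
  move: (count_mem _ _) => r; case: r => [|r] /=; lia.
Qed.

(** * Standard words *)

Definition contents (M : nat) : seq int := [seq i%:Z - M%:Z | i <- iota 0 (2 * M).+1].

Lemma mem_contents M (a : int) : (a \in contents M) = (`|a| <= M)%N.
Proof.
apply/mapP/idP => [[j]|h]; first by rewrite mem_iota => + ->; lia.
by exists (`|(a + M%:Z)%R|)%N; rewrite ?mem_iota; lia.
Qed.

Lemma uniq_contents M : uniq (contents M).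
Proof. by rewrite map_inj_uniq ?iota_uniq // => i j; lia. Qed.

Lemma sum_count (T : Type) (r : seq T) (P : pred T) :
  (\sum_(x <- r) P x)%N = count P r.
Proof.
by rewrite -sum1_count [RHS]big_mkcond; apply: eq_bigr => x _; case: (P x).
Qed.

Section Words.
Variables (d : nat).
Hypothesis (d_gt0 : (0 < d)%N).

Definition negz (z : nat) : nat := ((d - z) %% d)%N.
(** The representative of the class {z, -z} modulo d. *)
Definition zclass (z : nat) : nat := minn z (negz z).
Definition key (x : letter) : letter := (zclass x.1, x.2).
(** The second diagram, marked by e = true, exists only where z = -z. *)
Definition letter_ok (x : letter) : bool :=
  (x.1 < d)%N && (x.2.1 ==> (negz x.1 == x.1)).

Lemma keyE x : key x = (zclass x.1, x.2). Proof. by []. Qed.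

Fixpoint std_from (l : seq letter) (s : seq letter) : bool :=
  if s is x :: s' then addable l (key x) && std_from (key x :: l) s' else true.

Definition std (n : nat) (w : seq letter) : bool :=
  [&& size w == n, all letter_ok w & std_from [::] w].

Lemma negz_lt z : (negz z < d)%N.
Proof. exact: ltn_pmod. Qed.

Lemma negzE z : (z < d)%N -> negz z = if z == 0%N then 0%N else (d - z)%N.
Proof.
rewrite /negz; case: eqP => [->|z0] zd; first by rewrite subn0 modnn.
by rewrite modn_small; lia.
Qed.

Lemma negzK z : (z < d)%N -> negz (negz z) = z.
Proof.
move=> zd; rewrite (negzE (negz_lt z)) (negzE zd).
by do 2?case: eqP; lia.
Qed.

Lemma zclass_negz z : (z < d)%N -> zclass (negz z) = zclass z.
Proof. by move=> zd; rewrite /zclass negzK // minnC. Qed.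

Lemma zclass_eq z z' : (z < d)%N -> (z' < d)%N ->
  (zclass z == zclass z') = (z == z') || (z' == negz z).
Proof.
move=> zd zd'; rewrite /zclass !negzE //.
by do 2?case: (_ =P 0%N); lia.
Qed.

Lemma std_from_perm l l' s : perm_eq l l' -> std_from l s = std_from l' s.
Proof.
elim: s l l' => //= x s IH l l' h.
by rewrite (addable_perm _ h) (IH _ (key x :: l')) // perm_cons.
Qed.

Lemma std_from_cat l p q :
  std_from l (p ++ q) = std_from l p && std_from (map key p ++ l) q.
Proof.
elim: p l => //= x p IH l; rewrite IH andbA; congr (_ && _).
by apply: std_from_perm; apply/permPl/(perm_catCA _ [:: key x]).
Qed.

Lemma std_from_rcons l p x :
  std_from l (rcons p x) = std_from l p && addable (map key p ++ l) (key x).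
Proof. by rewrite -cats1 std_from_cat /= andbT. Qed.

Lemma std_from_swap l p x x' q : far (key x) (key x') ->
  std_from l (p ++ x :: x' :: q) -> std_from l (p ++ x' :: x :: q).
Proof.
move=> f; rewrite !std_from_cat => /= /and4P[-> a1 a2 s].
have [-> ->] := addable_swap f a1 a2; rewrite /= in s *.
by apply: etrans s; apply: std_from_perm; apply/permPl/(perm_catCA [:: _] [:: _]).
Qed.

Lemma std_swap n p x x' q : far (key x) (key x') ->
  std n (p ++ x :: x' :: q) -> std n (p ++ x' :: x :: q).
Proof.
move=> f /and3P[/eqP sz ok st]; apply/and3P; split.
- by rewrite -sz !size_cat.
- by move: ok; rewrite !all_cat /= (andbCA (letter_ok x)).
- exact: std_from_swap f st.
Qed.

(** Contents are cut off at M, to have a finite alphabet; a standard word of length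
n only uses contents smaller than n in absolute value. *)
Definition letters (M : nat) : seq letter :=
  [seq x <- [seq (z, y) | z <- iota 0 d,
       y <- [seq (e, a) | e <- [:: false; true], a <- contents M]] | letter_ok x].

Fixpoint words (M n : nat) : seq (seq letter) :=
  if n is n'.+1 then
    [seq rcons w x | w <- words M n',
                     x <- [seq x <- letters M | addable (map key w) (key x)]]
  else [:: [::]].

Lemma mem_letters M x : (x \in letters M) = letter_ok x && (`|x.2.2| <= M)%N.
Proof.
rewrite mem_filter; case ok: (letter_ok x); rewrite ?andTb ?andFb //.
case: x ok => z [e a] /andP[zd _].
apply/allpairsPdep/idP => [[z' [y [_ /allpairsPdep[e' [a' [_ h ->]]] [_ _ ->]]]]|h].
  by rewrite -mem_contents.
exists z, (e, a); split; [by rewrite mem_iota| |by []].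
by apply/allpairsPdep; exists e, a; split; rewrite ?mem_contents //; case: (e).
Qed.

Lemma uniq_letters M : uniq (letters M).
Proof.
apply/filter_uniq/allpairs_uniq; rewrite ?iota_uniq //; last by move=> [? ?] [? ?].
apply: allpairs_uniq => //; last by move=> [? ?] [? ?].
exact: uniq_contents.
Qed.

Lemma addable_bound l k : addable l k ->
  k.2.2 = 0 \/ exists2 k', k' \in l & (`|k.2.2| <= `|k'.2.2| + 1)%N.
Proof.
case: k => c [e a] /andP[/= h1 h2].
case: (ltgtP a 0) => a0; [right|right|by left].
  exists (shift (c, (e, a)) 1); last by rewrite /=; lia.
  by rewrite -has_pred1 has_count; move: h2; rewrite a0 => /eqP->; rewrite addn1.
exists (shift (c, (e, a)) (-1)); last by rewrite /=; lia.
by rewrite -has_pred1 has_count; move: h1; rewrite a0 => /eqP->; rewrite addn1.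
Qed.

Lemma std_bound w : std_from [::] w -> all (fun x => `|x.2.2| < size w)%N w.
Proof.
elim/last_ind: w => // w x IH; rewrite std_from_rcons cats0 => /andP[/IH h a].
rewrite all_rcons size_rcons; apply/andP; split; last first.
  by apply: sub_all h => y /leq_trans -> //.
have [->//|[k /mapP[y yw ->]] /= h'] := addable_bound a.
by have := allP h _ yw; rewrite /=; lia.
Qed.

Lemma std_rcons n w x : std n.+1 (rcons w x) =
  [&& std n w, letter_ok x & addable (map key w) (key x)].
Proof.
rewrite /std size_rcons eqSS all_rcons std_from_rcons cats0.
by case: (_ == n) => //=; case: (letter_ok x) => //=; rewrite ?andbF ?andbA.
Qed.

Lemma mem_words M n w : (n <= M.+1)%N -> (w \in words M n) = std n w.
Proof.
elim: n w => [|n IH] w nM.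
  by rewrite inE /std; case: w.
apply/allpairsPdep/idP => [[w' [x [w'W]]]|].
  rewrite mem_filter mem_letters => /and3P[a ok _] ->.
  by rewrite std_rcons -IH ?w'W ?ok //; apply: ltnW.
case/lastP: w => [|w x]; first by rewrite /std.
move=> st; have [_ _ /std_bound] := and3P st.
move: st; rewrite std_rcons all_rcons => /and3P[st ok a] /andP[b _].
exists w, x; rewrite IH ?st ?(ltnW nM) //; split=> //.
rewrite mem_filter a mem_letters ok /=; move: b.
by have /and3P[/eqP sz _ _] := st; rewrite size_rcons sz; lia.
Qed.

Lemma uniq_words M n : uniq (words M n).
Proof.
elim: n => //= n IH; apply: allpairs_uniq_dep => //.
  by move=> w _; apply/filter_uniq/uniq_letters.
by move=> [w x] [w' x'] _ _ /= /rcons_inj[-> ->].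
Qed.

Lemma big_letters M (R : nmodType) (F : letter -> R) :
  \sum_(x <- letters M) F x =
  \sum_(z < d) \sum_(e : bool | e ==> (negz z == z))
    \sum_(a <- contents M) F (z : nat, (e, a)).
Proof.
rewrite big_filter big_mkcond big_allpairs_dep.
have -> : iota 0 d = index_iota 0 d by rewrite /index_iota subn0.
rewrite big_mkord; apply: eq_bigr => z _.
rewrite big_allpairs_dep [RHS]big_mkcond -[RHS]/(\sum_(e : bool) _) big_bool.
move: (contents M) => r; rewrite !big_cons big_nil /= addr0 addrC /letter_ok /= ltn_ord /=.
congr (_ + _).
by case: (negz z == z) => //; rewrite big1.
Qed.

(** Unless z = -z, a key is shared by the two letters with exponents z and -z. *)
Lemma sum_letters_key M x : x \in letters M ->
  (\sum_(x' <- letters M) (key x' == key x) = if negz x.1 == x.1 then 1 else 2)%N.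
Proof.
rewrite mem_letters => /andP[/andP[xd ok] xM].
transitivity (\sum_(x' <- letters M) ((x' == x)
  + (((negz x.1 != x.1) && (x' == (negz x.1, x.2)))))%N)%N.
  rewrite !(big_seq _ _ (letters M)); apply: eq_bigr => -[z y].
  rewrite mem_letters /letter_ok => /andP[/andP[/= zd _] _].
  case: x xd ok xM => z' y' /= xd _ _; rewrite /key /= !xpair_eqE zclass_eq //.
  have -> : (z' == negz z) = (z == negz z').
    by apply/eqP/eqP => ->; rewrite negzK.
  case: (y == y'); rewrite ?andbF ?andbT //; have [->|ne] := eqVneq z z'.
    by rewrite (eq_sym z'); case: (_ == _).
  by have [e|] := eqVneq z (negz z'); rewrite ?andbF // -e ne.
rewrite big_split /=.
rewrite sum_count count_uniq_mem ?uniq_letters // mem_letters xM /letter_ok xd ok /=.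
case: eqP => [_|ne] /=; first by rewrite big1.
rewrite sum_count count_uniq_mem ?uniq_letters // mem_letters xM /letter_ok negz_lt.
by case: (x.2.1) ok ne => //= /eqP.
Qed.

End Words.

(** * Counting pairs of standard words of one shape *)

(** The second differences telescope to zero; only the source remains. *)
Lemma sum_laplacian M (m : int -> int) : (forall a, (M <= `|a|)%N -> m a = 0) ->
  \sum_(a <- contents M) ((a == 0)%:Z + m (a - 1) + m (a + 1) - m a *+ 2) = 1.
Proof.
move=> m0; pose f i := m (i%:Z - M%:Z) - m (i%:Z - M%:Z - 1).
transitivity (\sum_(a <- contents M) (a == 0)%:Z
              + \sum_(0 <= i < (2 * M).+1) (f i.+1 - f i)).
  rewrite /contents !big_map /index_iota subn0 -big_split /=.
  apply: eq_bigr => i _; rewrite /f intS.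
  have -> : 1 + i%:Z - M%:Z = i%:Z - M%:Z + 1 by lia.
  rewrite (addrK (1 : int)); lia.
rewrite telescope_sumr // /f !m0; [|lia..].
rewrite !subr0.
rewrite -(big_morph Posz PoszD (erefl _)) sum_count.
by rewrite count_uniq_mem ?uniq_contents // mem_contents.
Qed.

Lemma diagram_perm l l' : perm_eq l l' -> diagram l -> diagram l'.
Proof. by move=> /seq.permP h dl c e a; rewrite /= -!h; apply: dl. Qed.

Section Count.
Variables (d : nat) (M : nat).
Hypothesis (d_gt0 : (0 < d)%N).

Lemma std_diagram w : std_from d [::] w -> diagram (map (key d) w).
Proof.
elim/last_ind: w => [_|w x IH]; first exact: diagram_nil.
rewrite std_from_rcons cats0 => /andP[/IH dw ad].
apply: (@diagram_perm (key d x :: map (key d) w)); last exact: diagram_cons.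
by rewrite map_rcons perm_sym perm_rcons.
Qed.

(** Each diagram has one more addable than removable box. Every z contributes 2:
two diagrams with one letter for each box if z = -z, otherwise one diagram with
two letters for each box. *)
Lemma sum_excess l : diagram l -> all (fun k => `|k.2.2| < M)%N l ->
  (\sum_(x <- letters d M) \sum_(x' <- letters d M | key d x' == key d x)
      addable l (key d x)
   = \sum_(x <- letters d M) \sum_(x' <- letters d M | key d x' == key d x)
      removable l (key d x)
     + 2 * d)%N.
Proof.
move=> dl bl.
have E (F : letter -> nat) :
  (\sum_(x <- letters d M) \sum_(x' <- letters d M | key d x' == key d x) F x
   = \sum_(x <- letters d M) (if negz d x.1 == x.1 then 1 else 2) * F x)%N.
  rewrite big_seq [RHS]big_seq; apply: eq_bigr => x xL.
  rewrite -(sum_letters_key d_gt0 xL) big_mkcond big_distrl /=.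
  by apply: eq_bigr => x' _; case: (_ == _); rewrite ?mul1n ?mul0n.
rewrite !E; apply/eqP; rewrite -eqz_nat PoszD -subr_eq0 opprD addrA subr_eq0.
rewrite !(big_morph Posz PoszD (erefl _)) -sumrB.
under eq_bigr => x _ do rewrite !PoszM -mulrBr.
rewrite big_letters //.
transitivity (\sum_(z < d) (2 : int) == (2 * d)%N); last first.
  by rewrite sumr_const card_ord; apply/eqP; lia.
congr (_ == _); apply: eq_bigr => z _.
transitivity (\sum_(e | e ==> (negz d z == z)) (Posz (if negz d z == z then 1 else 2)%N)).
  apply: eq_bigr => e _; rewrite /= -mulr_sumr -[RHS]mulr1; congr (_ * _).
  rewrite -[RHS](@sum_laplacian M (fun a => (count_mem (zclass d z, (e, a)) l)%:Z)).
    by apply: eq_bigr => a _; rewrite /key /= add_sub_rem.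
  move=> a Ma; apply/eqP; rewrite eqz_nat -leqn0 leqNgt -has_count has_pred1.
  by apply/negP => /(allP bl) /=; lia.
rewrite big_mkcond big_bool /=.
by case: (_ == _).
Qed.

Definition num_std n l : nat := (\sum_(w <- words d M n) perm_eq (map (key d) w) l)%N.

Lemma num_std_perm n l l' : perm_eq l l' -> num_std n l = num_std n l'.
Proof.
by move=> /permPr h; apply: eq_bigr => w _; rewrite h.
Qed.

Lemma big_words n (F : seq letter -> nat) :
  (\sum_(w <- words d M n.+1) F w =
   \sum_(w <- words d M n) \sum_(x <- letters d M | addable (map (key d) w) (key d x))
     F (rcons w x))%N.
Proof.
by rewrite big_allpairs_dep; apply: eq_bigr => w _; rewrite big_filter.
Qed.

Lemma num_std_rec n l : num_std n.+1 l =
  (\sum_(x <- letters d M) removable l (key d x) * num_std n (rem (key d x) l))%N.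
Proof.
transitivity (\sum_(w <- words d M n) \sum_(x <- letters d M)
  if addable (map (key d) w) (key d x)
  then perm_eq (map (key d) (rcons w x)) l : nat else 0)%N.
  by rewrite /num_std big_words; apply: eq_bigr => w _; rewrite big_mkcond.
rewrite exchange_big /=.
transitivity (\sum_(x <- letters d M) \sum_(w <- words d M n)
   removable l (key d x) * perm_eq (map (key d) w) (rem (key d x) l))%N; last first.
  by apply: eq_bigr => x _; rewrite big_distrr.
apply: eq_bigr => x _; apply: eq_bigr => w _.
rewrite map_rcons /removable; have [kl|kl] := boolP (key d x \in l); last first.
  rewrite andFb mul0n; case: ifP => // _; apply/eqP; rewrite eqb0.
  by apply: contra kl => /perm_mem <-; rewrite mem_rcons mem_head.
rewrite perm_rcons (permPr (perm_to_rem kl)) perm_cons /=.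
have [h|_] := boolP (perm_eq _ _); last by rewrite muln0 if_same.
by rewrite (addable_perm _ h) muln1; case: ifP.
Qed.

(** Off the diagonal, adding a box and removing a box commute: this is the local
form of the relation D U = U D + 2d, where U adds and D removes a box in all
possible ways. *)
Lemma addable_removable l k k' : k != k' ->
  addable l k && removable (k :: l) k' = removable l k' && addable (rem k' l) k.
Proof.
move=> kk'; rewrite /removable inE eq_sym (negbTE kk') /= (negbTE kk').
have [kl|] := boolP (k' \in l); rewrite ?andbF //=.
rewrite (addable_perm k (perm_to_rem kl)).
set l' := rem k' l; have [f|] := boolP (far k k').
  by rewrite !addable_far // 1?far_sym // andbC.
case: k k' kk' {kl} @l' => [c [e a]] [c' [e' a']] ne l'.
rewrite /far negbK /= => /and3P[/eqP ec /eqP ee h].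
rewrite -{}ec -{}ee in ne l' *; move: ne; rewrite !pair_eqb !eqxx /= => ne.
have [e1|e1] : a' = a + 1 \/ a' = a - 1 by lia.
  rewrite {}e1 /addable /shift /= (addrK (1 : int) a) !pair_eqb !eqxx /=.
  move: (count_mem (c, (e, a + 1)) l') (count_mem (c, (e, a)) l') => x y.
  lia.
rewrite {}e1 /addable /shift /= (subrK (1 : int) a) !pair_eqb !eqxx /=.
move: (count_mem (c, (e, a - 1)) l') (count_mem (c, (e, a)) l') => x y.
lia.
Qed.

(** The relation D U = U D + 2d, applied to the function that counts the standard
words of a given shape; that function satisfies num_std = D num_std by
[num_std_rec]. *)
Lemma num_std_cover_aux l : diagram l -> all (fun k => `|k.2.2| < M)%N l ->
  (\sum_(x <- letters d M | addable l (key d x)) num_std (size l).+1 (key d x :: l)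
   = 2 * d * num_std (size l) l +
     \sum_(x' <- letters d M) removable l (key d x') *
     \sum_(x <- letters d M | addable (rem (key d x') l) (key d x))
       num_std (size l) (key d x :: rem (key d x') l))%N.
Proof.
move=> dl bl; have := sum_excess dl bl.
set A := (\sum_(x <- _) _)%N; set R := (\sum_(x <- _) _)%N => AR.
set n := size l; apply/eqP; rewrite -(eqn_add2r (R * num_std n l)) addnAC -mulnDl.
rewrite (addnC _ R) -AR; apply/eqP.
(* The pairs with equal keys give the numbers A and R of addable and removable
   boxes; T counts the other pairs with x added before x' is removed, T' all
   pairs with x' removed first. *)
pose T x x' := (addable l (key d x) && removable (key d x :: l) (key d x')
  * num_std n (rem (key d x') (key d x :: l)))%N.
pose T' x x' := (removable l (key d x') && addable (rem (key d x') l) (key d x)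
  * num_std n (key d x :: rem (key d x') l))%N.
transitivity (A * num_std n l
   + \sum_(x <- letters d M) \sum_(x' <- letters d M | key d x' != key d x) T x x'
   + R * num_std n l)%N.
  congr (_ + _)%N; rewrite big_mkcond big_distrl -big_split /=.
  apply: eq_bigr => x _; rewrite num_std_rec (bigID (fun x' => key d x' == key d x)) /=.
  case ad: (addable l (key d x)); last by rewrite !big1 /T ?ad // => x' _; rewrite andbF.
  congr (_ + _)%N; last by apply: eq_bigr => x' _; rewrite /T ad.
  rewrite big_distrl; apply: eq_bigr => x' /eqP->.
  by rewrite /removable inE eqxx /= eqxx ad.
rewrite -addnA; congr (_ + _)%N.
transitivity (\sum_(x <- letters d M) \sum_(x' <- letters d M) T' x x')%N; last first.
  rewrite exchange_big /=; apply: eq_bigr => x' _; rewrite [in RHS]big_mkcond big_distrr /=.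
  by apply: eq_bigr => x _; rewrite /T'; case: (addable _ _); rewrite ?andbT ?andbF ?mul0n ?muln0.
rewrite big_distrl -big_split; apply: eq_bigr => x _ /=.
rewrite [RHS](bigID (fun x' => key d x' == key d x)) /= addnC; congr (_ + _)%N.
  rewrite big_distrl; apply: eq_bigr => x' /eqP e; rewrite /T' e.
  have [rl|] := boolP (removable l _); rewrite ?mul0n //.
  have [kl a] := andP rl; rewrite a; congr (_ * _)%N; apply: num_std_perm.
  exact: perm_to_rem.
apply: eq_bigr => x' ne; rewrite /T /T' addable_removable 1?eq_sym //.
by rewrite /= eq_sym (negbTE ne).
Qed.

(** Moving U to the right through the D of [num_std_rec], one box at a time, shows
that num_std is an eigenvector of U. *)
Theorem num_std_cover l : diagram l -> all (fun k => `|k.2.2| < M)%N l ->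
  (\sum_(x <- letters d M | addable l (key d x)) num_std (size l).+1 (key d x :: l)
   = (size l).+1 * (2 * d) * num_std (size l) l)%N.
Proof.
move sl: (size l) => n; elim: n l sl => [|n IH] l sl dl bl.
  have := num_std_cover_aux dl bl; rewrite sl => ->.
  by rewrite (size0nil sl) big1 ?addn0 ?mul1n.
have := num_std_cover_aux dl bl; rewrite sl => ->.
rewrite [in RHS]mulSn mulnDl; congr (_ + _)%N.
rewrite num_std_rec big_distrr; apply: eq_bigr => x' _ /=.
have [rl|] := boolP (removable l _); rewrite ?muln0 // !mul1n.
have [kl a] := andP rl; apply: IH.
- by rewrite size_rem // sl.
- exact: diagram_rem.
- by apply/allP => k /mem_rem /(allP bl).
Qed.

(** The sum counts the pairs of standard words of one shape. By [num_std_cover],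
passing from words of length n - 1 to words of length n multiplies it by 2dn. *)
Theorem sum_num_std n : (n <= M.+1)%N ->
  (\sum_(w <- words d M n) num_std n (map (key d) w) = (2 * d) ^ n * n`!)%N.
Proof.
elim: n => [_|n IH nM]; first by rewrite big_seq1 /num_std big_seq1.
rewrite big_words factS expnS mulnACA (mulnC (2 * d)%N) -IH 1?ltnW //.
rewrite big_distrr big_seq [RHS]big_seq; apply: eq_bigr => w /=.
rewrite mem_words // 1?ltnW // => /and3P[/eqP sw ok st].
have sz : size (map (key d) w) = n by rewrite size_map.
rewrite -[in RHS]sz -num_std_cover; [|exact: std_diagram|]; last first.
  apply/allP => k /mapP[x xw ->] /=; have := allP (std_bound d_gt0 st) _ xw.
  by rewrite sw => /leq_trans; apply.
rewrite sz; apply: eq_bigr => x _; apply: num_std_perm.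
by rewrite map_rcons perm_rcons.
Qed.

End Count.

(** * Connecting standard words of one shape *)

Section Connect.
Variables (d n : nat).
Hypothesis (d_gt0 : (0 < d)%N).
Definition flip (x : letter) : letter := (negz d x.1, x.2).

Lemma flipE x : flip x = (negz d x.1, x.2). Proof. by []. Qed.

Lemma key_flip x : letter_ok d x -> key d (flip x) = key d x.
Proof. by case/andP=> xd _; rewrite /key zclass_negz. Qed.

Lemma letter_ok_flip x : letter_ok d x -> letter_ok d (flip x).
Proof.
case/andP=> xd ok; rewrite /letter_ok negz_lt //=.
by apply/implyP => /(implyP ok)/eqP e; rewrite e e.
Qed.

Lemma flipK x : letter_ok d x -> flip (flip x) = x.
Proof. by case: x => z y /andP[xd _]; rewrite /flip /= negzK. Qed.

Lemma key_inj x y : letter_ok d x -> letter_ok d y ->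
  key d x = key d y -> y = x \/ y = flip x.
Proof.
case: x y => [z y] [z' y'] /andP[/= xd _] /andP[/= xd' _] [/eqP + <-].
by rewrite zclass_eq // => /orP[/eqP->|/eqP->]; [left|right].
Qed.

Lemma std_from_flip l p x q : letter_ok d x ->
  std_from d l (p ++ flip x :: q) = std_from d l (p ++ x :: q).
Proof. by move=> ok; rewrite !std_from_cat /= key_flip. Qed.

Lemma std_flip p x q : std d n (p ++ x :: q) -> std d n (p ++ flip x :: q).
Proof.
case/and3P; rewrite all_cat /= => sz /and3P[okp ok okq] st; apply/and3P; split.
- by move: sz; rewrite !size_cat.
- by rewrite all_cat /= okp letter_ok_flip.
- by rewrite std_from_flip.
Qed.

Lemma last_occurrence k p : k \in map (key d) p ->
  exists p1 x p2, [/\ p = p1 ++ x :: p2, key d x = k & k \notin map (key d) p2].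
Proof.
elim: p => // y p IH; have [/IH[p1 [x [p2 [-> kx kn]]]] _|kn] := boolP (k \in map (key d) p).
  by exists (y :: p1), x, p2.
rewrite inE (negbTE kn) orbF => /eqP e.
by exists [::], y, p.
Qed.

(** The relation E is abstract here; it will be the existence of a matrix unit. *)
Variable E : seq letter -> seq letter -> Prop.
Hypothesis E_refl : forall w, std d n w -> E w w.
Hypothesis E_trans : forall w2 w1 w3, std d n w1 -> std d n w2 -> std d n w3 ->
  E w1 w2 -> E w2 w3 -> E w1 w3.
Hypothesis E_swap : forall p x x' q, std d n (p ++ x :: x' :: q) ->
  far (key d x) (key d x') -> E (p ++ x :: x' :: q) (p ++ x' :: x :: q).
Hypothesis E_flip : forall p x q, std d n (p ++ x :: q) ->
  E (p ++ x :: q) (p ++ flip x :: q).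

(** A letter moves to the right across letters that are far from it. *)
Lemma connect_bubble p x p2 q : std d n (p ++ x :: p2 ++ q) ->
  (forall z, z \in p2 -> far (key d x) (key d z)) ->
  std d n (p ++ p2 ++ x :: q) /\ E (p ++ x :: p2 ++ q) (p ++ p2 ++ x :: q).
Proof.
elim: p2 p => [|z p2 IH] p st h; first by split=> //; apply: E_refl.
have fz : far (key d x) (key d z) by apply: h; rewrite mem_head.
have st1 := std_swap fz st.
have [|z' z'p|st2 E2] := IH (rcons p z).
- by rewrite cat_rcons.
- by apply: h; rewrite inE z'p orbT.
move: st2 E2; rewrite !cat_rcons => st2 E2; split=> //.
by apply: (E_trans st st1 st2 _ E2); apply: E_swap.
Qed.

(** Consider the last letter y of p' and the last letter x of p with the same key.
The letters of p after x are far from x: both words end with the same shape, so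
the diagonals next to that of x already have their final length when x is
added. Hence x moves to the end of p, is flipped to y if necessary, and
induction applies to the shorter words. *)
Lemma connect_aux p p' q : perm_eq (map (key d) p) (map (key d) p') ->
  std d n (p ++ q) -> std d n (p' ++ q) -> E (p ++ q) (p' ++ q).
Proof.
elim/last_ind: p' p q => [|p' y IH] p q pe st st'.
  have /eqP := perm_size pe; rewrite size_map => /eqP/size0nil e.
  by rewrite e in st *; apply: E_refl.
have yp : key d y \in map (key d) p.
  by rewrite (perm_mem pe) map_rcons mem_rcons mem_head.
have [p1 [x [p2 [ep kx kn]]]] := last_occurrence yp; rewrite {p}ep in pe st yp *.
have pe' : perm_eq (map (key d) (p1 ++ p2)) (map (key d) p').
  rewrite -(perm_cons (key d y)).
  rewrite map_rcons (permPr (_ : perm_eq _ (key d y :: map (key d) p'))) in pe; last first.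
    by rewrite perm_rcons.
  rewrite -(permPr pe) map_cat map_cat /= kx perm_sym.
  exact/permPl/(perm_catCA _ [:: _]).
(* The box of y is addable both before and after p2 is added, although p2 adds no
   box on its diagonal: so p2 adds no box on the two neighbouring diagonals. *)
have a1 : addable (map (key d) p1) (key d y).
  case/and3P: st => _ _; rewrite -catA std_from_cat => /andP[_ /=].
  by rewrite cats0 kx => /andP[].
have a2 : addable (map (key d) p1 ++ map (key d) p2) (key d y).
  rewrite -map_cat (addable_perm _ pe').
  case/and3P: st' => _ _; rewrite cat_rcons std_from_cat => /andP[_ /=].
  by rewrite cats0 => /andP[].
have farp2 z : z \in p2 -> far (key d x) (key d z).
  move=> zp2; have kz : key d z \in map (key d) p2 by apply: map_f.
  rewrite kx; move: kz kn a1 a2; move: (map _ p2) (map _ p1) => l2 l1.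
  case: (key d y) (key d z) => [c [e a]] [c' [e' a']].
  rewrite -!has_pred1 !has_count /far /addable /shift /= !count_cat.
  move=> h h0 h1 h2; apply/negP => /and3P[/eqP ec /eqP ee ha].
  rewrite -{}ec -{}ee in h; have [e1|[e1|e1]] : a' = a \/ (a' = a + 1 \/ a' = a - 1) by lia.
  - by rewrite e1 in h; lia.
  - by rewrite e1 in h; lia.
  - by rewrite e1 in h; lia.
rewrite -catA /= in st *.
have [st1 E1] := connect_bubble st farp2.
have ok : letter_ok d x.
  by case/and3P: st => _; rewrite all_cat => /and3P[].
have ok' : letter_ok d y.
  by case/and3P: st' => _; rewrite all_cat all_rcons => /andP[/andP[]].
rewrite cat_rcons in st' *; rewrite catA in st1 E1.
have [st2 E2] : std d n ((p1 ++ p2) ++ y :: q) /\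
    E ((p1 ++ p2) ++ x :: q) ((p1 ++ p2) ++ y :: q).
  have [->|->] := key_inj ok ok' kx; first by split=> //; apply: E_refl.
  by split; [apply: std_flip|apply: E_flip].
apply: (E_trans st st1 st' E1); apply: (E_trans st1 st2 st' E2).
exact: IH.
Qed.

Theorem connect_std w w' : std d n w -> std d n w' ->
  perm_eq (map (key d) w) (map (key d) w') -> E w w'.
Proof.
by move=> st st' pe; have := @connect_aux w w' [::]; rewrite !cats0; apply.
Qed.
End Connect.

(** * A spanning set from coset representatives *)

Section LinearSpan.
Variables (K : nzRingType) (V : lmodType K).

Inductive spanned (s : seq V) : V -> Prop :=
| spanned_mem v : v \in s -> spanned s v
| spanned0 : spanned s 0
| spannedD v w : spanned s v -> spanned s w -> spanned s (v + w)
| spannedZ c v : spanned s v -> spanned s (c *: v).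

Lemma spanned_coef s v : spanned s v ->
  exists c : 'I_(size s) -> K, v = \sum_(i < size s) c i *: s`_i.
Proof.
elim=> {v} [v vs||v w _ [c ->] _ [c' ->]|a v _ [c ->]].
- have i := index_mem v s; rewrite vs in i.
  exists (fun j => (j == Ordinal i)%:R); rewrite (bigD1 (Ordinal i)) //= eqxx.
  rewrite scale1r nth_index // big1 ?addr0 // => j /negbTE ->.
  by rewrite scale0r.
- by exists (fun=> 0); rewrite big1 // => i _; rewrite scale0r.
- exists (fun i => c i + c' i); rewrite -big_split.
  by apply: eq_bigr => i _; rewrite scalerDl.
- exists (fun i => a * c i); rewrite scaler_sumr.
  by apply: eq_bigr => i _; rewrite scalerA.
Qed.
End LinearSpan.

Section NormalForm.
Variables (K : comNzRingType) (A : algType K) (d n : nat) (t xi : nat -> A).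

Inductive tpoly (m : nat) : A -> Prop :=
| tpoly1 : tpoly m 1
| tpolyX j a : (j < m)%N -> tpoly m a -> tpoly m (t j * a)
| tpolyD a b : tpoly m a -> tpoly m b -> tpoly m (a + b)
| tpolyZ c a : tpoly m a -> tpoly m (c *: a).

Lemma tpolyW m m' a : (m <= m')%N -> tpoly m a -> tpoly m' a.
Proof.
move=> mm'; elim=> [|j b jm _ IH|b c _ IHb _ IHc|c b _ IH].
- exact: tpoly1.
- by apply: tpolyX IH; apply: leq_trans mm'.
- exact: tpolyD.
- exact: tpolyZ.
Qed.

Lemma tpolyM m a b : tpoly m a -> tpoly m b -> tpoly m (a * b).
Proof.
move=> pa pb; elim: pa => [|j c jm _ IH|c e _ IHb _ IHc|c e _ IH].
- by rewrite mul1r.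
- by rewrite -mulrA; apply: tpolyX.
- by rewrite mulrDl; apply: tpolyD.
- by rewrite -scalerAl; apply: tpolyZ.
Qed.

Lemma tpoly_t m j : (j < m)%N -> tpoly m (t j).
Proof. by move=> jm; rewrite -[t j]mulr1; apply: tpolyX => //; apply: tpoly1. Qed.

Lemma tpoly_exp m a e : tpoly m a -> tpoly m (a ^+ e).
Proof.
move=> pa; elim: e => [|e IH]; first exact: tpoly1.
by rewrite exprS; apply: tpolyM.
Qed.

(** The minimal coset representatives of the group of rank p in that of rank p + 1
are xi_p ... xi_(p-l+1), and xi_p ... xi_0 continued by xi_1 ... xi_j. *)
Fixpoint desc (p l : nat) : A := if l is l'.+1 then desc p l' * xi (p - l') else 1.
Fixpoint asc (j : nat) : A := if j is j'.+1 then asc j' * xi j else 1.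
Lemma ascE j : asc j.+1 = asc j * xi j.+1. Proof. by []. Qed.
Definition reps (p : nat) : seq A :=
  [seq desc p l | l <- iota 0 p.+2] ++ [seq desc p p.+1 * asc j | j <- iota 1 p].
Fixpoint normal_forms (m : nat) : seq A :=
  if m is p.+1 then
    [seq x * g | x <- normal_forms p,
                 g <- [seq t p ^+ a * r | a <- iota 0 d, r <- reps p]]
  else [:: 1].

Lemma normal_formsS p : normal_forms p.+1 =
  [seq x * g | x <- normal_forms p,
               g <- [seq t p ^+ a * r | a <- iota 0 d, r <- reps p]].
Proof. by []. Qed.

Lemma size_normal_forms m : size (normal_forms m) = ((2 * d) ^ m * m`!)%N.
Proof.
elim: m => // m IH; rewrite normal_formsS !size_allpairs IH size_iota /reps.
by rewrite size_cat !size_map !size_iota expnS factS; lia.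
Qed.

Hypothesis d_gt0 : (0 < d)%N.
Hypothesis tC : forall i j, (i < n)%N -> (j < n)%N -> t i * t j = t j * t i.
Hypothesis td : forall i, (i < n)%N -> t i ^+ d = 1.
Hypothesis xit : forall i j p, (p < n)%N -> (i <= p)%N -> (j <= p)%N ->
  exists k e, (k <= p)%N /\ xi i * t j = t k ^+ e * xi i.
Hypothesis xitC : forall i j, (i < j)%N -> (j < n)%N -> xi i * t j = t j * xi i.
Hypothesis xi2 : forall i, (i < n)%N -> exists a b,
  [/\ tpoly i.+1 a, tpoly i.+1 b & xi i * xi i = a + b * xi i].
Hypothesis xiC : forall i j, (i.+1 < j)%N -> (j < n)%N -> xi i * xi j = xi j * xi i.
Hypothesis xi_braid3 : forall i, (0 < i)%N -> (i.+1 < n)%N ->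
  xi i.+1 * xi i * xi i.+1 = xi i * xi i.+1 * xi i.
Hypothesis xi_braid4 : (1 < n)%N ->
  xi 1 * xi 0 * xi 1 * xi 0 = xi 0 * xi 1 * xi 0 * xi 1.

Section Step.
Variable p : nat.
Hypothesis pn : (p < n)%N.

Lemma descC i l : (i + l < p)%N -> desc p l * xi i = xi i * desc p l.
Proof.
elim: l => [|l IH] il /=; first by rewrite mulr1 mul1r.
by rewrite -mulrA -xiC ?mulrA ?IH //; lia.
Qed.

Lemma descS i l : (1 < i <= p)%N -> (l <= p.+1)%N -> (p.+1 - l < i)%N ->
  desc p l * xi i = xi i.-1 * desc p l.
Proof.
case/andP=> i1 ip; elim: l => [|l IH] lp li; first by lia.
have [e|ne] := eqVneq (p - l)%N i.-1; last first.
  rewrite /= -mulrA xiC; [|lia..].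
  by rewrite mulrA IH ?mulrA //; lia.
case: l IH lp li e => [|l] IH lp li e; first by lia.
rewrite /= e; have -> : (p - l)%N = i.-1.+1 by lia.
have -> : xi i = xi i.-1.+1 by congr xi; lia.
rewrite -!mulrA (mulrA (xi i.-1.+1)) xi_braid3; [|lia..].
by rewrite !mulrA descC //; lia.
Qed.

Lemma ascC i j : (j.+1 < i)%N -> (i < n)%N -> asc j * xi i = xi i * asc j.
Proof.
move=> ji i_n; elim: j ji => [|j IH] ji /=; first by rewrite mulr1 mul1r.
by rewrite -mulrA xiC // mulrA IH ?mulrA //; lia.
Qed.

Lemma ascS i j : (0 < i < j)%N -> (j < n)%N -> asc j * xi i = xi i.+1 * asc j.
Proof.
case/andP=> i0; elim: j => // j IH ij jn.
have [e|ne] := eqVneq i j; last first.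
  by rewrite /= -mulrA -xiC ?mulrA ?IH //; lia.
case: i e i0 ij jn {IH} => // i <- _ ij jn /=.
rewrite -!mulrA (mulrA (xi i.+1)) -xi_braid3 //.
by rewrite !mulrA ascC //; lia.
Qed.

(** This is where the braid relation of length four enters. *)
Lemma desc_asc0 j : (0 < j <= p)%N ->
  desc p p.+1 * asc j * xi 0 = xi 0 * (desc p p.+1 * asc j).
Proof.
case/andP; elim: j => // j IH _ jp.
case: j IH jp => [|j] IH jp; last first.
  have := IH isT (ltnW jp); rewrite [asc j.+2]ascE; move: (desc p p.+1) (asc j.+1) => D E h.
  by rewrite -!mulrA -xiC; [|lia..]; rewrite !mulrA h !mulrA.
rewrite /= mul1r subnn.
have -> : desc p p = desc p p.-1 * xi 1.
  have e : p = p.-1.+1 by lia.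
  by rewrite [X in desc _ X]e /=; congr (_ * xi _); lia.
have /(congr1 ( *%R (desc p p.-1))) := xi_braid4 (leq_ltn_trans jp pn).
rewrite !mulrA => ->; rewrite descC //; lia.
Qed.

Let S' := spanned (normal_forms p).
Let S := spanned (normal_forms p.+1).
Hypothesis closed_t : forall a j, S' a -> (j < p)%N -> S' (a * t j).
Hypothesis closed_xi : forall a j, S' a -> (j < p)%N -> S' (a * xi j).

Lemma closed_rep x e r : S' x -> r \in reps p -> S (x * (t p ^+ e * r)).
Proof.
move=> Sx rr; elim: Sx => {x} [x xN||x y _ IHx _ IHy|c x _ IH].
- have -> : t p ^+ e = t p ^+ (e %% d).
    by rewrite [in LHS](divn_eq e d) exprD mulnC exprM td // expr1n mul1r.
  apply: spanned_mem; rewrite normal_formsS; apply: allpairs_f => //.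
  by apply: allpairs_f => //; rewrite mem_iota ltn_pmod.
- by rewrite mul0r; apply: spanned0.
- by rewrite mulrDl; apply: spannedD.
- by rewrite -scalerAl; apply: spannedZ.
Qed.

(** The span S is closed under right multiplication by a generator x when every r x,
r a coset representative, follows; the powers of t_p come before r in a normal
form. *)
Definition follows (g : A) := forall x e, S' x -> S (x * t p ^+ e * g).

Lemma tpC i e : (i <= p)%N -> t p ^+ e * t i = t i * t p ^+ e.
Proof.
move=> ip; apply/esym/commrX; apply: tC => //; exact: leq_ltn_trans pn.
Qed.

Lemma follows_tpoly m r : tpoly p.+1 m -> r \in reps p -> follows (m * r).
Proof.
move=> tm rr; elim: tm => [|j a jp _ IH|a b _ IHa _ IHb|c a _ IH] x e Sx.
- by rewrite mul1r -mulrA; apply: closed_rep.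
- rewrite !mulrA -(mulrA x) tpC //; move: jp; rewrite ltnS leq_eqVlt.
  case/orP => [/eqP->|jp]; first by rewrite -exprS -mulrA; apply: IH.
  by rewrite !mulrA -(mulrA (_ * t p ^+ e)); apply: IH; apply: closed_t.
- by rewrite mulrDl mulrDr; apply: spannedD; [apply: IHa|apply: IHb].
- by rewrite -scalerAl -scalerAr; apply: spannedZ; apply: IH.
Qed.

Lemma follows_rep r : r \in reps p -> follows r.
Proof. by move=> rr; rewrite -[r]mul1r; apply: follows_tpoly (tpoly1 _) rr. Qed.

Lemma followsD a b : follows a -> follows b -> follows (a + b).
Proof. by move=> fa fb x e Sx; rewrite mulrDr; apply: spannedD; [apply: fa|apply: fb]. Qed.

Lemma follows_xi i r : (i < p)%N -> r \in reps p -> follows (xi i * r).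
Proof.
move=> ip rr x e Sx; rewrite mulrA -(mulrA x).
have -> : t p ^+ e * xi i = xi i * t p ^+ e by apply/esym/commrX/xitC.
by rewrite mulrA; apply: follows_rep => //; apply: closed_xi.
Qed.

Definition monomial (r : A) := forall j, (j <= p)%N ->
  exists k e, (k <= p)%N /\ r * t j = t k ^+ e * r.

Lemma monomialM a b : monomial a -> monomial b -> monomial (a * b).
Proof.
move=> ma mb j jp; have [k [e [kp E]]] := mb j jp.
have [k' [e' [kp' E']]] := ma k kp.
exists k', (e' * e)%N; split=> //; rewrite -mulrA E mulrA exprM.
suff -> : a * t k ^+ e = t k' ^+ e' ^+ e * a by rewrite mulrA.
elim: e {E} => [|e IH]; first by rewrite !expr0 mulr1 mul1r.
by rewrite exprSr mulrA IH -mulrA E' mulrA -exprSr.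
Qed.

Lemma monomial1 : monomial 1.
Proof. by move=> j jp; exists j, 1%N; split=> //; rewrite mulr1 mul1r. Qed.

Lemma monomial_xi i : (i <= p)%N -> monomial (xi i).
Proof. by move=> ip j jp; apply: xit. Qed.

Lemma monomial_desc l : monomial (desc p l).
Proof.
elim: l => [|l IH]; first exact: monomial1.
by apply: monomialM IH _; apply: monomial_xi; lia.
Qed.

Lemma monomial_asc j : (j <= p)%N -> monomial (asc j).
Proof.
elim: j => [|j IH] jp; first exact: monomial1.
by apply: monomialM (IH (ltnW jp)) _; apply: monomial_xi.
Qed.

Lemma monomial_rep r : r \in reps p -> monomial r.
Proof.
rewrite mem_cat => /orP[] /mapP[l]; rewrite mem_iota => lp ->.
  exact: monomial_desc.
by apply: monomialM (monomial_desc _) (monomial_asc _); lia.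
Qed.

Lemma monomial_tpoly r m : monomial r -> tpoly p.+1 m ->
  exists2 m', tpoly p.+1 m' & r * m = m' * r.
Proof.
move=> mr; elim=> [|j a jp _ [m' tm' E]|a b _ [m1 t1 E1] _ [m2 t2 E2]|c a _ [m' tm' E]].
- by exists 1; [apply: tpoly1|rewrite mulr1 mul1r].
- have [k [e [kp E']]] := mr j jp; exists (t k ^+ e * m').
    by apply: tpolyM => //; apply: tpoly_exp; apply: tpoly_t.
  by rewrite mulrA E' -mulrA E mulrA.
- by exists (m1 + m2); [apply: tpolyD|rewrite mulrDr mulrDl E1 E2].
- by exists (c *: m'); [apply: tpolyZ|rewrite -scalerAr E scalerAl].
Qed.

Lemma follows_rep_t r j : r \in reps p -> (j <= p)%N -> follows (r * t j).
Proof.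
move=> rr jp; have [m tm ->] := monomial_tpoly (monomial_rep rr) (@tpoly_t p.+1 j jp).
exact: follows_tpoly.
Qed.

(** The quadratic relation falls back on r and r xi_i, with coefficients in the t_j
that move to the left through r. *)
Lemma follows_square r i : (i <= p)%N -> r \in reps p -> r * xi i \in reps p ->
  follows (r * xi i * xi i).
Proof.
move=> ip rr rxr; have [a [b [ta tb e]]] := xi2 (leq_ltn_trans ip pn).
rewrite -mulrA e mulrDr; apply: followsD.
  have [|m tm ->] := @monomial_tpoly _ a (monomial_rep rr); last exact: follows_tpoly.
  exact: tpolyW ta.
have [|m tm E] := @monomial_tpoly _ b (monomial_rep rr); first exact: tpolyW tb.
by rewrite mulrA E -mulrA; apply: follows_tpoly.
Qed.

Lemma desc_rep l : (l <= p.+1)%N -> desc p l \in reps p.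
Proof. by move=> lp; rewrite mem_cat map_f // mem_iota. Qed.

Lemma asc_rep j : (j <= p)%N -> desc p p.+1 * asc j \in reps p.
Proof.
case: j => [|j] jp; first by rewrite mulr1 desc_rep.
by rewrite mem_cat; apply/orP; right; apply: map_f; rewrite mem_iota; lia.
Qed.

(** According to the position of i, the generator xi_i commutes with the descending
word, is shifted through it by a braid relation, lengthens it, or meets a last
factor xi_i. *)
Lemma follows_desc_xi l i : (l <= p.+1)%N -> (i <= p)%N -> follows (desc p l * xi i).
Proof.
move=> lp ip; have [il|il|il] := ltngtP (i + l)%N p.
- by rewrite descC //; apply: follows_xi; [lia|apply: desc_rep].
- case: l lp il => [|l] lp il; first by lia.
  have [e|ne] := eqVneq i (p - l)%N.
    rewrite /= -e; apply: follows_square => //; first by apply: desc_rep; lia.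
    by have -> : desc p l * xi i = desc p l.+1 by [rewrite /= e]; apply: desc_rep.
  have [i1|i1] := ltnP 1 i.
    by rewrite descS ?i1 //; [|lia]; apply: follows_xi; [lia|apply: desc_rep].
  have -> : i = 1%N by lia.
  have -> : l = p by lia.
  have := @asc_rep 1; rewrite /= mul1r => h; apply: follows_rep; apply: h; lia.
- have -> : i = (p - l)%N by lia.
  by rewrite -/(desc p l.+1); apply: follows_rep; apply: desc_rep; lia.
Qed.

Lemma follows_asc_xi j i : (j <= p)%N -> (i <= p)%N ->
  follows (desc p p.+1 * asc j * xi i).
Proof.
move=> jp ip; case: j jp => [|j] jp; first by rewrite mulr1; apply: follows_desc_xi.
have [ij|ij|->] := ltngtP i j.+1.
- have [->|i0] := posnP i.
    by rewrite desc_asc0 //; apply: follows_xi; [lia|apply: asc_rep].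
  rewrite -mulrA ascS ?i0 //; [|lia].
  rewrite mulrA descS //; [|lia..]; rewrite -mulrA; apply: follows_xi; [lia|].
  exact: asc_rep.
- have [->|ne] := eqVneq i j.+2.
    by rewrite -mulrA -/(asc j.+2); apply: follows_rep; apply: asc_rep; lia.
  rewrite -mulrA ascC; [|lia..]; rewrite mulrA descS; [|lia..].
  by rewrite -mulrA; apply: follows_xi; [lia|apply: asc_rep].
- rewrite ascE mulrA; apply: follows_square => //; first by apply: asc_rep; lia.
  by rewrite -mulrA -/(asc j.+1); apply: asc_rep.
Qed.

Lemma follows_rep_xi r i : r \in reps p -> (i <= p)%N -> follows (r * xi i).
Proof.
rewrite mem_cat => /orP[] /mapP[l]; rewrite mem_iota => lp -> ip.
  by apply: follows_desc_xi => //; lia.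
by apply: follows_asc_xi => //; lia.
Qed.

Lemma closed_step g : (forall r, r \in reps p -> follows (r * g)) ->
  forall a, S a -> S (a * g).
Proof.
move=> fg a; elim=> {a} [a||a b _ IHa _ IHb|c a _ IH].
- rewrite normal_formsS => /allpairsPdep[x [h [xN /allpairsPdep[e [r [_ rr ->]]] ->]]].
  by rewrite -mulrA -mulrA mulrA; apply: fg => //; apply: spanned_mem.
- by rewrite mul0r; apply: spanned0.
- by rewrite mulrDl; apply: spannedD.
- by rewrite -scalerAl; apply: spannedZ.
Qed.
End Step.

(** Induction on the rank: in xi_i r with i < p, the factor xi_i is absorbed by the
normal forms of rank p. *)
Lemma normal_forms_closed m : (m <= n)%N ->
  forall a j, spanned (normal_forms m) a -> (j < m)%N ->
    spanned (normal_forms m) (a * t j) /\ spanned (normal_forms m) (a * xi j).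
Proof.
elim: m => // m IH mn a j Sa jm; have {}IH := IH (ltnW mn).
split; apply: closed_step Sa => // r rr.
  by apply: follows_rep_t => // [b i Sb im]; have [] := IH b i Sb im.
by apply: follows_rep_xi => // [b i Sb im|b i Sb im]; have [] := IH b i Sb im.
Qed.

Lemma normal_forms1 m : spanned (normal_forms m) 1.
Proof.
apply: spanned_mem; elim: m => [|m IH]; first by rewrite inE.
rewrite normal_formsS -[1]mulr1; apply: allpairs_f => //.
rewrite -[1]mulr1 -[X in X * _](expr0 (t m)); apply: allpairs_f.
  by rewrite mem_iota.
by rewrite /reps inE eqxx.
Qed.
End NormalForm.

(** * Algebras with matrix units are split *)

Section Descent.
Variables (k k' : fieldType) (iota : {rmorphism k -> k'}) (A : algType k) (m : nat).
Variable rho : {lrmorphism A -> 'M[k']_m | iota \; *:%R}.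

(** Matrices over k are determined by their images under the embedding iota, so the
matrices S inherit the algebra structure of A. *)
Lemma descend_unitmx (P : 'M[k']_m) : P \in unitmx ->
  (forall a, exists S : 'M[k]_m, P *m rho a = map_mx iota S *m P) ->
  exists (sigma : {lrmorphism A -> 'M[k]_m}) (Q : 'M[k']_m),
    Q \in unitmx /\ forall a, Q *m rho a = map_mx iota (sigma a) *m Q.
Proof.
move=> uP /choice[s sE].
have sP a S : P *m rho a = map_mx iota S *m P -> s a = S.
  move=> e; apply: (@map_mx_inj _ _ iota); apply: (can_inj (mulmxK uP)).
  by rewrite -sE.
have sD : {morph s : a b / a + b}.
  by move=> a b; apply: sP; rewrite raddfD mulmxDr !sE raddfD mulmxDl.
have sZ : scalable s.
  move=> c a; apply: sP; rewrite linearZ /= -scalemxAr sE map_mxZ.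
  by rewrite scalemxAl.
have sM : {morph s : a b / a * b}.
  move=> a b; apply: sP; rewrite rmorphM -[rho a * rho b]/(rho a *m rho b).
  by rewrite mulmxA sE -mulmxA sE mulmxA -map_mxM.
have s1 : s 1 = 1.
  by apply: sP; rewrite rmorph1 mulmx1 map_mx1 mul1mx.
have s0 : s 0 = 0 by apply: sP; rewrite raddf0 map_mx0 mulmx0 mul0mx.
have sl : linear s by move=> c a b; rewrite sD sZ.
pose L := GRing.isLinear.Build k A 'M[k]_m *:%R s sl.
pose Mm := GRing.isMonoidMorphism.Build A 'M[k]_m s (s1, sM).
pose sigma : {lrmorphism A -> 'M[k]_m} := HB.pack s L Mm.
by exists sigma, P.
Qed.

(** Here P is only known to be a rectangular matrix whose rows form a basis; its
number of rows is then m. *)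
Lemma descend_basis p (P : 'M[k']_(p, m)) : row_free P -> row_full P ->
  (forall a, exists S : 'M[k]_p, P *m rho a = map_mx iota S *m P) ->
  exists (sigma : {lrmorphism A -> 'M[k]_m}) (Q : 'M[k']_m),
    Q \in unitmx /\ forall a, Q *m rho a = map_mx iota (sigma a) *m Q.
Proof.
rewrite /row_free /row_full => /eqP rP /eqP rP'; have e : p = m by rewrite -rP rP'.
subst p => h; apply: (@descend_unitmx P) => //.
by rewrite -row_free_unit /row_free rP.
Qed.
End Descent.

Section MatrixUnits.
Variables (k : fieldType) (A : algType k) (I : finType) (T : eqType) (cls : I -> T).
Variable E : I -> I -> A.
Hypothesis E_mul : forall i j i' j', cls i = cls j -> cls i' = cls j' ->
  E i j * E i' j' = if j == i' then E i j' else 0.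
Hypothesis E_sum : \sum_i E i i = 1.
Hypothesis E_span : forall (Q : A -> Prop), Q 0 ->
  (forall a b, Q a -> Q b -> Q (a + b)) ->
  (forall c a, Q a -> Q (c *: a)) -> (forall i j, cls i = cls j -> Q (E i j)) ->
  forall a, Q a.

(** A representative of the class of i that depends only on the class. *)
Definition class_rep (i : I) : I := odflt i [pick j | cls j == cls i].

Lemma cls_rep i : cls (class_rep i) = cls i.
Proof. by rewrite /class_rep; case: pickP => //= j /eqP. Qed.

Lemma rep_eq i j : cls i = cls j -> class_rep i = class_rep j.
Proof.
move=> e; rewrite /class_rep e; case: pickP => //= h.
by have := h j; rewrite eqxx.
Qed.

Section Rep.
Variables (k' : fieldType) (iota : {rmorphism k -> k'}) (m : nat).
Variable rho : {lrmorphism A -> 'M[k']_m | iota \; *:%R}.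

Let e i j : 'M[k']_m := rho (E i j).

Let e_mul i j i' j' : cls i = cls j -> cls i' = cls j' ->
  e i j *m e i' j' = if j == i' then e i j' else 0.
Proof.
move=> ij ij'; rewrite -[LHS](rmorphM rho) E_mul //.
by case: ifP => // _; rewrite raddf0.
Qed.

Let B i := row_base (e i i).
Let M i : 'M_(_, m) := B (class_rep i) *m e (class_rep i) i.
Let J : finType := {i : I & 'I_(\rank (e (class_rep i) (class_rep i)))}.
(** The rows are bases of the row spaces of the idempotents of the representatives,
transported to the whole class by the matrix units. *)
Let P0 : 'M[k']_(#|J|, m) :=
  \matrix_(a < #|J|) row (tagged (enum_val a)) (M (tag (enum_val a))).

Let rowP0 i x : row (enum_rank (Tagged _ x : J)) P0 = row x (M i).
Proof. by rewrite rowK enum_rankK. Qed.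

Let B_e i : B i *m e i i = B i.
Proof.
have : (B i <= e i i)%MS by rewrite eq_row_base.
by case/submxP=> D ->; rewrite -mulmxA e_mul // eqxx.
Qed.

Let M_e i j l : cls j = cls l ->
  M i *m e j l = if i == j then B (class_rep i) *m e (class_rep i) l else 0.
Proof.
move=> jl; rewrite -mulmxA e_mul ?cls_rep //.
by case: ifP => // _; rewrite mulmx0.
Qed.

Let P0_free : row_free P0.
Proof.
apply: inj_row_free => c cP; apply/rowP => a; rewrite mxE.
case: (enum_val a) (enum_valK a) => i x <- {a}.
pose ci : 'rV_(\rank (e (class_rep i) (class_rep i))) :=
  \row_y c 0 (enum_rank (Tagged _ y : J)).
suff /rowP/(_ x) : ci = 0 by rewrite !mxE.
apply: (row_free_inj (row_base_free (e (class_rep i) (class_rep i)))).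
rewrite mul0mx -[RHS](mul0mx _ (e i (class_rep i))) -cP.
rewrite mulmx_sum_row [c *m P0]mulmx_sum_row mulmx_suml.
rewrite (reindex (@enum_rank J)) /=; last first.
  by exists enum_val => a _; rewrite ?enum_rankK ?enum_valK.
transitivity (\sum_(l : I) \sum_(y < \rank (e (class_rep l) (class_rep l)))
    c 0 (enum_rank (Tagged _ y : J)) *: (row y (M l) *m e i (class_rep i))); last first.
  rewrite sig_big_dep /=; apply: eq_bigr => -[l y] _ /=.
  by rewrite rowP0 scalemxAl.
rewrite (bigD1 i) //= [X in _ + X]big1 ?addr0 => [|l ne]; last first.
  apply: big1 => y _; rewrite -row_mul M_e ?cls_rep //.
  by rewrite (negbTE ne) row0 scaler0.
apply: eq_bigr => y _; rewrite mxE -row_mul M_e ?cls_rep // eqxx.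
by rewrite B_e.
Qed.

Let P0_full : row_full P0.
Proof.
rewrite -sub1mx; have -> : 1%:M = \sum_i e i i :> 'M_m.
  by rewrite /e -raddf_sum E_sum; apply/esym/(rmorph1 rho).
apply: summx_sub => i _.
have -> : e i i = e i (class_rep i) *m e (class_rep i) i.
  by rewrite e_mul ?cls_rep // eqxx.
have /submxP[D ->] : (e i (class_rep i) <= B (class_rep i))%MS.
  rewrite eq_row_base; apply/submxP; exists (e i (class_rep i)).
  by rewrite e_mul ?cls_rep // eqxx.
rewrite -mulmxA; apply: mulmx_sub; rewrite -/(M i).
by apply/row_subP => x; rewrite -rowP0 row_sub.
Qed.

Lemma matrix_units_descend :
  exists (sigma : {lrmorphism A -> 'M[k]_m}) (Q : 'M[k']_m),
    Q \in unitmx /\ forall a, Q *m rho a = map_mx iota (sigma a) *m Q.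
Proof.
apply: (@descend_basis _ _ _ _ _ rho _ P0) => //; apply: E_span.
- by exists 0; rewrite raddf0 mulmx0 raddf0 mul0mx.
- move=> a b [S e1] [S' e2]; exists (S + S').
  by rewrite raddfD mulmxDr e1 e2 raddfD mulmxDl.
- move=> c a [S e1]; exists (c *: S).
  by rewrite linearZ /= -scalemxAr e1 map_mxZ scalemxAl.
- move=> i j ij.
  have H (a : 'I_#|J|) : exists r : 'rV[k]_#|J|,
      row a P0 *m e i j = map_mx iota r *m P0.
    case: (enum_val a) (enum_valK a) => l x <- {a}.
    rewrite rowP0 -row_mul M_e //; have [li|_] := eqVneq l i; last first.
      by exists 0; rewrite row0 raddf0 mul0mx.
    suff [y ->] : exists y, row x (B (class_rep l) *m e (class_rep l) j) = row y P0.
      by exists (delta_mx 0 y); rewrite map_delta_mx -rowE.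
    have lj : class_rep l = class_rep j by apply: rep_eq; rewrite li.
    move: x; rewrite lj => x.
    exists (enum_rank
      (existT (fun i => 'I_(\rank (e (class_rep i) (class_rep i)))) j x : J)).
    exact/esym/rowP0.
  have [s sE] := fin_all_exists H; exists (\matrix_a s a); apply/row_matrixP => a.
  by rewrite !row_mul sE -map_row rowK.
Qed.
End Rep.

(** The induction principle E_span expresses that the E i j span the algebra. *)
Theorem matrix_units_split : split_algebra A.
Proof.
split; last by move=> k' iota m rho; apply: matrix_units_descend.
exists [seq E i j | i <- enum I, j <- enum I] => a; apply: spanned_coef.
move: a; apply: E_span => [|||i j ij].
- exact: spanned0.
- exact: spannedD.
- exact: spannedZ.
by apply: spanned_mem; apply: allpairs_f; rewrite mem_enum.
Qed.
End MatrixUnits.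

(** * The seminormal operators *)

Section Seminormal.
Variables (K : fieldType) (u omega : K) (d n : nat).
Local Notation negz := (negz d).
Local Notation zclass := (zclass d).
Local Notation key := (key d).
Local Notation flip := (flip d).
Local Notation std := (std d n).
Local Notation word := (seq letter).

(** The eigenvalue of a Jucys-Murphy element for a box. The xi_i with equal
eigenvalues of the t_j are Hecke operators with eigenvalues 1 and -u; increasing
the content by one multiplies by u, and the diagram that receives the first box
decides whether xi_0 acts by 1 or by -u. *)
Definition cval (y : bool * int) : K := (if y.1 then - u else 1) * u ^ y.2.

(** The diagonal coefficient of Young's seminormal form of the Hecke algebra. *)
Definition acoef (y y' : bool * int) : K := (1 - u) * cval y' / (cval y' - cval y).
(** For adjacent contents in one diagram the swapped word is not standard, and the
coefficient is set to zero. One of bcoef y y' and bcoef y' y vanishes there by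
its formula, and only their product matters. *)
Definition bcoef (y y' : bool * int) : K :=
  if (y.1 == y'.1) && (`|y.2 - y'.2| == 1)%N then 0
  else (u * cval y' - cval y) / (cval y' - cval y).
(** For z' = -z <> z, the operator xi_i exchanges the eigenvalues and acts on the
boxes by a Hecke operator T with T^2 = (1 - u) T + u. Taking T for one order of z
and z', and u T^-1 = T - (1 - u) for the other, gives xi_i^2 = u and keeps the
Jucys-Murphy elements in a simple form, see [opJE]. *)
Definition ecoef (z z' : nat) : bool := (negz z < z)%N && (z' < negz z')%N.
(** Only the product of ccoef z z' and ccoef z' z is prescribed, and it is u or -u.
Putting the factor u on one side avoids its square root. *)
Definition ccoef (z z' : nat) : K :=
  if (zclass z < zclass z')%N then u else (- 1) ^+ (z + z').

(** The coefficients of the word in which only the eigenvalues are exchanged, and of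
the word in which the whole letters are exchanged. *)
Definition Pcoef (x x' : letter) : K :=
  if zclass x.1 == zclass x'.1 then acoef x.2 x'.2 - (ecoef x.1 x'.1)%:R * (1 - u) else 0.
Definition Qcoef (x x' : letter) : K :=
  if zclass x.1 == zclass x'.1 then bcoef x.2 x'.2 else ccoef x.1 x'.1.

(** As in [ccoef], the whole factor u is put on one of the two directions between z
and -z; likewise [gcoef] puts the content value on one direction. *)
Definition xi0_coef (z : nat) : K := if (z < negz z)%N then u else 1.
Definition gcoef (x : letter) : K := if (x.1 < negz x.1)%N then 1 else cval x.2.

Definition op_xi (i : nat) (f : word -> K) (w : word) : K :=
  if i is j.+1 then
    if drop j w is x :: x' :: q then
      Pcoef x x' * f (take j w ++ (x'.1, x.2) :: (x.1, x'.2) :: q)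
      + Qcoef x x' * f (take j w ++ x' :: x :: q)
    else 0
  else if w is x :: q then xi0_coef x.1 * gcoef x * f (flip x :: q) else 0.

Arguments op_xi : simpl never.

Definition op_t (j : nat) (f : word -> K) (w : word) : K :=
  omega ^+ (nth (0%N, (false, 0)) w j).1 * f w.

Lemma op_xi0E x q f : op_xi 0 f (x :: q) = xi0_coef x.1 * gcoef x * f (flip x :: q).
Proof. by []. Qed.

Lemma op_xiE p x x' q f : op_xi (size p).+1 f (p ++ x :: x' :: q) =
  Pcoef x x' * f (p ++ (x'.1, x.2) :: (x.1, x'.2) :: q)
  + Qcoef x x' * f (p ++ x' :: x :: q).
Proof. by rewrite /op_xi drop_size_cat // take_size_cat. Qed.

Lemma op_xiE2 p x1 x x' q f : op_xi (size p).+2 f (p ++ x1 :: x :: x' :: q) =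
  Pcoef x x' * f (p ++ x1 :: (x'.1, x.2) :: (x.1, x'.2) :: q)
  + Qcoef x x' * f (p ++ x1 :: x' :: x :: q).
Proof. by have := op_xiE (rcons p x1) x x' q f; rewrite size_rcons !cat_rcons. Qed.

(** Operators on disjoint positions commute. *)
Lemma op_xi_far0 x r y y' q f : let w := x :: r ++ y :: y' :: q in
  op_xi 0 (op_xi (size r).+2 f) w = op_xi (size r).+2 (op_xi 0 f) w.
Proof.
have E g a := op_xiE (a :: r) y y' q g.
by rewrite /= in E *; rewrite op_xi0E !E !op_xi0E; ring.
Qed.

Lemma op_xi_far p x x' r y y' q f : let w := p ++ x :: x' :: r ++ y :: y' :: q in
  let i := (size p).+1 in let j := (size p + size r + 2).+1 in
  op_xi i (op_xi j f) w = op_xi j (op_xi i f) w.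
Proof.
move=> w i j; have E g a b := op_xiE (p ++ a :: b :: r) y y' q g.
have ej a b : (size (p ++ a :: b :: r)).+1 = j by rewrite size_cat /j /= !addnS addn0.
have {}E g a b : op_xi j g (p ++ a :: b :: r ++ y :: y' :: q) =
    Pcoef y y' * g (p ++ a :: b :: r ++ (y'.1, y.2) :: (y.1, y'.2) :: q) +
    Qcoef y y' * g (p ++ a :: b :: r ++ y' :: y :: q).
  by move: (E g a b); rewrite ej -!catA.
by rewrite /w !(op_xiE, E); ring.
Qed.

Definition zof (w : word) (j : nat) : nat := (nth (0%N, (false, 0)) w j).1.

Lemma op_xi0_t w j f : op_xi 0 (op_t j f) w =
  omega ^+ (if j == 0%N then negz (zof w 0) else zof w j) * op_xi 0 f w.
Proof. by case: w j => [|x q] [|j]; rewrite /op_xi ?mulr0 // /op_t /zof /=; ring. Qed.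

Lemma op_xi_t i w j f : (i.+1 < size w)%N -> op_xi i.+1 (op_t j f) w =
  omega ^+ zof w (if j == i then i.+1 else if j == i.+1 then i else j) * op_xi i.+1 f w.
Proof.
move=> h; have sd := size_drop i w; rewrite -[w](cat_take_drop i).
have si : size (take i w) = i by rewrite size_takel // -ltnS; apply: ltnW (ltnW _).
case: (drop i w) sd => [|x [|x' q]] /= sd; [by lia..|].
move: (take i w) si => p <- {i sd h}; rewrite !op_xiE /op_t /zof !nth_cat.
have [jp|jp|->] := ltngtP j (size p).
- have -> : (j == (size p).+1) = false by lia.
  by rewrite jp; ring.
- have [->|ne] := eqVneq j (size p).+1; first by rewrite ltnn subSnn subnn /=; ring.
  rewrite ltnNge ltnW //=; have -> : (j - size p)%N = (j - size p).-2.+2 by lia.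
  by rewrite /=; ring.
- by rewrite ltnNge leqnSn /= subSnn subnn /=; ring.
Qed.

Lemma op_t_comm i j f w : op_t i (op_t j f) w = op_t j (op_t i f) w.
Proof. by rewrite /op_t; ring. Qed.

Hypothesis d_gt0 : (0 < d)%N.
Hypothesis d_even : ~~ odd d.
Hypothesis u_neq0 : u != 0.
Hypothesis u_free : forall a : int, a != 0 -> u ^ a != 1.
Hypothesis u_freeN : forall a : int, u ^ a != - 1.

Lemma cval_neq0 y : cval y != 0.
Proof.
rewrite /cval mulf_eq0 negb_or expfz_neq0 // andbT.
by case: y.1; rewrite ?oppr_eq0 ?oner_eq0.
Qed.

Lemma cvalE y : cval y = (- 1) ^+ y.1 * u ^ (y.2 + y.1%:Z).
Proof.
case: y => [] [] a; rewrite /cval /= ?addr0 ?mul1r //.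
by rewrite expfzDr // expr1z expr1 mulN1r mulNr mulrC.
Qed.

(** The values u^a and -u^(a+1) are distinct because no power of u but the trivial
one is 1 and none is -1. *)
Lemma cval_inj : injective cval.
Proof.
move=> [e a] [e' a']; rewrite !cvalE /= => h.
have ub b b' : u ^ b = u ^ b' -> b = b'.
  move=> hb; apply/eqP; rewrite -subr_eq0; apply: contraT => /u_free/eqP[].
  by rewrite expfzDr // -invr_expz hb mulfV ?expfz_neq0.
have ubN b b' : u ^ b <> - u ^ b'.
  move=> hb; have /eqP := u_freeN (b - b'); apply.
  by rewrite expfzDr // -invr_expz hb mulNr mulfV ?expfz_neq0.
case: e e' h => [] [] /=; rewrite ?expr1 ?expr0 ?mulN1r ?mul1r.
- by move/oppr_inj/ub => h; congr (_, _); lia.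
- by move/esym/ubN.
- by move/ubN.
- by move/ub => h; congr (_, _); lia.
Qed.

Lemma cval_sub y y' : y != y' -> cval y' - cval y != 0.
Proof. by move=> ne; rewrite subr_eq0 (inj_eq cval_inj) eq_sym. Qed.

Lemma acoefD y y' : y != y' -> acoef y' y = (1 - u) - acoef y y'.
Proof.
move=> ne; rewrite /acoef; field.
by rewrite (cval_sub ne) cval_sub // eq_sym.
Qed.

Lemma acoef_cval y y' : y != y' -> acoef y' y * cval y' = - (acoef y y' * cval y).
Proof.
move=> ne; rewrite /acoef; field.
by rewrite (cval_sub ne) cval_sub // eq_sym.
Qed.

(** The identity behind the braid relation of length three. *)
Lemma acoef_cocycle y1 y2 y3 : y1 != y2 -> y1 != y3 -> y2 != y3 ->
  acoef y1 y2 * acoef y2 y3 =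
  acoef y1 y3 * (acoef y1 y2 + acoef y2 y3 - (1 - u)).
Proof.
move=> n12 n13 n23; rewrite /acoef; field.
by rewrite !cval_sub.
Qed.

(** Where bcoef was set to zero the right-hand side vanishes as well. *)
Lemma bcoefM (y y' : bool * int) : y != y' ->
  bcoef y y' * bcoef y' y = u + acoef y y' * ((1 - u) - acoef y y').
Proof.
move=> ne.
have E : (u * cval y' - cval y) / (cval y' - cval y)
     * ((u * cval y - cval y') / (cval y - cval y'))
   = u + acoef y y' * ((1 - u) - acoef y y').
  by rewrite /acoef; field; rewrite (cval_sub ne) cval_sub // eq_sym.
rewrite /bcoef (eq_sym y'.1) (distnC y'.2); case: ifP => // /andP[/eqP e /eqP h].
rewrite mul0r -{}E; suff [->|->] : u * cval y' = cval y \/ u * cval y = cval y'.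
- by rewrite subrr mul0r mul0r.
- by rewrite subrr mul0r mulr0.
rewrite /cval e; have [->|->] : y.2 = y'.2 + 1 \/ y'.2 = y.2 + 1 by lia.
  by left; rewrite expfzDr // expr1z; ring.
by right; rewrite expfzDr // expr1z; ring.
Qed.

Lemma bcoef_neq0 (y y' : bool * int) : y != y' ->
  ~~ ((y.1 == y'.1) && (`|y.2 - y'.2| <= 1)%N) ->
  bcoef y y' != 0.
Proof.
move=> ne h; rewrite /bcoef ifF; last by apply: contraNF h => /andP[-> /eqP->].
rewrite mulf_eq0 negb_or invr_eq0 cval_sub // andbT subr_eq0.
have -> : u * cval y' = cval (y'.1, y'.2 + 1) by rewrite /cval /= expfzDr // expr1z; ring.
rewrite (inj_eq cval_inj); apply: contraNneq h => <-; rewrite eqxx /=; lia.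
Qed.

Lemma letter_ok_mix x x' : letter_ok d x -> letter_ok d x' ->
  zclass x.1 = zclass x'.1 -> letter_ok d (x'.1, x.2).
Proof.
case/andP=> xd ok /andP[xd' _] e; rewrite /letter_ok /= xd' /=.
apply/implyP => /(implyP ok)/eqP h.
by move/eqP: e; rewrite zclass_eq // h (eq_sym x.1) orbb => /eqP->; apply/eqP.
Qed.

Lemma std_ok p x q : std (p ++ x :: q) -> letter_ok d x.
Proof. by case/and3P=> _; rewrite all_cat => /and3P[]. Qed.

Lemma std_mix p x x' q : zclass x.1 = zclass x'.1 -> std (p ++ x :: x' :: q) ->
  std (p ++ (x'.1, x.2) :: (x.1, x'.2) :: q).
Proof.
move=> e st; have ok := std_ok st.
have ok' : letter_ok d x' by move: st; rewrite -cat_rcons => /std_ok.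
move: st => /and3P[sz okw st]; apply/and3P; split.
- by move: sz; rewrite !size_cat.
- move: okw; rewrite !all_cat /= (letter_ok_mix ok ok' e) (letter_ok_mix ok' ok (esym e)).
  by case/and4P=> -> _ _ ->.
- by move: st; rewrite !std_from_cat /= !keyE /= e.
Qed.

Lemma std_pair p x x' q : std (p ++ x :: x' :: q) -> zclass x.1 = zclass x'.1 ->
  x.2 != x'.2.
Proof.
case/and3P=> _ _; rewrite std_from_cat => /and4P[_ a a' _] e.
apply: contraL a' => /eqP e2; have -> : key x' = key x by rewrite !keyE e e2.
exact: addable_neq.
Qed.

Lemma std_pair2 p x1 x x' q : std (p ++ x1 :: x :: x' :: q) -> zclass x.1 = zclass x'.1 ->
  x.2 != x'.2.
Proof. by rewrite -cat_rcons; apply: std_pair. Qed.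

Lemma std_triple p x1 x2 x3 q : std (p ++ x1 :: x2 :: x3 :: q) ->
  zclass x1.1 = zclass x3.1 ->
  x1.2 != x3.2.
Proof.
case/and3P=> _ _; rewrite std_from_cat => /= /and5P[_ a1 a2 a3 _] e.
apply: contraL a3 => /eqP e2; have -> : key x3 = key x1 by rewrite !keyE e e2.
exact: addable_neq3.
Qed.

(** The zeros of bcoef are chosen so that a swap with a nonzero coefficient leads to
a standard word. *)
Lemma Qcoef_far p x x' q : std (p ++ x :: x' :: q) ->
  Qcoef x x' != 0 <-> far (key x) (key x').
Proof.
move=> st; rewrite /far /Qcoef /=; case: (zclass x.1 =P zclass x'.1) => [e|_] /=; last first.
  by split=> // _; rewrite /ccoef; case: (_ < _)%N; rewrite ?signr_eq0.
have ne := std_pair st e; split=> h; last exact: bcoef_neq0.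
apply: contra h; case: x x' ne {st e} => [z [e a]] [z' [e' a']] /=.
rewrite /bcoef /= => ne /andP[/eqP ee h]; rewrite ee eqxx /= ifT //.
by move: ne; rewrite xpair_eqE ee eqxx /=; lia.
Qed.

(** The operators descend to functions on standard words: a word that is not
standard only occurs with a zero coefficient. *)
Lemma op_xi_ext i f f' w : (forall v, std v -> f v = f' v) -> std w ->
  op_xi i f w = op_xi i f' w.
Proof.
move=> ff'; case: i => [|i] st; rewrite /op_xi.
  by case: w st => // x q st; rewrite ff' //; apply: (@std_flip d n d_gt0 [::]).
case E: (drop i w) => [//|x [//|x' q]].
rewrite -(cat_take_drop i w) E in st; congr (_ + _).
  rewrite /Pcoef; case: eqP => [e|]; last by rewrite !mul0r.
  by congr (_ * _); apply: ff'; apply: std_mix.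
have [->|nz] := eqVneq (Qcoef x x') 0; first by rewrite !mul0r.
by congr (_ * _); apply: ff'; apply: std_swap => //; apply/(Qcoef_far st).
Qed.

Lemma ecoefD z z' : (z < d)%N -> (z' < d)%N -> zclass z = zclass z' ->
  ((ecoef z z')%:R + (ecoef z' z)%:R : K) = (z != z')%:R.
Proof.
move=> zd zd' /eqP; rewrite zclass_eq // => /orP[/eqP<-|/eqP->].
  by rewrite eqxx /ecoef; case: ltngtP => //=; rewrite addr0.
rewrite /ecoef negzK // (eq_sym z).
by case: ltngtP => /=; rewrite ?addr0 ?add0r.
Qed.

Lemma ccoefM z z' : zclass z != zclass z' -> ccoef z z' * ccoef z' z = u * (- 1) ^+ (z + z').
Proof.
rewrite /ccoef (addnC z'); case: ltngtP => // _ _; by rewrite // mulrC.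
Qed.

Lemma sign_negz z z' : (z < d)%N -> (- 1) ^+ (negz z + z') = (- 1) ^+ (z + z') :> K.
Proof.
move=> zd; rewrite -signr_odd -[RHS]signr_odd !oddD negzE //.
by case: eqP => [->//|_]; rewrite oddB ?(negbTE d_even) // ltnW.
Qed.

Lemma sign_zclass z z' : (z < d)%N -> (z' < d)%N -> zclass z = zclass z' ->
  (- 1) ^+ (z + z') = 1 :> K.
Proof.
move=> zd zd' /eqP; rewrite zclass_eq // => /orP[/eqP<-|/eqP->].
  by rewrite -signr_odd addnn odd_double.
by rewrite addnC sign_negz // -signr_odd addnn odd_double.
Qed.

(** With T^2 = (1 - u) T + u, the square is T^2 if the two eigenvalues are equal and
T (u T^-1) = u if they are distinct and opposite; otherwise it is the product of
two values of [ccoef]. *)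
Lemma op_xi_quad p x x' q f : let w := p ++ x :: x' :: q in std w ->
  op_xi (size p).+1 (op_xi (size p).+1 f) w =
  u * (- 1) ^+ (x.1 + x'.1) * f w
  + (if x.1 == x'.1 then (1 - u) * op_xi (size p).+1 f w else 0).
Proof.
case: x x' => [z y] [z' y'] w st.
have /andP[zd _] := std_ok st.
have /andP[zd' _] : letter_ok d (z', y') by move: st; rewrite /w -cat_rcons => /std_ok.
rewrite /w !op_xiE /Pcoef /Qcoef /= (eq_sym (zclass z')); case: eqP => [e|/eqP ne]; last first.
  rewrite !mul0r !add0r mulrA ccoefM // ifF ?addr0 //.
  by apply: contraNF ne => /eqP->.
have /= ny := std_pair st e; have /= eE := ecoefD zd zd' e.
have bb := bcoefM ny; rewrite sign_zclass // mulr1 (acoefD ny).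
have [zz|zz] := eqVneq z z'.
  rewrite {}zz eqxx in eE *.
  have -> : ecoef z' z' = false by rewrite /ecoef; case: ltngtP.
  by rewrite /=; ring: bb.
rewrite zz /= in eE; have -> : (ecoef z' z)%:R = 1 - (ecoef z z')%:R :> K.
  by rewrite -[LHS](addKr (ecoef z z')%:R) eE addrC.
have ee : (ecoef z z')%:R * (ecoef z z')%:R = (ecoef z z')%:R :> K.
  by rewrite -natrM mulnb andbb.
by move: (ecoef z z')%:R ee => e1 ee; ring: ee bb.
Qed.

(** The first letter of a standard word has content 0, so its content value is 1 or
-u, the roots of X^2 = (1 - u) X + u. *)
Lemma op_xi0_quad x q f : std (x :: q) ->
  op_xi 0 (op_xi 0 f) (x :: q) = u * f (x :: q)
  + (if negz x.1 == x.1 then (1 - u) * op_xi 0 f (x :: q) else 0).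
Proof.
move=> st; have ok := @std_ok [::] _ _ st; rewrite /op_xi flipK //.
have x0 : x.2.2 = 0.
  case/and3P: st => _ _ /= /andP[/andP[/= /eqP h1 /eqP h2] _].
  by move: h1 h2; lia.
case: x {st} ok x0 => [z [e a]] /= ok a0; rewrite a0 {a a0} in ok *.
have /andP[/= zd ok'] := ok.
rewrite /xi0_coef /gcoef /flip /= negzK //.
have [zz|zz|zz] := ltngtP z (negz z).
- have -> : e = false by apply: contraTF zz => he; rewrite -leqNgt (eqP (implyP ok' he)).
  by rewrite /cval /= expr0z; ring.
- have -> : e = false by apply: contraTF zz => he; rewrite -leqNgt (eqP (implyP ok' he)).
  by rewrite /cval /= expr0z; ring.
- by rewrite -zz /cval /= expr0z; case: e {ok ok'} => /=; ring.
Qed.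

(** The braid relation holds for T_i and T_j^-1 mixed, except for the patterns with
signs (+,-,+) and (-,+,-); the choice made in [ecoef] avoids these. *)
Lemma ecoef_trans z1 z2 z3 : (z1 < d)%N -> (z2 < d)%N -> zclass z1 = zclass z2 ->
  [|| [&& ~~ ecoef z1 z2, ~~ ecoef z2 z3 & ~~ ecoef z1 z3],
      ecoef z1 z2 && ~~ ecoef z2 z3 | ~~ ecoef z1 z2 && ecoef z2 z3].
Proof.
move=> zd zd' /eqP; rewrite zclass_eq // /ecoef => /orP[/eqP<-|/eqP->]; rewrite ?negzK //.
  by case: (ltngtP z1 (negz z1)) => //= _; case: (z3 < _)%N.
by case: (ltngtP z1 (negz z1)) => //= _; case: (z3 < _)%N.
Qed.

(** If the three eigenvalue classes are equal, the six words that occur give an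
identity in three content values; otherwise one operator at most is more than a
rescaled swap, and the coefficients match term by term. *)
Lemma op_xi_braid3 p x1 x2 x3 q f : let w := p ++ x1 :: x2 :: x3 :: q in std w ->
  op_xi (size p).+1 (op_xi (size p).+2 (op_xi (size p).+1 f)) w =
  op_xi (size p).+2 (op_xi (size p).+1 (op_xi (size p).+2 f)) w.
Proof.
case: x1 x2 x3 => [z1 y1] [z2 y2] [z3 y3] w st.
have /andP[/= zd1 _] := std_ok st.
have /andP[/= zd2 _] : letter_ok d (z2, y2) by move: st; rewrite /w -cat_rcons => /std_ok.
have /= n12 := std_pair st; have /= n23 := std_pair2 st; have /= n13 := std_triple st.
rewrite /w !(op_xiE, op_xiE2) /Pcoef /Qcoef /=.
have eE := ecoef_trans z3 zd1 zd2.
case: (zclass z1 =P zclass z2) n12 eE => [e12|ne12] n12 eE.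
  rewrite -!e12 in n23 *; case: (zclass z1 =P zclass z3) n13 n23 => [e13|ne13] n13 n23; last by ring.
  move: (n12 e12) (n13 e13) (n23 e13) (eE e12) => {}n12 {}n13 {}n23 {}eE.
  rewrite ?(acoefD n12) ?(acoefD n13) ?(acoefD n23).
  have bb12 := bcoefM n12; have bb13 := bcoefM n13; have bb23 := bcoefM n23.
  have coc := acoef_cocycle n12 n13 n23.
  move: (acoef y1 y2) (acoef y1 y3) (acoef y2 y3) bb12 bb13 bb23 coc => a12 a13 a23.
  move: (bcoef y1 y2) (bcoef y1 y3) (bcoef y2 y3) => b12 b13 b23.
  move: (bcoef y2 y1) (bcoef y3 y1) (bcoef y3 y2) => b21 b31 b32 bb12 bb13 bb23 coc.
  move: (f _) (f _) (f _) (f _) (f _) (f _) => F1 F2 F3 F4 F5 F6.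
  case: (ecoef z1 z2) (ecoef z2 z3) (ecoef z1 z3) eE => [] [] [] //= _; ring: coc bb12 bb13 bb23.
case: (zclass z1 =P zclass z3) n13 n23 => [e13|ne13] n13 n23.
  have -> : (zclass z2 == zclass z3) = false by apply/eqP => h; apply: ne12; rewrite e13 h.
  by ring.
by case: (zclass z2 =P zclass z3) n23 => [e23|ne23] n23; ring.
Qed.

(** The Jucys-Murphy elements xi_i ... xi_1 xi_0 xi_1 ... xi_i. *)
Fixpoint opJ (i : nat) : (word -> K) -> word -> K :=
  if i is i'.+1 then fun f => op_xi i (opJ i' (op_xi i f)) else op_xi 0.

Definition hcoef (z z' : nat) : K :=
  if zclass z == zclass z' then u else u * (- 1) ^+ (z + z').
Definition J_coef (p : word) (z : nat) : K := xi0_coef z * \prod_(y <- p) hcoef y.1 z.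

Lemma J_coef_neq0 p z : J_coef p z != 0.
Proof.
rewrite /J_coef mulf_neq0 //; first by rewrite /xi0_coef; case: ifP => // _; apply: oner_neq0.
elim/big_rec: _ => [|y c _ nc]; first exact: oner_neq0.
by rewrite mulf_neq0 // /hcoef; case: ifP; rewrite // mulf_neq0 // signr_eq0.
Qed.

Lemma gcoef_neq0 x : gcoef x != 0.
Proof. by rewrite /gcoef; case: ifP; rewrite ?oner_neq0 ?cval_neq0. Qed.

(** A Jucys-Murphy element flips one letter. When that letter is moved across one of
the same class and z = -z, this rests on T y T = u y', the rule by which T moves
a content value from one position to the next; the same happens when z is the
larger of z and -z. When z is the smaller one, gcoef is 1 and T meets u T^-1,
with product u. *)
Lemma opJE i p x q f : size p = i -> std (p ++ x :: q) ->
  opJ i f (p ++ x :: q) = J_coef p x.1 * gcoef x * f (p ++ flip x :: q).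
Proof.
elim: i p x q f => [|i IH] p x q f.
  by move/size0nil => -> st; rewrite /J_coef big_nil mulr1.
case/lastP: p => // p x0; rewrite size_rcons !cat_rcons => -[sp] st.
have E g a b : op_xi i.+1 g (p ++ a :: b :: q) =
    Pcoef a b * g (p ++ (b.1, a.2) :: (a.1, b.2) :: q) + Qcoef a b * g (p ++ b :: a :: q).
  by rewrite -sp op_xiE.
rewrite /= E.
have -> : Pcoef x0 x * opJ i (op_xi i.+1 f) (p ++ (x.1, x0.2) :: (x0.1, x.2) :: q) =
    Pcoef x0 x * (J_coef p x.1 * gcoef (x.1, x0.2) *
      op_xi i.+1 f (p ++ (negz x.1, x0.2) :: (x0.1, x.2) :: q)).
  rewrite /Pcoef; case: eqP => [e|_]; last by rewrite !mul0r.
  by congr (_ * _); apply: IH => //; apply: std_mix.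
have -> : Qcoef x0 x * opJ i (op_xi i.+1 f) (p ++ x :: x0 :: q) =
    Qcoef x0 x * (J_coef p x.1 * gcoef x * op_xi i.+1 f (p ++ flip x :: x0 :: q)).
  have [->|nz] := eqVneq (Qcoef x0 x) 0; first by rewrite !mul0r.
  by congr (_ * _); apply: IH => //; apply: std_swap => //; apply/(Qcoef_far st).
have ok : letter_ok d x by move: st; rewrite -cat_rcons => /std_ok.
have /andP[zd _] := ok; have /andP[zd0 _] := std_ok st.
have ny := std_pair st; have eE := ecoefD zd0 zd.
rewrite !E /J_coef -cats1 big_cat big_seq1 /=.
case: x0 x {st} ok zd zd0 ny eE => [z0 y0] [z y] /= ok zd zd0 ny eE.
rewrite /hcoef /Pcoef /Qcoef /flip /= zclass_negz // !(eq_sym (zclass z)).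
case: (zclass z0 =P zclass z) ny eE => [e|/eqP ne] ny eE; last first.
  rewrite !mul0r !add0r.
  have cc : ccoef z0 z * ccoef (negz z) z0 = u * (- 1) ^+ (z0 + z).
    by rewrite -ccoefM //; congr (_ * _); rewrite /ccoef zclass_negz // sign_negz.
  by move: (\prod_(y <- p) _) => c; ring: cc.
move: (ny e) (eE e) => {}ny {}eE.
have bb := bcoefM ny; have ay := acoef_cval ny.
rewrite (acoefD ny) in ay *.
have {}ay : acoef y0 y * cval y0 = - ((1 - u - acoef y0 y) * cval y) by rewrite ay opprK.
have e12 : if (z < negz z)%N then ecoef (negz z) z0 = ~~ ecoef z0 z
           else (ecoef z0 z = false) /\ (ecoef (negz z) z0 = false).
  move/eqP: e; rewrite eq_sym zclass_eq // /ecoef negzK // => /orP[/eqP<-|/eqP->].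
    by case: (ltngtP z).
  by rewrite negzK //; case: (ltngtP z).
rewrite /gcoef /=.
move: (\prod_(_ <- p) _) (f _) (f _) => c F G.
case: ltnP e12 => [zz ->|zz [-> ->]]; last by rewrite /=; ring: ay bb.
by case: (ecoef z0 z) => /=; ring: bb ay.
Qed.

(** The relation says that xi_0 commutes with the second Jucys-Murphy element, and
both only flip a letter. *)
Lemma op_xi_braid4 x x' q f : let w := x :: x' :: q in std w ->
  op_xi 0 (op_xi 1 (op_xi 0 (op_xi 1 f))) w = op_xi 1 (op_xi 0 (op_xi 1 (op_xi 0 f))) w.
Proof.
move=> w st; have ok := @std_ok [::] _ _ st.
have st' : std (flip x :: x' :: q) by apply: (@std_flip d n d_gt0 [::]).
have /andP[zd _] := ok.
rewrite -[op_xi 1 (op_xi 0 (op_xi 1 (op_xi 0 f))) w]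
  /(opJ 1 (op_xi 0 f) ([:: x] ++ x' :: q)).
rewrite opJE // -[LHS]/(xi0_coef x.1 * gcoef x * opJ 1 f ([:: flip x] ++ x' :: q)) opJE //.
rewrite /J_coef !big_seq1 /op_xi /= /hcoef zclass_negz // sign_negz //.
ring.
Qed.

End Seminormal.

Arguments op_xi : simpl never.

(** * Orders of the products of two reflections *)

Section Orders.
Variable n : nat.
Local Notation r := (@typeB_refl n).
Implicit Types (i j k : 'I_n) (x y w : 'M[int]_n).

Lemma has_order_uniq w m m' : has_order w m -> has_order w m' -> m = m'.
Proof.
case=> m0 wm hm [m0' wm' hm']; case: (ltngtP m m') => // lt.
  by have := hm' m; rewrite m0 lt => /(_ isT).
by have := hm m'; rewrite m0' lt => /(_ isT).
Qed.

(** The order of a product of two involutions is read off from the braid relation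
that they satisfy. *)
Lemma has_order2 x y : x * x = 1 -> y * y = 1 -> x <> y -> x * y = y * x ->
  has_order (x * y) 2.
Proof.
move=> xx yy xy c; split=> //.
  by rewrite expr2 {2}c mulrA -(mulrA x) yy mulr1 xx.
case=> [|[|l]] // _; rewrite expr1 => e; apply: xy.
by rewrite -[x]mulr1 -yy mulrA e mul1r.
Qed.

Lemma has_order3 x y : x * x = 1 -> y * y = 1 -> x <> y -> x * y * x = y * x * y ->
  has_order (x * y) 3.
Proof.
move=> xx yy xy c; split=> //.
  rewrite !exprS expr0 mulr1 !mulrA c.
  by rewrite -(mulrA (y * x)) yy mulr1 -(mulrA y) xx mulr1 yy.
case=> [|[|[|l]]] // _.
  by rewrite expr1 => e; apply: xy; rewrite -[x]mulr1 -yy mulrA e mul1r.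
rewrite expr2 mulrA c -mulrA -mulrA yy mulr1 => e; apply: xy.
have {}e : y = x by rewrite -[y]mulr1 -xx mulrA e mul1r.
by [].
Qed.

Lemma has_order4 x y : x * x = 1 -> y * y = 1 -> x * y <> y * x ->
  x * y * x * y = y * x * y * x -> has_order (x * y) 4.
Proof.
move=> xx yy xy c.
have e4 : (x * y) ^+ 4 = 1.
  have e2 : (x * y) ^+ 2 = x * y * x * y by rewrite expr2 !mulrA.
  rewrite (exprM _ 2 2) expr2 e2 {2}c !mulrA.
  by rewrite -(mulrA (x * y * x)) yy mulr1 -(mulrA (x * y)) xx mulr1 -(mulrA x) yy mulr1 xx.
have n2 : (x * y) ^+ 2 <> 1.
  rewrite expr2 => e; apply: xy.
  have : x * (x * y * (x * y)) * y = x * y by rewrite e mulr1.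
  by rewrite !mulrA xx mul1r -(mulrA (y * x)) yy mulr1 => ->.
split=> //; case=> [|[|[|[|l]]]] // _.
  by rewrite expr1 => e; apply: n2; rewrite e expr1n.
by move=> e3; apply: n2; move: e4; rewrite exprS e3 mulr1 => e; rewrite e expr1n.
Qed.

Definition rsign i k : int := if (val i == 0%N) && (k == i) then - 1 else 1.
Definition rperm i k : 'I_n := if val i == 0%N then k else tperm (ord_pred i) i k.

Lemma refl_coweight i k : r i *m coweight k = rsign i k *: coweight (rperm i k).
Proof.
rewrite /typeB_refl /rsign /rperm; case: ifP => i0 /=.
  apply/colP => l; rewrite mul_diag_mx !mxE eqxx andbT.
  by case: (eqVneq l k) => [->|_]; rewrite ?mulr0.
rewrite scale1r /tperm_mx; apply/colP => l; rewrite -row_permE !mxE !eqxx !andbT.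
by rewrite (can2_eq (tpermK (ord_pred i) i) (tpermK (ord_pred i) i)).
Qed.

Lemma eq_coweight x y : (forall k, x *m coweight k = y *m coweight k) -> x = y.
Proof.
move=> h; apply/matrixP => a b; move/colP/(_ a): (h b).
by rewrite /coweight -!colE !mxE.
Qed.

Lemma coweight_neq k l (c : int) : c != 0 -> k != l -> coweight k <> c *: coweight l.
Proof.
move=> c0 kl /colP/(_ k); rewrite !mxE !eqxx (negbTE kl) /= mulr0 => /eqP.
by rewrite oner_eq0.
Qed.

Lemma ord_predE i : val i != 0%N -> val (ord_pred i) = (val i).-1.
Proof.
case: i => [[|i] h] //= _; rewrite modnDr modn_small //; exact: ltnW.
Qed.

Lemma refl_sq i : r i * r i = 1.
Proof.
apply: eq_coweight => k; rewrite -mulmxA mul1mx refl_coweight -scalemxAr refl_coweight scalerA.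
rewrite /rsign /rperm; case: (val i == 0%N) => /=; last by rewrite tpermK mulr1 scale1r.
by case: ifP => _; rewrite ?mulrNN ?mulr1 scale1r.
Qed.

Lemma refl_neq i j : i != j -> r i <> r j.
Proof.
wlog ij : i j / (val i < val j)%N.
  move=> h ne; case: (ltngtP (val i) (val j)) => lt.
  - exact: h.
  - by move=> e; apply: (h j i) => //; rewrite eq_sym.
  - by move: ne; rewrite -val_eqE lt eqxx.
move=> ne /(congr1 (fun m => m *m coweight j)); rewrite !refl_coweight.
rewrite {1}/rsign {1}/rperm {1}/rsign (eq_sym j) (negbTE ne) andbF.
have j0 : val j != 0%N by case: (val j) ij.
have pj := ord_predE j0.
rewrite [X in _ = X *: _](_ : _ = 1); last by rewrite (negbTE j0).
rewrite !scale1r /rperm (negbTE j0) tpermR.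
have -> : (if val i == 0%N then j else tperm (ord_pred i) i j) = j.
  case: ifP => // /negbT i0; rewrite tpermD // -val_eqE ?ord_predE //=.
  by move: ij => /=; lia.
rewrite -[coweight (ord_pred j)]scale1r; apply: coweight_neq => //.
by rewrite -val_eqE pj; move: j0 => /=; case: (nat_of_ord j) => // m _; rewrite -addn1; lia.
Qed.

Lemma perm_tperm (s : 'S_n) a b k : s (tperm a b k) = tperm (s a) (s b) (s k).
Proof. by rewrite -tpermJ permJ. Qed.

Lemma order_far i j : ((val i).+1 < val j)%N -> has_order (r i * r j) 2.
Proof.
move=> ij; have ne : i != j by rewrite -val_eqE /=; move: ij => /=; lia.
apply: has_order2; [exact: refl_sq|exact: refl_sq|exact: refl_neq|].
have j0 : val j != 0%N by case: (val j) ij.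
have pj := ord_predE j0.
apply: eq_coweight => k; rewrite -!mulmxA !refl_coweight -!scalemxAr !refl_coweight !scalerA.
rewrite /rsign /rperm !(negbTE j0) /=; have [i0|i0] := eqVneq (val i) 0%N.
  have e : tperm (ord_pred j) j i = i.
    by rewrite tpermD // -val_eqE ?pj /=; move: i0 ij => /=; lia.
  have -> : (tperm (ord_pred j) j k == i) = (k == i) by rewrite -{1}e (inj_eq perm_inj).
  by rewrite /= mulr1 mul1r.
rewrite !mulr1; congr (_ *: coweight _); have pi := ord_predE i0.
rewrite (perm_tperm (tperm (ord_pred i) i)) (tpermD (z := ord_pred j)) ?(tpermD (z := j)) //.
all: by rewrite -val_eqE ?pi ?pj; move: ij i0 j0 => /=; lia.
Qed.

Lemma order_adj i j : val i != 0%N -> val j = (val i).+1 -> has_order (r j * r i) 3.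
Proof.
move=> i0 ij; have ne : j != i by rewrite -val_eqE /=; move: ij => /=; lia.
apply: has_order3; [exact: refl_sq|exact: refl_sq|exact: refl_neq|].
have j0 : val j != 0%N by rewrite ij.
have pj : ord_pred j = i by apply: val_inj; rewrite ord_predE // ij.
have pi := ord_predE i0.
apply: eq_coweight => k; rewrite -!mulmxA !refl_coweight -!scalemxAr !refl_coweight.
rewrite -!scalemxAr !refl_coweight !scalerA /rsign /rperm !(negbTE j0) !(negbTE i0) pj /=.
congr (_ *: coweight _).
have ai : ord_pred i != i by rewrite -val_eqE pi; move: i0 => /=; lia.
have aj : ord_pred i != j by rewrite -val_eqE pi; move: ij i0 => /=; lia.
rewrite (perm_tperm (tperm i j)) tpermK tpermL (tpermD (z := ord_pred i)) // 1?eq_sym //.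
rewrite (perm_tperm (tperm (ord_pred i) i)) tpermK tpermR.
by rewrite (tpermD (z := j)) // eq_sym.
Qed.

Lemma order_01 i j : val i = 0%N -> val j = 1%N -> has_order (r i * r j) 4.
Proof.
move=> i0 j1; have ne : i != j by rewrite -val_eqE i0 j1.
have j0 : val j != 0%N by rewrite j1.
have pj : ord_pred j = i by apply: val_inj; rewrite ord_predE // j1 i0.
have rj k : r j *m coweight k = coweight (tperm i j k).
  by rewrite refl_coweight /rsign /rperm (negbTE j0) pj scale1r.
have ri k : r i *m coweight k = (if k == i then - 1 else 1) *: coweight k.
  by rewrite refl_coweight /rsign /rperm i0 eqxx.
apply: has_order4; [exact: refl_sq|exact: refl_sq| |].
  move/(congr1 (fun m => m *m coweight i)); rewrite -!mulmxA ri rj tpermL ri.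
  rewrite -scalemxAr rj tpermL eqxx eq_sym (negbTE ne) scale1r.
  move/colP/(_ j); rewrite !mxE !eqxx /= mulr1 => /eqP.
  by [].
have rjs c k : r j *m (c *: coweight k) = c *: coweight (tperm i j k).
  by rewrite -scalemxAr rj.
have ris c k : r i *m (c *: coweight k) = (c * (if k == i then - 1 else 1)) *: coweight k.
  by rewrite -scalemxAr ri scalerA.
apply: eq_coweight => k; rewrite -!mulmxA -[coweight k]scale1r !(rjs, ris) !tpermK.
by congr (_ *: _); rewrite mulrAC.
Qed.

Lemma has_orderC x y m : x * x = 1 -> y * y = 1 ->
  has_order (x * y) m -> has_order (y * x) m.
Proof.
move=> xx yy [m0 e h].
have conj l : (y * x) ^+ l = x * (x * y) ^+ l * x.
  elim: l => [|l IH]; first by rewrite !expr0 mulr1 xx.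
  by rewrite [in LHS]exprSr IH exprSr !mulrA.
split=> //; first by rewrite conj e mulr1 xx.
move=> l /h nl e'; apply: nl.
have : x * (y * x) ^+ l * x = 1 by rewrite e' mulr1 xx.
by rewrite conj !mulrA xx mul1r -mulrA xx mulr1.
Qed.

End Orders.

(** * The representation of the presented algebra *)

Lemma split2 (w : seq letter) i : (i.+1 < size w)%N ->
  exists p x x' q, size p = i /\ w = p ++ x :: x' :: q.
Proof.
move=> h; have := size_drop i w; case E: (drop i w) => [|x [|x' q]] /= sd; [lia..|].
exists (take i w), x, x', q; rewrite -E cat_take_drop size_takel //; lia.
Qed.

Lemma split3 (w : seq letter) i : (i.+2 < size w)%N ->
  exists p x1 x2 x3 q, size p = i /\ w = p ++ x1 :: x2 :: x3 :: q.
Proof.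
move=> h; have [|p [x1 [x2 [q [sp e]]]]] := @split2 w i; first lia.
move: h; rewrite e size_cat sp /=; case: q e => [|x3 q] e /=; first lia.
by exists p, x1, x2, x3, q.
Qed.

Section Action.
Variables (F : numFieldType) (d n : nat) (omegaF : F).
Hypothesis d_gt1 : (1 < d)%N.
Hypothesis d_even : ~~ odd d.
Hypothesis omegaF_prim : d.-primitive_root omegaF.

Let d_gt0 : (0 < d)%N := ltnW d_gt1.
Local Notation K := {fraction {poly F}}.
Local Notation L := (laurent F).
Local Notation word := (seq letter).
Local Notation expr := (nc_expr L ('I_n + 'I_n)).
Definition uK : K := tofrac 'X.
Definition omega : K := tofrac omegaF%:P.

Lemma uK_neq0 : uK != 0.
Proof. by rewrite tofrac_eq0 polyX_eq0. Qed.

(** A nonzero power of an indeterminate is not a constant. *)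
Lemma uK_exp (a : int) : a != 0 -> forall c : F, uK ^ a != tofrac c%:P.
Proof.
have X m (b c' : F) : tofrac (b%:P * 'X^(m.+1)) != tofrac c'%:P + 0 :> K \/ b = 0.
  have [->|b0] := eqVneq b 0; [by right|left].
  rewrite addr0 tofrac_eq; apply/eqP => /(congr1 (fun p : {poly F} => p`_m.+1)).
  by rewrite coefCM coefXn eqxx mulr1 coefC /= => /eqP; rewrite (negbTE b0).
case: a => [[|m]|m] // _ c.
  have [|/eqP] := X m 1 c; last by rewrite oner_eq0.
  by rewrite addr0 mul1r rmorphXn.
rewrite NegzE -invr_expz; apply/eqP => e.
have e1 : tofrac (c%:P * 'X^(m.+1)) = tofrac 1%:P :> K.
  by rewrite tofracM tofracXn -e polyC1 tofrac1 mulVf // expfz_neq0 // uK_neq0.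
have [|c0] := X m c 1; first by rewrite addr0 e1 eqxx.
move: e; rewrite c0 polyC0 rmorph0 => /eqP; rewrite invr_eq0.
by rewrite expfz_eq0 (negbTE uK_neq0) andbF.
Qed.

Lemma uK_free (a : int) : a != 0 -> uK ^ a != 1.
Proof. by move=> a0; rewrite -[1](rmorph1 (@tofrac {poly F})) -polyC1 uK_exp. Qed.

Lemma uK_freeN (a : int) : uK ^ a != - 1.
Proof.
have [->|a0] := eqVneq a 0.
  rewrite expr0z -subr_eq0 opprK -(rmorph1 (@tofrac {poly F})) -rmorphD tofrac_eq0.
  by rewrite -polyC1 -polyCD polyC_eq0 -mulr2n pnatr_eq0.
rewrite -(rmorph1 (@tofrac {poly F})) -rmorphN -polyC1 -polyCN.
exact: uK_exp.
Qed.

Fixpoint act (x : expr) (f : word -> K) (w : word) : K :=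
  match x with
  | Gen (inl j) => op_t omega j f w
  | Gen (inr i) => op_xi uK d i f w
  | Cst c => laurent_val c * f w
  | Add y z => act y f w + act z f w
  | Mul y z => act y (act z f) w
  end.

Lemma op_xi_lin i c (f g h : word -> K) w : (forall v, f v = c * g v + h v) ->
  op_xi uK d i f w = c * op_xi uK d i g w + op_xi uK d i h w.
Proof.
move=> e; case: i => [|i]; rewrite /op_xi.
  by case: w => [|x q]; rewrite ?mulr0 ?addr0 // e; ring.
by case: (drop i w) => [|x [|x' q]]; rewrite ?mulr0 ?addr0 // !e; ring.
Qed.

Lemma act_lin x c (f g h : word -> K) w : (forall v, f v = c * g v + h v) ->
  act x f w = c * act x g w + act x h w.
Proof.
elim: x f g h w => [[j|i]|a|x IHx y IHy|x IHx y IHy] f g h w e /=.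
- by rewrite /op_t e; ring.
- exact: op_xi_lin.
- by rewrite e; ring.
- by rewrite (IHx _ _ _ _ e) (IHy _ _ _ _ e); ring.
- by apply: IHx => v; apply: IHy.
Qed.

Lemma act_ext x f g w : (forall v, std d n v -> f v = g v) -> std d n w ->
  act x f w = act x g w.
Proof.
elim: x f g w => [[j|i]|a|x IHx y IHy|x IHx y IHy] f g w e st /=.
- by rewrite /op_t e.
- exact: (op_xi_ext d_gt0 d_even uK_neq0 uK_free uK_freeN i e st).
- by rewrite e.
- by rewrite (IHx f g) // (IHy f g).
- by apply: IHx => // v sv; apply: IHy.
Qed.

Definition acts_by (x : expr) (D : word -> K) := forall f w, act x f w = D w * f w.

Lemma acts_by_exp x D m : acts_by x D -> acts_by (nc_exp x m) (fun w => D w ^+ m).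
Proof.
move=> xD f w; elim: m f w => [|m IH] f w /=; first by rewrite expr0.
by rewrite xD IH exprS mulrA.
Qed.

Lemma acts_by_prod I (r : seq I) (x : I -> expr) D : (forall i, acts_by (x i) (D i)) ->
  acts_by (\big[@Mul _ _/Cst 1]_(i <- r) x i) (fun w => \prod_(i <- r) D i w).
Proof.
move=> xD f w; elim: r => [|i r IH]; first by rewrite !big_nil.
by rewrite !big_cons /= xD IH mulrA.
Qed.

Lemma acts_by_sum I (r : seq I) (x : I -> expr) D : (forall i, acts_by (x i) (D i)) ->
  acts_by (\big[@Add _ _/Cst 0]_(i <- r) x i) (fun w => \sum_(i <- r) D i w).
Proof.
move=> xD f w; elim: r => [|i r IH]; first by rewrite !big_nil.
by rewrite !big_cons /= xD IH mulrDl.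
Qed.

Lemma acts_by_t j : acts_by (Yt _ j) (fun w => omega ^+ zof w j).
Proof. by []. Qed.

(** The eigenvalue of t_H. *)
Definition tval (H : 'cV[int]_n) (w : word) : K :=
  \prod_(j < n) omega ^+ zof w j ^+ `|(H j 0%R %% d)%Z|%N.

Lemma acts_by_tH H : acts_by (YtH F d H) (tval H).
Proof. by apply: acts_by_prod => j; apply: acts_by_exp; apply: acts_by_t. Qed.

Lemma omega_prim : d.-primitive_root omega.
Proof.
rewrite /omega -[tofrac _]/((@tofrac {poly F} \o polyC) omegaF).
by rewrite fmorph_primitive_root.
Qed.

Lemma omega_half : omega ^+ d./2 = - 1.
Proof.
have e : d = (d./2 * 2)%N by rewrite muln2 -[LHS]odd_double_half (negbTE d_even).
have /eqP : omega ^+ d./2 ^+ 2 = 1 by rewrite -exprM -e prim_expr_order ?omega_prim.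
rewrite sqrf_eq1 => /orP[|/eqP //]; rewrite -(prim_order_dvd omega_prim).
by move/dvdn_leq; lia.
Qed.

Lemma tval_coweight j w : tval (coweight j) w = omega ^+ zof w j.
Proof.
rewrite /tval (bigD1 j) //= [X in _ * X]big1 => [|k kj]; rewrite mxE ?eqxx.
  by rewrite modz_small // mulr1 expr1.
by rewrite (negbTE kj) mod0z expr0.
Qed.

Lemma tval_coweightN j w : tval (- coweight j) w = omega ^+ (zof w j * d.-1).
Proof.
rewrite /tval (bigD1 j) //= [X in _ * X]big1 => [|k kj]; rewrite !mxE ?eqxx.
  rewrite mulr1 exprM; congr (_ ^+ _).
  by rewrite -[- true%:R]/(-1)%Z modNz_nat //= modn_small //; lia.
by rewrite (negbTE kj) oppr0 mod0z expr0.
Qed.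

Lemma omega_negz z : (z < d)%N -> omega ^+ (z * d.-1) = omega ^+ negz d z.
Proof.
move=> zd; apply/eqP; rewrite (eq_prim_root_expr omega_prim) negzE //.
case: (z =P 0%N) => [->|z0]; first by rewrite mul0n.
rewrite -(eqn_modDr z) subnK ?(ltnW zd) // -mulnSr prednK // modnn.
by rewrite modnMl.
Qed.

Lemma omega_expd z : omega ^+ z ^+ d = 1.
Proof. by rewrite -exprM mulnC exprM (prim_expr_order omega_prim) expr1n. Qed.

Lemma omega_exp_neq0 z : omega ^+ z != 0.
Proof.
apply/eqP => e; have := omega_expd z; rewrite e expr0n gtn_eqF // => /esym/eqP.
by rewrite oner_eq0.
Qed.

Lemma tvalD H H' w : tval (H + H') w = tval H w * tval H' w.
Proof.
rewrite /tval -big_split; apply: eq_bigr => j _; rewrite mxE /= -exprD -!exprM.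
apply/eqP; rewrite (eq_prim_root_expr omega_prim); apply/eqP.
rewrite -modnMmr -[in RHS]modnMmr; congr (_ * _ %% _)%N.
apply/eqP; rewrite -eqz_nat -!modz_nat PoszD.
have E (a : int) : `|(a %% d)%Z|%N = (a %% d)%Z :> int.
  by apply: gez0_abs; apply: modz_ge0; rewrite eqz_nat -lt0n.
by rewrite !E modzDm modz_mod.
Qed.

Lemma tval_coroot0 (i : 'I_n) w : val i = 0%N -> tval (coroot i) w = omega ^+ (2 * zof w i).
Proof.
move=> i0; rewrite /coroot i0 -[2]/(1 + 1) scalerDl scale1r tvalD tval_coweight.
by rewrite -exprD addnn mul2n.
Qed.

Lemma tval_coroot (i : 'I_n) w : val i != 0%N ->
  tval (coroot i) w = omega ^+ (zof w (val i).-1 + zof w i * d.-1).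
Proof.
move=> i0; rewrite /coroot (negbTE i0) tvalD tval_coweightN tval_coweight exprD.
by rewrite -(ord_predE i0).
Qed.

Lemma tval_expd H w : tval H w ^+ d = 1.
Proof.
by rewrite -prodrXl big1 // => j _; rewrite (exprAC _ _ d) omega_expd expr1n.
Qed.

(** The mean of the powers of a d-th root of unity is 1 if the root is 1, and 0
otherwise. *)
Lemma acts_by_e i : acts_by (Ye F d i) (fun w => (tval (coroot i) w == 1)%:R).
Proof.
move=> f w; rewrite /Ye [LHS]/=.
rewrite (acts_by_sum _ (fun j => acts_by_exp j (acts_by_tH (coroot i)))) mulrA.
congr (_ * _); set x := tval _ _.
rewrite big_add1 /= big_mkord.
have [->|x1] := eqVneq x 1.
  under eq_bigr do rewrite expr1n.
  rewrite sumr_const card_ord -tofrac1 -tofracMn -tofracM.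
  by rewrite -polyC_natr -polyCM mulVf ?polyC1 ?tofrac1 // pnatr_eq0 -lt0n.
apply/eqP; rewrite mulf_eq0; apply/orP; right.
rewrite -(mulrI_eq0 _ (lregP (_ : x - 1 != 0))) ?subr_eq0 //.
under eq_bigr do rewrite exprS.
by rewrite -mulr_sumr mulrCA -subrX1 tval_expd subrr mulr0.
Qed.

Lemma std_zof w j : std d n w -> (j < n)%N -> (zof w j < d)%N.
Proof.
case/and3P=> /eqP sw /all_nthP h _ jn; rewrite -sw in jn.
by have /andP[] := h (0%N, (false, 0)) _ jn.
Qed.

Lemma act_rel_xit i j f w : std d n w ->
  act (Yxi _ i * Yt _ j)%nc f w = act (YtH F d (typeB_refl i *m coweight j) * Yxi _ i)%nc f w.
Proof.
move=> st; rewrite refl_coweight [RHS]/= acts_by_tH [LHS]/=.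
have /and3P[/eqP sw _ _] := st.
have [i0|i0] := eqVneq (val i) 0%N.
  rewrite /rsign /rperm i0 /= -[nat_of_ord i]/(val i) i0 op_xi0_t; congr (_ * _).
  have [->|ji] := eqVneq j i.
    rewrite scaleN1r tval_coweightN -[nat_of_ord i]/(val i) i0 eqxx.
    by rewrite omega_negz // std_zof // -{1}i0 ltn_ord.
  rewrite scale1r tval_coweight ifF //.
  by apply: contraNF ji => /eqP j0; rewrite -val_eqE i0 /= j0.
have si : val i = (val i).-1.+1 by case: (val i) i0.
rewrite /rsign /rperm (negbTE i0) /= scale1r tval_coweight.
rewrite -[nat_of_ord i]/(val i) [in LHS]si op_xi_t; last by rewrite sw -si ltn_ord.
rewrite -si; congr (omega ^+ zof w _ * _).
have vp := ord_predE i0.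
case: tpermP => [->|->|/eqP n1 /eqP n2].
- by rewrite -[nat_of_ord (ord_pred i)]/(val _) vp eqxx.
- by rewrite -[nat_of_ord (ord_pred i)]/(val _) vp eqxx ifF //; move: i0 => /=; lia.
- rewrite -[nat_of_ord j]/(val j) -vp.
  by rewrite !val_eqE (negbTE n1) (negbTE n2).
Qed.

Lemma d_half : (d./2 * 2)%N = d.
Proof. by rewrite muln2 -[RHS]odd_double_half (negbTE d_even). Qed.

Lemma omega_double z : (z < d)%N -> (omega ^+ (2 * z) == 1) = (negz d z == z).
Proof.
move=> zd; rewrite -(prim_order_dvd omega_prim) negzE //; case: (z =P 0%N) => [->|z0].
  by rewrite muln0 dvdn0 eqxx.
apply/idP/eqP => [/dvdnP[[|[|k]]]|e]; [lia|lia|rewrite !mulSn; lia|].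
by have -> : (2 * z)%N = d by lia.
Qed.

Lemma omega_mulV z : omega ^+ (z * d.-1) = (omega ^+ z)^-1.
Proof.
apply: (mulIf (omega_exp_neq0 z)); rewrite mulVf ?omega_exp_neq0 //.
by rewrite -exprD -mulnSr prednK // exprM omega_expd.
Qed.

Lemma omega_ratio z z' : (z < d)%N -> (z' < d)%N ->
  (omega ^+ (z + z' * d.-1) == 1) = (z == z').
Proof.
move=> zd zd'; rewrite exprD omega_mulV -(mulfV (omega_exp_neq0 z')).
rewrite (inj_eq (mulIf _)) ?invr_neq0 ?omega_exp_neq0 //.
by rewrite (eq_prim_root_expr omega_prim) !modn_small.
Qed.

Lemma omega_ratio_half z z' : omega ^+ (z + z' * d.-1) ^+ d./2 = (- 1) ^+ (z + z').
Proof.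
rewrite exprAC omega_half -[LHS]signr_odd -[RHS]signr_odd !oddD oddM.
have -> : odd d.-1 by have := d_even; rewrite -{1}(prednK d_gt0) /= negbK.
by rewrite andbT.
Qed.

Lemma act_rel_xi2 i f w : std d n w ->
  act (Yxi _ i * Yxi _ i)%nc f w =
  act (Cst (Yu F) * nc_exp (YtH F d (coroot i)) d./2
       + Cst (1 - Yu F)%R * (Ye F d i * Yxi _ i))%nc f w.
Proof.
move=> st; have /and3P[/eqP sw _ _] := st.
transitivity (uK * tval (coroot i) w ^+ d./2 * f w
  + (1 - uK) * ((tval (coroot i) w == 1)%:R * op_xi uK d i f w)); last first.
  rewrite [RHS](_ : _ = laurent_val (Yu F) * act (nc_exp (YtH F d (coroot i)) d./2) f w
    + laurent_val (1 - Yu F) * act (Ye F d i) (op_xi uK d i f) w) //.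
  by rewrite (acts_by_exp _ (acts_by_tH (coroot i))) acts_by_e -mulrA.
rewrite [LHS]/=; have [i0|i0] := eqVneq (val i) 0%N.
  rewrite tval_coroot0 // -[nat_of_ord i]/(val i) i0.
  have n0 : (0 < n)%N by rewrite -{1}i0 ltn_ord.
  have z0 : (zof w 0 < d)%N by apply: std_zof st _.
  case: w st sw z0 => [|x q] st sw z0; first by rewrite -sw in n0.
  rewrite (op_xi0_quad d_gt0 d_even uK_neq0 f st) omega_double // -exprM.
  have -> : (2 * zof (x :: q) 0 * d./2)%N = (zof (x :: q) 0 * d)%N.
    by rewrite -[in RHS]d_half; lia.
  rewrite exprM omega_expd mulr1 /zof /=.
  by case: ifP => _; rewrite ?mul1r ?mul0r ?mulr0.
rewrite tval_coroot //.
have [m E] : exists m, val i = m.+1 by exists (val i).-1; case: (val i) i0.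
have : (m.+1 < size w)%N by rewrite -E sw ltn_ord.
have {}E : nat_of_ord i = m.+1 := E; rewrite -[\val i]/(nat_of_ord i) !E /=.
case/split2 => [p [x [x' [q [<- e]]]]]; rewrite {}e in st sw *.
have zx : zof (p ++ x :: x' :: q) (size p) = x.1 by rewrite /zof nth_cat ltnn subnn.
have zx' : zof (p ++ x :: x' :: q) (size p).+1 = x'.1.
  by rewrite /zof nth_cat ltnNge leqnSn subSnn.
have np : (size p < n)%N by rewrite -sw size_cat /=; lia.
have np' : ((size p).+1 < n)%N by rewrite -sw size_cat /=; lia.
rewrite (op_xi_quad d_gt0 d_even uK_neq0 uK_free uK_freeN f st).
have zd := std_zof st np; have zd' := std_zof st np'.
rewrite omega_ratio // omega_ratio_half zx zx'.
by case: ifP => _; rewrite ?mul1r ?mul0r ?mulr0.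
Qed.

Lemma act1 f : act (Cst 1) f = f.
Proof. by apply/funext => w /=; rewrite mul1r. Qed.

Local Notation opx := (op_xi uK d).

Lemma Yalt2 (i j : 'I_n) f w : act (Yalt F i j 2) f w = opx i (opx j f) w.
Proof.
by rewrite /Yalt !big_ord_recl big_ord0 -[LHS]/(opx i (opx j (act (Cst 1) f)) w) act1.
Qed.

Lemma Yalt3 (i j : 'I_n) f w : act (Yalt F i j 3) f w = opx i (opx j (opx i f)) w.
Proof.
rewrite /Yalt !big_ord_recl big_ord0.
by rewrite -[LHS]/(opx i (opx j (opx i (act (Cst 1) f))) w) act1.
Qed.

Lemma Yalt4 (i j : 'I_n) f w :
  act (Yalt F i j 4) f w = opx i (opx j (opx i (opx j f))) w.
Proof.
rewrite /Yalt !big_ord_recl big_ord0.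
by rewrite -[LHS]/(opx i (opx j (opx i (opx j (act (Cst 1) f)))) w) act1.
Qed.

(** The exponent m is the order of the product of the two reflections, hence 2, 3 or
4 according to the position of i and j. *)
Lemma act_rel_braid_lt (i j : 'I_n) m f w : std d n w -> (val i < val j)%N ->
  has_order (typeB_refl i * typeB_refl j) m ->
  act (Yalt F i j m) f w = act (Yalt F j i m) f w.
Proof.
move=> st ij om; have /and3P[/eqP sw _ _] := st; have jn := ltn_ord j.
have [far|near] := ltnP (val i).+1 (val j).
  rewrite (has_order_uniq om (order_far far)) !Yalt2.
  have [|p [x [x' [q [sp ew]]]]] := @split2 w (val j).-1.
    by rewrite sw prednK //; case: (val j) ij.
  have [i0|i0] := eqVneq (val i) 0%N.
    rewrite (i0 : nat_of_ord i = 0%N); case: p sp ew => [|x0 r] sp ew.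
      by move: sp far; rewrite /=; lia.
    have -> : nat_of_ord j = (size r).+2 by move: sp far => /=; lia.
    by rewrite ew; apply: op_xi_far0.
  have [|p' [y [y' [r [sp' ep]]]]] := @split2 p (val i).-1.
    by rewrite sp; move: far i0 => /=; lia.
  have -> : nat_of_ord i = (size p').+1 by move: i0; rewrite sp' /=; lia.
  have -> : nat_of_ord j = (size p' + size r + 2).+1.
    by move: sp far; rewrite ep size_cat /=; lia.
  by rewrite ew ep -catA; apply: op_xi_far.
have ji : val j = (val i).+1 by move: ij near => /=; lia.
have [i0|i0] := eqVneq (val i) 0%N.
  rewrite i0 in ji; rewrite (has_order_uniq om (order_01 i0 ji)) !Yalt4.
  rewrite (i0 : nat_of_ord i = 0%N) (ji : nat_of_ord j = 1%N).
  have w2 : (1 < size w)%N by rewrite sw -ji ltn_ord.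
  case: w st sw w2 => [|x [|x' q]] // st sw _.
  exact: (op_xi_braid4 d_gt0 d_even uK_neq0 uK_free uK_freeN f st).
have om3 := has_orderC (refl_sq _) (refl_sq _) (order_adj i0 ji).
rewrite (has_order_uniq om om3) !Yalt3.
have [|p [x1 [x2 [x3 [q [sp ew]]]]]] := @split3 w (val i).-1.
  by rewrite sw; move: jn ji i0 => /=; lia.
have -> : nat_of_ord i = (size p).+1 by move: i0; rewrite sp /=; lia.
have -> : nat_of_ord j = (size p).+2 by move: i0 ji; rewrite sp /=; lia.
rewrite ew in st *.
exact: (op_xi_braid3 d_gt0 d_even uK_neq0 uK_free uK_freeN f st).
Qed.

Lemma act_rel x y f w : std d n w -> Yrel d x y -> act x f w = act y f w.
Proof.
move=> st; case=> [j k|j|i j|i|i j m om].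
- exact: op_t_comm.
- by rewrite (acts_by_exp d (acts_by_t j)) omega_expd.
- exact: act_rel_xit.
- exact: act_rel_xi2.
have [ij|ij|ij] := ltngtP (val i) (val j).
- exact: act_rel_braid_lt.
- apply/esym; apply: act_rel_braid_lt => //.
  exact: has_orderC (refl_sq _) (refl_sq _) om.
- by rewrite (val_inj ij).
Qed.

(** The defining relations hold at standard words; by [act_ext] they persist inside
products. *)
Lemma act_cong x y : nc_cong (@Yrel F d n) x y ->
  forall f w, std d n w -> act x f w = act y f w.
Proof.
elim=> {x y} //=.
- by move=> x y _ IH f w st; rewrite IH.
- by move=> y x z _ IH _ IH' f w st; rewrite IH // IH'.
- by move=> x x' y y' _ IH _ IH' f w st; rewrite IH // IH'.
- move=> x x' y y' _ IH _ IH' f w st; rewrite IH //.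
  by apply: act_ext => // v; apply: IH'.
- by move=> x y z f w st; rewrite addrA.
- by move=> x y f w st; rewrite addrC.
- by move=> x f w st; rewrite mul0r add0r.
- by move=> x f w st; rewrite mulN1r addNr mul0r.
- by move=> x f w st; rewrite mul1r.
- by move=> x f w st; apply: act_ext => // v _; rewrite mul1r.
- move=> x y z f w st.
  rewrite (@act_lin x 1 _ (act y f) (act z f)); first by rewrite mul1r.
  by move=> v; rewrite mul1r.
- by move=> c c' f w st; rewrite mulrDl.
- by move=> c c' f w st; rewrite mulrA.
- move=> c x f w st.
  rewrite -[RHS]/(act x (act (Cst c) f) w).
  rewrite (@act_lin x (laurent_val c) (act (Cst c) f) f (fun=> 0)) => [|v]; last first.
    by rewrite /= addr0.
  rewrite [X in _ = _ + X](@act_lin x (-1) _ (fun=> 0) (fun=> 0)) => [|v]; last first.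
    by rewrite /= mulr0 addr0.
  by rewrite mulN1r addNr addr0.
- by move=> x y r f w st; apply: act_rel.
Qed.
End Action.

Section Embedding.
Variables (F : numFieldType) (d n : nat) (d_gt0 : (0 < d)%N).
Local Notation K := {fraction {poly F}}.
Local Notation L := (laurent F).
Local Notation lv := (@laurent_val F : {rmorphism L -> K}).
Local Notation A := (YBu F n d_gt0).
Local Notation expr := (nc_expr L ('I_n + 'I_n)).

Definition generic (x : expr) : A := tens lv 1 (nc_class (@Yrel F d n) x : YB F n d_gt0).

Local Notation cls x := (nc_class (@Yrel F d n) x : YB F n d_gt0).

Lemma clsD x y : cls (x + y)%nc = cls x + cls y.
Proof. by rewrite [RHS]/GRing.add /= pres_addE. Qed.

Lemma clsM x y : cls (x * y)%nc = cls x * cls y.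
Proof. by rewrite [RHS]/GRing.mul /= pres_mulE. Qed.

Lemma clsZ c x : cls (Cst c * x)%nc = c *: cls x.
Proof. by rewrite [RHS]/GRing.scale /= pres_scaleE. Qed.

Lemma genD x y : generic (x + y)%nc = generic x + generic y.
Proof.
rewrite /generic [RHS]/GRing.add /= bc_addE clsD; apply/tens_classP.
exact: tens_Dr.
Qed.

Lemma genM x y : generic (x * y)%nc = generic x * generic y.
Proof.
rewrite /generic [RHS]/GRing.mul /= bc_mulE clsM; congr (tens_class _ [:: (_, _)]).
by rewrite mulr1.
Qed.

Lemma genZ c : generic (Cst c) = laurent_val c *: 1.
Proof.
have e : cls (Cst c) = c *: (1 : YB F n d_gt0).
  by rewrite -clsZ; apply/nc_classP; apply: nc_sym; apply: nc_mul1r.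
rewrite /generic e [RHS]/GRing.scale /= bc_scaleE /tens_scale /= mulr1.
apply/tens_classP; apply: tens_sym; rewrite -[laurent_val c]mul1r.
exact: (tens_bal lv 1 c).
Qed.

End Embedding.

Section Representation.
Variables (F : numFieldType) (d n : nat) (d_gt0 : (0 < d)%N) (omegaF : F).
Hypothesis d_gt1 : (1 < d)%N.
Hypothesis d_even : ~~ odd d.
Hypothesis omegaF_prim : d.-primitive_root omegaF.
Local Notation K := {fraction {poly F}}.
Local Notation L := (laurent F).
Local Notation lv := (@laurent_val F : {rmorphism L -> K}).
Local Notation A := (YBu F n d_gt0).
Local Notation expr := (nc_expr L ('I_n + 'I_n)).
Local Notation word := (seq letter).
Local Notation cls x := (nc_class (@Yrel F d n) x : YB F n d_gt0).
Local Notation act := (@act F d n omegaF).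
Local Notation std := (std d n).
Local Notation gen x := (generic d_gt0 x).

(** The representation of the algebra over K, computed from chosen representatives:
it is well defined only on standard words, by [psi_cong] and [act_cls]. *)
Definition phi (a : A) (f : word -> K) (w : word) : K :=
  \sum_(x <- (repr a : seq (K * YB F n d_gt0))) x.1 * act (repr x.2) f w.

Let cong := @act_cong F d n omegaF d_gt1 d_even omegaF_prim.

Lemma act_cls x f w : std w -> act (repr (cls x)) f w = act x f w.
Proof. by move=> st; apply: cong => //; apply: nc_repr_class. Qed.

Lemma act_repr_lin (a b : YB F n d_gt0) c f w : std w ->
  [/\ act (repr (a + b)) f w = act (repr a) f w + act (repr b) f w,
      act (repr (a * b)) f w = act (repr a) (act (repr b) f) w &
      act (repr (c *: a)) f w = laurent_val c * act (repr a) f w].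
Proof.
move=> st; rewrite -{1 3}(nc_class_repr a) -{1 3}(nc_class_repr b).
rewrite -clsD -clsM -[X in c *: X](nc_class_repr a) -clsZ.
by split; rewrite act_cls.
Qed.

Definition psi (s : seq (K * YB F n d_gt0)) f w : K :=
  \sum_(x <- s) x.1 * act (repr x.2) f w.

Lemma psi_cong s t f w : std w -> tens_cong lv s t -> psi s f w = psi t f w.
Proof.
move=> st; rewrite /psi; elim=> {s t} //.
- by move=> s t v _ -> _ ->.
- by move=> s s' t t' _ e _ e'; rewrite !big_cat /= e e'.
- by move=> s t; rewrite !big_cat /= addrC.
- by move=> a; rewrite big_seq1 big_nil mul0r.
- by move=> k k' a; rewrite !big_cons !big_nil !addr0 mulrDl.
- move=> k a a'; rewrite !big_cons !big_nil !addr0 /=.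
  by have [-> _ _] := act_repr_lin a a' 0 f st; rewrite mulrDr.
- move=> k c a; rewrite !big_seq1 /=.
  by have [_ _ ->] := act_repr_lin a a c f st; rewrite mulrA.
Qed.

Lemma phiE s f w : std w -> phi (tens_class lv s) f w = psi s f w.
Proof. by move=> st; apply: psi_cong => //; apply: tens_repr_class. Qed.

Lemma phiD a b f w : std w -> phi (a + b) f w = phi a f w + phi b f w.
Proof.
move=> st; elim/(@tens_classW _ _ lv): a => s; elim/(@tens_classW _ _ lv): b => t.
rewrite [X in phi X]/GRing.add /= bc_addE !phiE //.
by rewrite /psi big_cat.
Qed.

Lemma phiZ c a f w : std w -> phi (c *: a) f w = c * phi a f w.
Proof.
move=> st; elim/(@tens_classW _ _ lv): a => s.
rewrite [X in phi X]/GRing.scale /= bc_scaleE !phiE // /psi /tens_scale big_map mulr_sumr.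
by apply: eq_bigr => x _; rewrite mulrA.
Qed.

Lemma act_psi x s f w :
  act x (fun v => psi s f v) w = \sum_(y <- s) y.1 * act x (act (repr y.2) f) w.
Proof.
elim: s => [|y s IH].
  rewrite big_nil (@act_lin _ _ _ _ x (-1) _ (fun=> 0) (fun=> 0)) => [|v]; last first.
    by rewrite /psi big_nil mulr0 addr0.
  by rewrite mulN1r addNr.
rewrite big_cons -IH; apply: act_lin => v; by rewrite /psi big_cons.
Qed.

Lemma phi_ext a f g w : (forall v, std v -> f v = g v) -> std w -> phi a f w = phi a g w.
Proof.
move=> e st; rewrite /phi; apply: eq_bigr => x _; congr (_ * _).
exact: (act_ext omegaF d_gt1 d_even).
Qed.

Lemma phiM a b f w : std w -> phi (a * b) f w = phi a (phi b f) w.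
Proof.
move=> st; elim/(@tens_classW _ _ lv): a => s; elim/(@tens_classW _ _ lv): b => t.
rewrite (@phi_ext _ (phi _ f) (psi t f)) //; last by move=> v sv; rewrite phiE.
rewrite [X in phi X]/GRing.mul /= bc_mulE !phiE // /psi /tens_mul.
rewrite big_allpairs_dep; apply: eq_bigr => x _.
rewrite -/(psi t f) act_psi mulr_sumr; apply: eq_bigr => y _ /=.
by have [_ -> _] := act_repr_lin x.2 y.2 0 f st; rewrite mulrA.
Qed.

Lemma phi_gen x f w : std w -> phi (gen x) f w = act x f w.
Proof.
by move=> st; rewrite /generic phiE // /psi big_seq1 /= mul1r act_cls.
Qed.

Lemma phi1 f w : std w -> phi 1 f w = f w.
Proof.
move=> st; have <- : gen (Cst 1) = 1 :> A by rewrite genZ scale1r.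
by rewrite phi_gen //= mul1r.
Qed.

Local Notation omega := (omega omegaF).
Local Notation uK := (uK F).
Local Notation opJ := (opJ uK d).
Local Notation flip := (flip d).
Local Notation key := (key d).
Local Notation negz := (negz d).
Let oprim := omega_prim omegaF_prim.

(** * Matrix units in the image of the representation *)

Definition diagonal (D : word -> K) : Prop :=
  exists a, forall f w, std w -> phi a f w = D w * f w.

Lemma diagonal_ext D D' : (forall w, std w -> D w = D' w) -> diagonal D -> diagonal D'.
Proof. by move=> e [a h]; exists a => f w st; rewrite h // e. Qed.

Lemma diagonal_const c : diagonal (fun=> c).
Proof. by exists (c *: 1) => f w st; rewrite phiZ // phi1. Qed.

Lemma diagonalM D D' : diagonal D -> diagonal D' -> diagonal (fun w => D w * D' w).
Proof.
move=> [a h] [b h']; exists (a * b) => f w st.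
by rewrite phiM // h // h' // mulrA.
Qed.

Lemma diagonalD D D' : diagonal D -> diagonal D' -> diagonal (fun w => D w + D' w).
Proof.
move=> [a h] [b h']; exists (a + b) => f w st.
by rewrite phiD // h // h' // mulrDl.
Qed.

Lemma diagonal_t j : (j < n)%N -> diagonal (fun w => omega ^+ zof w j).
Proof. by move=> jn; exists (gen (Yt _ (Ordinal jn))) => f w st; rewrite phi_gen. Qed.

(** A diagonal operator that separates two words is normalized to 1 at one of them
and to 0 at the other. *)
Lemma diagonal_split D c c' : diagonal D -> c != c' ->
  diagonal (fun w => (D w - c') / (c - c')).
Proof.
move=> dD ne; apply: diagonal_ext (diagonalM (diagonalD dD (diagonal_const (- c')))
  (diagonal_const (c - c')^-1)) => w _; by [].
Qed.

(** Lagrange interpolation: a product of the operators of [diagonal_split]. *)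
Lemma diagonal_interp w (vs : seq word) :
  (forall v, v \in vs -> exists2 D, diagonal D & D w != D v) ->
  exists D, [/\ diagonal D, D w = 1 & forall v, v \in vs -> D v = 0].
Proof.
elim: vs => [|v vs IH] h.
  by exists (fun=> 1); split=> //; apply: diagonal_const.
have [|D [dD Dw Dvs]] := IH; first by move=> v' v'vs; apply: h; rewrite inE v'vs orbT.
have [|D' dD' ne] := h v; first exact: mem_head.
exists (fun x => D x * ((D' x - D' v) / (D' w - D' v))); split.
- exact/diagonalM/diagonal_split.
- by rewrite Dw mul1r divff // subr_eq0.
- move=> v'; rewrite inE => /predU1P[->|/Dvs->]; last by rewrite mul0r.
  by rewrite subrr mul0r mulr0.
Qed.

Lemma omega_inj z z' : (z < d)%N -> (z' < d)%N -> omega ^+ z = omega ^+ z' -> z = z'.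
Proof.
by move=> zd zd' /eqP; rewrite (eq_prim_root_expr oprim) !modn_small // => /eqP.
Qed.

Lemma diagonal_zof j z : (j < n)%N -> (z < d)%N ->
  diagonal (fun w => (zof w j == z)%:R).
Proof.
move=> jn zd.
suff H (zs : seq nat) : z \notin zs -> all (fun z' => z' < d)%N zs ->
    exists D, [/\ diagonal D,
    forall w, zof w j = z -> D w = 1 & forall w, zof w j \in zs -> D w = 0].
  have [||D [dD D1 D0]] := H [seq z' <- iota 0 d | z' != z].
  - by rewrite mem_filter eqxx.
  - by apply/allP => z'; rewrite mem_filter mem_iota => /andP[].
  apply: diagonal_ext dD => w st; case: eqP => [/D1//|/eqP ne]; apply: D0.
  by rewrite mem_filter ne mem_iota (std_zof st jn).
elim: zs => [|z' zs IH] /=.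
  by move=> _ _; exists (fun=> 1); split=> //; apply: diagonal_const.
rewrite inE negb_or => /andP[ne zn] /andP[zd' /IH-/(_ zn)[D [dD D1 D0]]].
have nw : omega ^+ z != omega ^+ z' by apply: contra ne => /eqP/(omega_inj zd zd')->.
exists (fun w => D w * ((omega ^+ zof w j - omega ^+ z') / (omega ^+ z - omega ^+ z'))).
split.
- by apply/diagonalM => //; apply: diagonal_split => //; apply: diagonal_t.
- by move=> w e; rewrite D1 // e mul1r divff // subr_eq0.
- move=> w; rewrite inE => /predU1P[->|/D0->]; last by rewrite mul0r.
  by rewrite subrr mul0r mulr0.
Qed.

(** The condition on op, of depending only on values at standard words, is what
allows operators to be composed. *)
Definition operates (op : (word -> K) -> word -> K) : Prop :=
  (forall f g w, (forall v, std v -> f v = g v) -> std w -> op f w = op g w) /\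
  exists a, forall f w, std w -> phi a f w = op f w.

Lemma operatesM op op' : operates op -> operates op' -> operates (fun f => op (op' f)).
Proof.
move=> [e [a h]] [e' [b h']]; split.
  by move=> f g w fg st; apply: e => // v sv; apply: e'.
exists (a * b) => f w st; rewrite phiM // h //.
by apply: e => // v sv; apply: h'.
Qed.

Lemma operates_xi i : (i < n)%N -> operates (op_xi uK d i).
Proof.
move=> i_n; split.
  move=> f g w; apply: op_xi_ext => //; [exact: uK_neq0|exact: uK_free|exact: uK_freeN].
by exists (gen (Yxi _ (Ordinal i_n))) => f w st; rewrite phi_gen.
Qed.

Lemma operates_J i : (i < n)%N -> operates (opJ i).
Proof.
elim: i => [|i IH] i_n; first exact: operates_xi.
have xi := operates_xi i_n; have := operatesM xi (operatesM (IH (ltnW i_n)) xi).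
exact.
Qed.

Lemma operates_diagonal D : diagonal D -> operates (fun f w => D w * f w).
Proof. by move=> [a h]; split; [move=> f g w e st; rewrite e | exists a]. Qed.

Lemma std_split w j : std w -> (j < n)%N ->
  exists p x q, [/\ size p = j, w = p ++ x :: q & letter_ok d x].
Proof.
move=> st jn; have /and3P[/eqP sw ok _] := st; rewrite -sw in jn.
exists (take j w), (nth (0%N, (false, 0)) w j), (drop j.+1 w).
by rewrite size_takel 1?ltnW // -drop_nth // cat_take_drop; split=> //; apply: all_nthP.
Qed.

Lemma zof_cat (p : word) x q : zof (p ++ x :: q) (size p) = x.1.
Proof. by rewrite /zof nth_cat ltnn subnn. Qed.

Lemma J_coef_fst (p p' : word) z : map fst p = map fst p' ->
  J_coef uK d p z = J_coef uK d p' z.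
Proof.
move=> e; rewrite /J_coef; congr (_ * _).
by rewrite -!(big_map fst xpredT (fun y => hcoef uK d y z)) e.
Qed.

Lemma opJ_word p x q f : std (p ++ x :: q) ->
  opJ (size p) f (p ++ x :: q) = J_coef uK d p x.1 * gcoef uK d x * f (p ++ flip x :: q).
Proof.
by move=> st; apply: opJE st; rewrite ?uK_neq0 //; [apply: uK_free|apply: uK_freeN].
Qed.

(** Diagonal operators of this form depend on the letter at position j and on those
before it. *)
Definition at_pos (j : nat) (G : word -> letter -> K) (w : word) : K :=
  G (take j w) (nth (0%N, (false, 0)) w j).

Lemma at_posE G p x q : at_pos (size p) G (p ++ x :: q) = G p x.
Proof. by rewrite /at_pos take_size_cat // nth_cat ltnn subnn. Qed.

(** After projection to an eigenvalue with z = -z, the Jucys-Murphy element fixes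
the words. *)
Lemma diagonal_J_fixed j z : (j < n)%N -> (z < d)%N -> negz z = z ->
  diagonal (at_pos j (fun p x => (x.1 == z)%:R * (J_coef uK d p z * cval uK x.2))).
Proof.
move=> jn zd zz.
have [_ [a h]] := operatesM (operates_J jn) (operates_diagonal (diagonal_zof jn zd)).
exists a => f w st; rewrite h //.
have [p [x [q [sp e ok]]]] := std_split st jn; move: st; rewrite e -sp => st.
rewrite opJ_word // at_posE zof_cat /=.
have /andP[xd _] := ok; have [xz|xz] := eqVneq x.1 z; last first.
  have -> : (negz x.1 == z) = false.
    by apply: contraNF xz => /eqP h'; rewrite -(negzK d_gt0 xd) h' zz.
  by rewrite !mul0r !mulr0.
have -> : flip x = x by rewrite flipE xz zz -xz; case: (x).
by rewrite /gcoef xz zz ltnn eqxx !mul1r.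
Qed.

(** For z <> -z the Jucys-Murphy element exchanges two words, and its square is
diagonal. *)
Lemma diagonal_J_moved j z : (j < n)%N -> (z < d)%N -> negz z != z ->
  diagonal (at_pos j (fun p x => (x.1 == z)%:R *
    (J_coef uK d p z * J_coef uK d p (negz z) * cval uK x.2))).
Proof.
move=> jn zd zz.
have [_ [a h]] := operatesM (operates_J jn)
  (operatesM (operates_J jn) (operates_diagonal (diagonal_zof jn zd))).
exists a => f w st; rewrite h //.
have [p [x [q [sp e ok]]]] := std_split st jn; move: st; rewrite e -sp => st.
have st' := std_flip d_gt0 st.
rewrite opJ_word // opJ_word //.
rewrite at_posE flipK // zof_cat.
have [xz|xz] := eqVneq x.1 z; last by rewrite !mul0r !mulr0.
rewrite !mul1r /gcoef /= xz negzK //.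
by case: ltngtP zz => // _ _; ring.
Qed.

(** If all eigenvalues of the t_j agree, the words differ in a content value at some
position; the other factors of the eigenvalue of the Jucys-Murphy element depend
only on the eigenvalues of the t_j. *)
Lemma diagonal_separate w v : std w -> std v -> w != v ->
  exists2 D, diagonal D & D w != D v.
Proof.
move=> sw sv ne.
have /and3P[/eqP szw okw _] := sw; have /and3P[/eqP szv okv _] := sv.
have [/existsP[j nz]|/existsPn ez] := boolP [exists j : 'I_n, zof w j != zof v j].
  exists (fun w => omega ^+ zof w j); first exact: diagonal_t.
  by apply: contra nz => /eqP/omega_inj->; rewrite ?eqxx ?(std_zof _ (ltn_ord j)).
have ef : map fst w = map fst v.
  apply: (@eq_from_nth _ 0%N) => [|j]; rewrite !size_map ?szw ?szv // => jn.
  have := ez (Ordinal jn); rewrite negbK => /eqP /=.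
  by rewrite /zof !(nth_map (0%N, (false, 0))) ?szw ?szv.
have [/existsP[j nj]|/existsPn ej] := boolP [exists j : 'I_n,
    nth (0%N, (false, 0)) w j != nth (0%N, (false, 0)) v j]; last first.
  case/eqP: ne; apply: (@eq_from_nth _ (0%N, (false, 0))); first by rewrite szw szv.
  by move=> j; rewrite szw => jn; have := ej (Ordinal jn); rewrite negbK => /eqP.
have jn := ltn_ord j; move: (nat_of_ord j) jn nj => {}j jn nj {ne ez}.
have [p [x [q [sp ew ok]]]] := std_split sw jn.
have [p' [y [q' [sp' ev ok']]]] := std_split sv jn.
rewrite {}ew {}ev {w v szw szv sw sv okw okv} -sp in nj ef *.
have spp : size p = size p' by rewrite sp sp'.
move: ef nj; rewrite !map_cat /= => /eqP; rewrite eqseq_cat ?size_map //.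
case/andP=> /eqP ep /andP[/eqP exy _].
rewrite nth_cat ltnn subnn {1}spp nth_cat ltnn subnn /= => nxy.
have ny : cval uK x.2 != cval uK y.2.
  rewrite (inj_eq (cval_inj d_gt0 d_even (uK_neq0 F) (@uK_free F) (@uK_freeN F))).
  by case: (x) (y) exy nxy => [a b] [a' b'] /= <-; rewrite xpair_eqE eqxx.
have /andP[xd _] := ok; rewrite -{}sp {sp'} in jn.
have J0 p0 z0 : J_coef uK d p0 z0 != 0 by apply: J_coef_neq0; rewrite ?uK_neq0.
have [zz|zz] := eqVneq (negz x.1) x.1.
  apply: (ex_intro2 _ _ _ (diagonal_J_fixed jn xd zz)).
  rewrite at_posE spp at_posE exy !eqxx !mul1r (J_coef_fst _ ep).
  by rewrite (inj_eq (mulfI (J0 _ _))).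
apply: (ex_intro2 _ _ _ (diagonal_J_moved jn xd zz)).
rewrite at_posE spp at_posE exy !eqxx !mul1r !(J_coef_fst _ ep).
by rewrite (inj_eq (mulfI (mulf_neq0 (J0 _ _) (J0 _ _)))).
Qed.

Lemma diagonal_delta w : std w -> diagonal (fun v => (v == w)%:R).
Proof.
move=> sw; have n_le : (n <= n.+1)%N by [].
have [v|D [dD Dw D0]] := @diagonal_interp w [seq v <- words d n n | v != w].
  rewrite mem_filter mem_words // => /andP[vw sv].
  by apply: diagonal_separate => //; rewrite eq_sym.
apply: diagonal_ext dD => v sv; have [->//|vw] := eqVneq v w.
by rewrite D0 // mem_filter vw mem_words.
Qed.

Definition matrix_unit (w v : word) (a : A) : Prop :=
  forall f x, std x -> phi a f x = (x == w)%:R * f v.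

(** The operator is compressed between two diagonal matrix units. *)
Lemma matrix_unit_of op w v c : operates op -> std w -> std v -> c != 0 ->
  (forall f, op (fun x => (x == v)%:R * f x) w = c * f v) ->
  exists a, matrix_unit w v a.
Proof.
move=> oop sw sv c0 h.
have [_ [a ha]] := operatesM (operates_diagonal (diagonal_delta sw))
  (operatesM oop (operates_diagonal (diagonal_delta sv))).
exists (c^-1 *: a) => f x sx; rewrite phiZ // ha //.
have [->|_] := eqVneq x w; last by rewrite !mul0r mulr0.
by rewrite h !mul1r mulKf.
Qed.

(** The word in which only the eigenvalues are exchanged is different from the
swapped word, so it does not contribute. *)
Lemma matrix_unit_swap p x x' q : std (p ++ x :: x' :: q) -> far (key x) (key x') ->
  exists a, matrix_unit (p ++ x :: x' :: q) (p ++ x' :: x :: q) a.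
Proof.
move=> st f; have sn : ((size p).+1 < n)%N.
  by have /and3P[/eqP <- _ _] := st; rewrite size_cat /=; lia.
have Q0 := (Qcoef_far d_gt0 d_even (uK_neq0 F) (@uK_free F) (@uK_freeN F) st).2 f.
apply: (matrix_unit_of (operates_xi sn) st (std_swap f st) Q0) => g.
rewrite op_xiE eqxx mul1r [X in X + _](_ : _ = 0) ?add0r // /Pcoef.
case: eqP => [e|_]; last by rewrite mul0r.
have := std_pair st e; rewrite eqseq_cat // eqxx /= eqseq_cons.
by case: (x') => z y /=; rewrite xpair_eqE eqxx /= => /negbTE->; rewrite mul0r mulr0.
Qed.

Lemma matrix_unit_flip p x q : std (p ++ x :: q) ->
  exists a, matrix_unit (p ++ x :: q) (p ++ flip x :: q) a.
Proof.
move=> st; have sn : (size p < n)%N.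
  by have /and3P[/eqP <- _ _] := st; rewrite size_cat /=; lia.
apply: (matrix_unit_of (c := J_coef uK d p x.1 * gcoef uK d x) (operates_J sn) st).
- exact: std_flip.
- by rewrite mulf_neq0 ?J_coef_neq0 ?gcoef_neq0 // uK_neq0.
- by move=> g; rewrite opJ_word // eqxx mul1r.
Qed.

Theorem matrix_unit_exists w v : std w -> std v ->
  perm_eq (map key w) (map key v) -> exists a, matrix_unit w v a.
Proof.
move=> sw sv; apply: (@connect_std d n d_gt0 (fun w v => exists a, matrix_unit w v a)) => //.
- by move=> x sx; have [a h] := diagonal_delta sx; exists a => f y sy; rewrite h //;
    case: eqP => [->|]; rewrite ?mul0r.
- move=> y x z sx sy sz [a ha] [b hb]; exists (a * b) => f r sr.
  by rewrite phiM // ha // hb // eqxx mul1r.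
- exact: matrix_unit_swap.
- exact: matrix_unit_flip.
Qed.

End Representation.

(** * Normal forms span the generic algebra *)

Section Spanning.
Variables (F : numFieldType) (d n : nat) (d_gt0 : (0 < d)%N).
Hypothesis d_gt1 : (1 < d)%N.
Hypothesis n_gt0 : (0 < n)%N.
Local Notation K := {fraction {poly F}}.
Local Notation L := (laurent F).
Local Notation A := (YBu F n d_gt0).
Local Notation expr := (nc_expr L ('I_n + 'I_n)).
Local Notation gen x := (generic d_gt0 x).

Let i0 : 'I_n := Ordinal n_gt0.
Let t (j : nat) : A := gen (Yt _ (insubd i0 j)).
Let xi (i : nat) : A := gen (Yxi _ (insubd i0 i)).

Let tE (j : 'I_n) : t j = gen (Yt _ j).
Proof. by rewrite /t valKd. Qed.
Let xiE (i : 'I_n) : xi i = gen (Yxi _ i).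
Proof. by rewrite /xi valKd. Qed.

Lemma gen1 : gen (Cst 1 : expr) = 1.
Proof. by rewrite genZ scale1r. Qed.

Lemma gen0 : gen (Cst 0 : expr) = 0.
Proof. by rewrite genZ scale0r. Qed.

Lemma gen_exp (x : expr) m : gen (nc_exp x m) = gen x ^+ m.
Proof. by elim: m => [|m IH]; [rewrite gen1|rewrite [LHS]genM IH exprS]. Qed.

Lemma gen_prod I (r : seq I) (x : I -> expr) :
  gen (\big[@Mul _ _/Cst 1]_(i <- r) x i) = \prod_(i <- r) gen (x i).
Proof.
elim: r => [|i r IH]; first by rewrite !big_nil gen1.
by rewrite !big_cons genM IH.
Qed.

Lemma gen_sum I (r : seq I) (x : I -> expr) :
  gen (\big[@Add _ _/Cst 0]_(i <- r) x i) = \sum_(i <- r) gen (x i).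
Proof.
elim: r => [|i r IH]; first by rewrite !big_nil gen0.
by rewrite !big_cons genD IH.
Qed.

Lemma gen_rel (x y : expr) : Yrel d x y -> gen x = gen y.
Proof.
by move=> h; rewrite /generic; congr (tens _ 1 _); apply/nc_classP/nc_rel.
Qed.

Lemma gen_tH_single (H : 'cV[int]_n) k : (forall j, j != k -> H j 0 = 0) ->
  gen (YtH F d H) = t k ^+ `|(H k 0%R %% d)%Z|%N.
Proof.
move=> h; rewrite gen_prod.
transitivity (\prod_(j < n | j == k) gen (nc_exp (Yt F j) `|(H j 0%R %% d)%Z|%N)); last first.
  by rewrite big_pred1_eq gen_exp tE.
rewrite [RHS]big_mkcond; apply: eq_bigr => j _.
by case: eqP => [->//|/eqP jk]; rewrite h // mod0z gen_exp.
Qed.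

Let tC i j : (i < n)%N -> (j < n)%N -> t i * t j = t j * t i.
Proof. by move=> _ _; rewrite -!genM; apply/gen_rel/Yrel_tC. Qed.

Let td i : (i < n)%N -> t i ^+ d = 1.
Proof. by move=> _; rewrite -gen_exp -gen1; apply/gen_rel/Yrel_td. Qed.

Let xit_ord (i j : 'I_n) :
  xi i * t j = t (rperm i j) ^+ `|(rsign i j %% d)%Z|%N * xi i.
Proof.
rewrite xiE tE -genM (gen_rel (Yrel_xit F d i j)) genM refl_coweight; congr (_ * _).
rewrite (@gen_tH_single _ (rperm i j)) => [|l ne]; rewrite !mxE ?eqxx ?mulr1 //.
by rewrite (negbTE ne) mulr0.
Qed.

Let xit i j p : (p < n)%N -> (i <= p)%N -> (j <= p)%N ->
  exists k e, (k <= p)%N /\ xi i * t j = t k ^+ e * xi i.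
Proof.
move=> pn ip jp; have i_n := leq_ltn_trans ip pn; have jn := leq_ltn_trans jp pn.
have := xit_ord (Ordinal i_n) (Ordinal jn); rewrite /= => ->.
exists (rperm (Ordinal i_n) (Ordinal jn)), `|(rsign (Ordinal i_n) (Ordinal jn) %% d)%Z|%N.
split=> //; rewrite /rperm; case: (val _ =P 0%N) => [//|/eqP vi].
have vp := ord_predE vi; case: tpermP => // _; rewrite -[nat_of_ord _]/(val _) ?vp //=.
by apply: leq_trans ip; apply: leq_pred.
Qed.

Let xitC i j : (i < j)%N -> (j < n)%N -> xi i * t j = t j * xi i.
Proof.
move=> ij jn; have i_n := ltn_trans ij jn.
have := xit_ord (Ordinal i_n) (Ordinal jn); rewrite /= => ->.
have ne : Ordinal jn != Ordinal i_n by rewrite -val_eqE /= gtn_eqF.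
rewrite /rsign (negbTE ne) andbF modz_small // expr1; congr (t _ * _).
rewrite /rperm; case: (val _ =P 0%N) => [//|/eqP vi]; rewrite tpermD //.
  by rewrite -val_eqE ord_predE //=; lia.
by rewrite eq_sym.
Qed.

Let tpoly_sum I (r : seq I) m (a : I -> A) : (forall i, tpoly t m (a i)) ->
  tpoly t m (\sum_(i <- r) a i).
Proof.
move=> h; elim: r => [|i r IH]; last by rewrite big_cons; apply: tpolyD.
by rewrite big_nil -(scale0r 1); apply: tpolyZ; apply: tpoly1.
Qed.

Let tpoly_tH (i : 'I_n) : tpoly t i.+1 (gen (YtH F d (coroot i))).
Proof.
rewrite gen_prod; elim/big_ind: _ => [|a b|j _]; [exact: tpoly1|exact: tpolyM|].
rewrite gen_exp -tE; have [ji|ij] := leqP j i; first by apply/tpoly_exp/tpoly_t.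
suff -> : coroot i j 0 = 0 by rewrite mod0z; apply: tpoly1.
have ne : j != i by rewrite -val_eqE gtn_eqF.
rewrite /coroot; case: (val i =P 0%N) => [_|/eqP vi]; rewrite !mxE (negbTE ne) /= ?mulr0 ?subr0 //.
rewrite [j == _](_ : _ = false) //; apply/negbTE; rewrite -val_eqE ord_predE //.
by move: ij => /=; lia.
Qed.

Let xi2 i : (i < n)%N -> exists a b,
  [/\ tpoly t i.+1 a, tpoly t i.+1 b & xi i * xi i = a + b * xi i].
Proof.
move=> i_n; pose o := Ordinal i_n; have to : tpoly t i.+1 _ := tpoly_tH o.
exists (laurent_val (Yu F) *: gen (YtH F d (coroot o)) ^+ d./2).
exists (laurent_val (1 - Yu F) *: gen (Ye F d o)); split.
- by apply: tpolyZ; apply: tpoly_exp.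
- apply: tpolyZ; rewrite /Ye genM genZ -scalerAl mul1r gen_sum; apply: tpolyZ.
  by apply: tpoly_sum => j; rewrite gen_exp; apply: tpoly_exp.
have := gen_rel (Yrel_xi2 F d o); rewrite genM -!xiE /= => ->.
by rewrite genD !genM !genZ gen_exp -!scalerAl !mul1r -xiE.
Qed.

Let gen_alt2 i j : gen (Yalt F i j 2) = xi i * xi j.
Proof. by rewrite /Yalt gen_prod !big_ord_recl big_ord0 !xiE mulr1. Qed.

Let gen_alt3 i j : gen (Yalt F i j 3) = xi i * xi j * xi i.
Proof. by rewrite /Yalt gen_prod !big_ord_recl big_ord0 !xiE mulr1 mulrA. Qed.

Let gen_alt4 i j : gen (Yalt F i j 4) = xi i * xi j * xi i * xi j.
Proof. by rewrite /Yalt gen_prod !big_ord_recl big_ord0 !xiE mulr1 !mulrA. Qed.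

Let xiC i j : (i.+1 < j)%N -> (j < n)%N -> xi i * xi j = xi j * xi i.
Proof.
move=> ij jn; have i_n := ltn_trans (ltnW ij) jn.
have := gen_rel (Yrel_braid F d (@order_far n (Ordinal i_n) (Ordinal jn) ij)).
by rewrite !gen_alt2.
Qed.

Let xi_braid3 i : (0 < i)%N -> (i.+1 < n)%N ->
  xi i.+1 * xi i * xi i.+1 = xi i * xi i.+1 * xi i.
Proof.
move=> i_gt0 jn; have i_n := ltnW jn; have vi : i != 0%N by rewrite -lt0n.
have := gen_rel (Yrel_braid F d (@order_adj n (Ordinal i_n) (Ordinal jn) vi erefl)).
by rewrite !gen_alt3.
Qed.

Let xi_braid4 : (1 < n)%N -> xi 1 * xi 0 * xi 1 * xi 0 = xi 0 * xi 1 * xi 0 * xi 1.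
Proof.
move=> n1; have := gen_rel (Yrel_braid F d (@order_01 n i0 (Ordinal n1) erefl erefl)).
by rewrite !gen_alt4.
Qed.

(** The span of the normal forms contains 1 and is closed under right
multiplication by the generators. *)
Lemma YBu_spanned (a : A) : spanned (normal_forms d t xi n) a.
Proof.
have closed b j := @normal_forms_closed K A d n t xi d_gt0 tC td xit xitC xi2 xiC
  xi_braid3 xi_braid4 n (leqnn n) b j.
have H x b : spanned (normal_forms d t xi n) b ->
    spanned (normal_forms d t xi n) (b * gen x).
  elim: x b => [[j|i]|c|x IHx y IHy|x IHx y IHy] b Sb.
  - by have [+ _] := closed _ _ Sb (ltn_ord j); rewrite tE.
  - by have [_] := closed _ _ Sb (ltn_ord i); rewrite xiE.
  - by rewrite genZ -scalerAr mulr1; apply: spannedZ.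
  - by rewrite genD mulrDr; apply: spannedD; [apply: IHx|apply: IHy].
  - by rewrite genM mulrA; apply/IHy/IHx.
elim/(@tens_classW _ _ (@laurent_val F)): a; elim=> [|[k a] s IH].
  exact: spanned0.
have -> : tens_class (@laurent_val F) ((k, a) :: s)
    = k *: gen (repr a) + tens_class (@laurent_val F) s :> A.
  rewrite [RHS]/GRing.add /= [X in bc_add X]/GRing.scale /= bc_scaleE bc_addE.
  by rewrite /= mulr1 (nc_class_repr (a : presented _)).
apply: spannedD => //; apply: spannedZ; rewrite -[gen _]mul1r; apply: H.
exact: normal_forms1.
Qed.

Lemma normal_forms_spanning : exists2 s : seq A,
  size s = ((2 * d) ^ n * n`!)%N & forall a : A, spanned s a.
Proof.
exists (normal_forms d t xi n); [exact: size_normal_forms|exact: YBu_spanned].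
Qed.
End Spanning.

(** The matrix that expresses the independent family by the spanning one is square
with free rows, hence invertible. *)
Lemma independent_spanning (K : fieldType) (V : lmodType K) (J : finType)
    (s : seq V) (e : J -> V) :
  (forall v, spanned s v) -> #|J| = size s ->
  (forall c : J -> K, \sum_j c j *: e j = 0 -> forall j, c j = 0) ->
  forall v, exists c : J -> K, v = \sum_j c j *: e j.
Proof.
move=> span sJ indep v.
have coef j := spanned_coef (span (e j)); have [M eM] := fin_all_exists coef.
pose Mx := \matrix_(a < #|J|, i < size s) M (enum_val a) i.
have sumE (c : 'rV_#|J|) :
    \sum_j c 0 (enum_rank j) *: e j = \sum_i (c *m Mx) 0 i *: s`_i.
  under eq_bigr => j _ do rewrite eM scaler_sumr.
  rewrite exchange_big; apply: eq_bigr => i _; rewrite mxE scaler_suml.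
  rewrite (reindex (@enum_rank J)) /=; last first.
    by exists enum_val => a _; rewrite ?enum_rankK ?enum_valK.
  by apply: eq_bigr => j _; rewrite scalerA mxE enum_rankK.
have free : row_free Mx.
  apply: inj_row_free => c cM; apply/rowP => a; rewrite mxE -(enum_valK a).
  apply: (indep (fun j => c 0 (enum_rank j))).
  by rewrite sumE cM big1 // => i _; rewrite mxE scale0r.
have [x ->] := spanned_coef (span v).
exists (fun j => ((\row_i x i) *m pinvmx Mx) 0 (enum_rank j)).
rewrite sumE mulmxKpV; first by apply: eq_bigr => i _; rewrite mxE.
by apply: submx_full; rewrite /row_full (eqP free) sJ.
Qed.

(** * The algebra is a sum of matrix algebras *)

Section SplitYBu.
Variables (F : numFieldType) (d n : nat) (d_gt0 : (0 < d)%N) (omegaF : F).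
Hypothesis d_gt1 : (1 < d)%N.
Hypothesis d_even : ~~ odd d.
Hypothesis omegaF_prim : d.-primitive_root omegaF.
Hypothesis n_gt0 : (0 < n)%N.
Local Notation K := {fraction {poly F}}.
Local Notation A := (YBu F n d_gt0).
Local Notation word := (seq letter).
Local Notation std := (std d n).
Local Notation phi := (@phi F d n d_gt0 omegaF).
Local Notation key := (key d).

Let ws := words d n n.
Let I : finType := 'I_(size ws).
Let wrd (i : I) : word := nth [::] ws i.

Let std_wrd i : std (wrd i).
Proof. by rewrite -(@mem_words d d_gt0 n) // mem_nth. Qed.

Let wrd_inj : injective wrd.
Proof.
move=> i j /eqP; rewrite nth_uniq // ?uniq_words // => /eqP; exact: val_inj.
Qed.

Definition same_shape (i j : I) : bool := perm_eq (map key (wrd i)) (map key (wrd j)).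
Definition shape_class (i : I) : {set I} := [set j | same_shape j i].

Let shape_classP i j : (shape_class i == shape_class j) = same_shape i j.
Proof.
apply/eqP/idP => [/setP/(_ i)|h].
  by rewrite !inE /same_shape perm_refl.
by apply/setP => l; rewrite !inE /same_shape (permPr h).
Qed.

Let J : finType := {p : I * I | shape_class p.1 == shape_class p.2}.

(** The index set of the matrix units has as many elements as the spanning set of
normal forms. *)
Let card_J : #|J| = ((2 * d) ^ n * n`!)%N.
Proof.
rewrite card_sig -sum1_card -(@sum_num_std d n d_gt0 n) // /num_std.
rewrite (big_nth [::]) big_mkord.
transitivity (\sum_(i : I) \sum_(j : I) same_shape j i)%N; last first.
  by apply: eq_bigr => i _; rewrite [RHS](big_nth [::]) big_mkord.
rewrite pair_big /= big_mkcond; apply: eq_bigr => -[i j] _ /=.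
by rewrite inE shape_classP /same_shape perm_sym; case: perm_eq.
Qed.

Let phi0 f w : std w -> phi 0 f w = 0.
Proof. by move=> st; rewrite -(scale0r 1) phiZ // mul0r. Qed.

Let phi_sum (T : finType) (c : T -> K) (e : T -> A) f w : std w ->
  phi (\sum_i c i *: e i) f w = \sum_i c i * phi (e i) f w.
Proof.
move=> st; elim: (index_enum T) => [|i r IH]; first by rewrite !big_nil phi0.
by rewrite !big_cons phiD // phiZ // IH.
Qed.

(** The elements E lift the matrix units. They are independent because phi separates
them, and as numerous as a spanning set, hence a basis; so phi is injective and
the relations of matrix units, which hold after phi, hold in the algebra. *)
Theorem YBu_split : split_algebra A.
Proof.
have ex (p : I * I) : exists a : A, shape_class p.1 = shape_class p.2 ->
    matrix_unit omegaF (wrd p.1) (wrd p.2) a.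
  have [h|ne] := eqVneq (shape_class p.1) (shape_class p.2); last first.
    by exists 0 => /eqP; rewrite (negbTE ne).
  move/eqP: h; rewrite shape_classP => h.
  have [a ha] := matrix_unit_exists d_gt0 d_gt1 d_even omegaF_prim
    (std_wrd p.1) (std_wrd p.2) h.
  by exists a.
have [E EP] := fin_all_exists ex.
have EJ (j : J) f x : std x -> phi (E (val j)) f x =
    (x == wrd (val j).1)%:R * f (wrd (val j).2).
  by move=> sx; apply: EP => //; apply/eqP/(valP j).
have coefE (c : J -> K) j : phi (\sum_i c i *: E (val i))
    (fun x => (x == wrd (val j).2)%:R) (wrd (val j).1) = c j.
  rewrite phi_sum // (bigD1 j) //= EJ // !eqxx !mulr1 big1 ?addr0 // => i ij.
  rewrite EJ // !(inj_eq wrd_inj); case: eqP => [e1|_]; last by rewrite mul0r mulr0.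
  case: eqP => [e2|_]; last by rewrite !mulr0.
  case/eqP: ij; apply: val_inj.
  by rewrite [LHS]surjective_pairing [RHS]surjective_pairing e1 e2.
have [s ss span] := @normal_forms_spanning F d n d_gt0 d_gt1 n_gt0.
have basis := @independent_spanning K A J s (fun j => E (val j)) span.
have {}basis : forall a : A, exists c : J -> K, a = \sum_j c j *: E (val j).
  apply: basis; first by rewrite card_J.
  by move=> c e j; rewrite -(coefE c j) e phi0.
have phi_inj a b : (forall f w, std w -> phi a f w = phi b f w) -> a = b.
  move=> h; apply/eqP; rewrite -subr_eq0; apply/eqP.
  have [c e] := basis (a - b); rewrite e; apply: big1 => j _.
  rewrite -(coefE c j) -e phiD // -scaleN1r phiZ // h // mulN1r subrr.
  by rewrite scale0r.
apply: (@matrix_units_split _ _ I _ shape_class (fun i j => E (i, j))).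
- move=> i j i' j' ij ij'; apply: phi_inj => f w sw.
  rewrite phiM // (EP (i, j)) // (EP (i', j')) //= (inj_eq wrd_inj).
  have [ji|_] := eqVneq j i'; last by rewrite phi0 // mul0r mulr0.
  by rewrite mul1r (EP (i, j')) //= ij ji ij'.
- apply: phi_inj => f w sw; rewrite phi1 //.
  have -> : \sum_i E (i, i) = \sum_i (1 : K) *: E (i, i).
    by apply: eq_bigr => i _; rewrite scale1r.
  rewrite phi_sum //; have ww : w \in ws by rewrite mem_words.
  have lw : (index w ws < size ws)%N by rewrite index_mem.
  have wo : wrd (Ordinal lw) = w by apply: nth_index.
  rewrite (bigD1 (Ordinal lw)) //= (EP (_, _)) //= big1 ?addr0 => [|i ne].
    by rewrite wo eqxx !mul1r.
  rewrite (EP (i, i)) //= -[X in X == _]wo (inj_eq wrd_inj) eq_sym (negbTE ne).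
  by rewrite mul0r mulr0.
- move=> Q Q0 QD QZ QE a; have [c ->] := basis a.
  elim/big_ind: _ => // j _; apply: QZ; rewrite [val j]surjective_pairing.
  by apply: QE; apply/eqP/(valP j).
Qed.
End SplitYBu.

Lemma primitive_root_exists (C : numClosedFieldType) m : (0 < m)%N ->
  exists z : C, m.-primitive_root z.
Proof.
move=> m_gt0; have [r] := closed_field_poly_normal ('X^m - 1 : {poly C}).
rewrite (monicP _) ?monicXnsubC // scale1r => Dp.
have uniq_r : uniq r.
  by rewrite -separable_prod_XsubC -Dp separable_Xn_sub_1 // pnatr_eq0 -lt0n.
have size_r : size r = m.
  by apply: succn_inj; rewrite -(size_prod_XsubC r id) -Dp size_XnsubC.
have roots_r : all m.-unity_root r.
  by apply/allP => z zr; rewrite /root_of_unity Dp root_prod_XsubC.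
have [z _ zp] := hasP (has_prim_root m_gt0 roots_r uniq_r (eq_leq (esym size_r))).
by exists z.
Qed.

Theorem lemma4p6 (R : realType) (d n : nat) (d_ge2 : (2 <= d)%N)
    (d_even : ~~ odd d) (n_ge2 : (2 <= n)%N) :
  split_algebra (YBu R[i] n (ltnW d_ge2)).
Proof.
have [z zp] := @primitive_root_exists R[i] d (ltnW d_ge2).
exact: (YBu_split _ d_ge2 d_even zp (ltnW n_ge2)).
Qed.
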